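(* Let $s\in(\frac12,1)$ and $n=1$. Let $\phi\in \mathcal{H}^s_0\big((-1,1)\big)$ be the first eigenfunction of $(-\Delta)^s$ on the interval $(-1,1)$, chosen strictly positive in $(-1,1)$. Then $$\phi''<0\qquad\text{in }(-1,1).$$
   Context: For $s\in(0,1)$ and $x\in\mathbb{R}^n$ the fractional Laplacian is $$(-\Delta)^s u(x)=c_{n,s}\ \mathrm{p.v.}\int_{\mathbb{R}^n}\frac{u(x)-u(y)}{|x-y|^{n+2s}}\,dy,\qquad c_{n,s}=\frac{4^s\Gamma(n/2+s)}{\pi^{n/2}|\Gamma(-s)|}.$$ $H^s(\mathbb{R}^n)$ is the set of $u\in L^2(\mathbb{R}^n)$ with $\int_{\mathbb{R}^n}\int_{\mathbb{R}^n}\frac{|u(x)-u(y)|^2}{|x-y|^{n+2s}}\,dy\,dx<\infty$. For a bounded domain $\Omega\subset\mathbb{R}^n$, $\mathcal{H}^s_0(\Omega)=\{u\in H^s(\mathbb{R}^n): u=0\text{ in }\mathbb{R}^n\setminus\Omega\}$. The operator $(-\Delta)^s$ with zero data in $\mathbb{R}^n\setminus\Omega$ (the restricted fractional Laplacian) has discrete spectrum; its first (smallest) eigenvalue $\lambda=\lambda(\Omega)>0$ is simple. A first eigenfunction is a nonzero $\phi\in\mathcal{H}^s_0(\Omega)$ satisfying (weakly) $(-\Delta)^s\phi=\lambda\phi$ in $\Omega$, i.e. $\frac{c_{n,s}}{2}\iint\frac{(\phi(x)-\phi(y))(v(x)-v(y))}{|x-y|^{n+2s}}\,dx\,dy=\lambda\int_\Omega\phi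 v$ for all $v\in\mathcal{H}^s_0(\Omega)$. It is known that $\phi$ is smooth in $\Omega$ and can be chosen strictly positive in $\Omega$; this choice is made here. *)

(* Defs.v *)
From mathcomp Require Import all_boot all_order all_algebra.
From mathcomp Require Import all_classical all_reals all_analysis.
Set Implicit Arguments.
Unset Strict Implicit.
Unset Printing Implicit Defensive.
Import Order.TTheory GRing.Theory Num.Theory.
Import numFieldNormedType.Exports.
Local Open Scope classical_set_scope.
Local Open Scope ring_scope.

Definition euler_gamma (R : realType) (z : R) : R :=
  \int[lebesgue_measure]_(t in `]0, +oo[) (t `^ (z - 1) * expR (- t)).

(* Extended to z <= 0 (z not an integer) by the functional equation
   Gamma z = Gamma (z + k) / (z (z + 1) ... (z + k - 1)), with k the least
   natural number such that 0 < z + k. *)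
Definition Gamma (R : realType) (z : R) : R :=
  let k := if 0 < z then 0%N else (Num.truncn (- z)).+1 in
  euler_gamma (z + k%:R) / \prod_(i < k) (z + i%:R).

Definition fracLap_const (R : realType) (n : nat) (s : R) : R :=
  4 `^ s * Gamma (n%:R / 2 + s) / (pi `^ (n%:R / 2) * `|Gamma (- s)|).

(* |x - y|^(n + 2 s) for n = 1; on the diagonal it is 0, where the quotients
   below take the harmless value 0 / 0 = 0. *)
Definition frac_kernel (R : realType) (s : R) (z : R * R) : R :=
  `|z.1 - z.2| `^ (1 + 2 * s).

Definition fracSobolev (R : realType) (s : R) (u : R -> R) : Prop :=
  u \in Lfun (@lebesgue_measure R) 2%:E /\
  (\int[((@lebesgue_measure R) \x (@lebesgue_measure R))%E]_z
     (`|u z.1 - u z.2| ^+ 2 / frac_kernel s z)%:E < +oo)%E.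

(* Elements of the L^2-based spaces are represented by functions, so equality
   (vanishing outside Omega, being nonzero) is understood almost everywhere. *)
Definition fracSobolev0 (R : realType) (s : R) (Omega : set R) (u : R -> R)
  : Prop :=
  fracSobolev s u /\
  {ae @lebesgue_measure R, forall x, ~ Omega x -> u x = 0}.

Definition frac_form (R : realType) (s : R) (u v : R -> R) : R :=
  fracLap_const 1 s / 2 *
  \int[((@lebesgue_measure R) \x (@lebesgue_measure R))%E]_z
    ((u z.1 - u z.2) * (v z.1 - v z.2) / frac_kernel s z).

Definition frac_eigenfunction (R : realType) (s : R) (Omega : set R)
    (lambda : R) (phi : R -> R) : Prop :=
  [/\ fracSobolev0 s Omega phi,
      ~ {ae @lebesgue_measure R, forall x, phi x = 0} &
      forall v : R -> R, fracSobolev0 s Omega v ->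
        frac_form s phi v =
        lambda * \int[lebesgue_measure]_(x in Omega) (phi x * v x)].

Definition frac_eigenvalue (R : realType) (s : R) (Omega : set R)
    (lambda : R) : Prop :=
  exists phi : R -> R, frac_eigenfunction s Omega lambda phi.

Definition first_frac_eigenvalue (R : realType) (s : R) (Omega : set R)
    (lambda : R) : Prop :=
  frac_eigenvalue s Omega lambda /\
  forall mu : R, frac_eigenvalue s Omega mu -> lambda <= mu.

Definition first_frac_eigenfunction (R : realType) (s : R) (Omega : set R)
    (phi : R -> R) : Prop :=
  exists2 lambda : R, first_frac_eigenvalue s Omega lambda &
    frac_eigenfunction s Omega lambda phi.

(* For an open set Omega, where the iterated derivatives only depend on the
   values of f in Omega. *)
Definition smooth_in (R : realType) (Omega : set R) (f : R -> R) : Prop :=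
  forall (n : nat) (x : R), Omega x -> derivable (derive1n n f) x 1.

(* Main.v *)
(** Extend the eigenfunction by zero to [f]; write S_u(x, r) = u(x+r) + u(x-r) - 2 u(x)
    and drop the constant in (-Delta)^s, so that (-Delta)^s u(x) is minus the integral of
    S_u(x, r) r^(-1-2s) over r > 0.  For s > 1/2 the finite energy makes [f] continuous up
    to the boundary (Morrey's argument on dyadic intervals), and testing the weak equation
    with small tents turns it into the pointwise equation (-Delta)^s f = L f in (-1, 1).

    Let w be the least concave majorant of [f] on [-1, 1], extended by zero.  Where w
    touches [f], (-Delta)^s w <= L w is clear.  Suppose (-Delta)^s w - L w has a positive
    maximum at a point x1 of an interval where w is affine.  Differentiating twice under
    the integral at x1, the integral of S_w(x1, r) r^(-3-2s) is nonnegative.  For an even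
    concave cap w, this sign implies s (-Delta)^s w(x1) <= w(x1), whereas s L > 1: a
    contradiction.  So w is a subsolution; by the comparison principle it is a multiple of
    [f], hence [f] = w is concave.  If f''(x1) = 0, then S_f(x1, r) = O(r^4), and the same
    two facts applied to [f] at x1 give s L <= 1, again a contradiction. *)
Require Import Defs.
From HB Require Import structures.
From mathcomp Require Import all_boot all_order all_algebra.
From mathcomp Require Import all_classical all_reals all_analysis.
From mathcomp Require Import measurable_realfun ring lra.
Set Implicit Arguments.
Unset Strict Implicit.
Unset Printing Implicit Defensive.
Import Order.TTheory GRing.Theory Num.Theory.
Import numFieldNormedType.Exports.
Local Open Scope classical_set_scope.
Local Open Scope ring_scope.

(** The same constant 1/s = 2 * integral of r^(-1-2s) over r > 1 decides both inequalities that
    contradict each other. At a maximum of the eigenfunction the zero exterior alone contributes at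
    least 1/s times the maximal value, by convexity of r^(-2s), which gives s L > 1. For a cap, the
    part r > 1 of the Laplacian costs at most w(x1)/s, and the sign hypothesis has to absorb the
    part r < 1. The obstacle is a point x1 close to 1. For |x1| <= 1/2 a cap has S_w(x1, r) <= 0 for
    all r, and the two kernels are compared across r = 1. Near the boundary S_w(x1, r) can be
    positive for large r. There the kernels are combined into 2s r^(-1-2s) - (2s+2) rho r^(-3-2s),
    with rho chosen so that this weight has integral 1 over r > 1 - x1. What remains is the sign of
    one weighted integral of w, for which monotonicity of w in |x| and the bound w(x) >= w(0) (1 -
    |x|) suffice. The second obstacle is that the maximum of (-Delta)^s w - L w must be kept away
    from the ends of an affine interval. An end inside (-1, 1) and an end at the boundary need
    different arguments. *)

Definition hidden (P : Prop) : Prop := P.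

(* [lra] slows down with the number of inequalities in the context, so the tactics
   below hide them all and use only those moved to the goal. *)
Ltac hide_inequalities :=
  repeat match goal with H : is_true ?b |- _ => change (hidden b) in H end.

Ltac goal_lra := hide_inequalities; intros; lra.

Ltac goal_nra := hide_inequalities; intros; nra.

(** * Integrals on the real line *)

Section RealIntegrable.
Context d (T : measurableType d) {R : realType} (m : {measure set T -> \bar R}).
Variables (D : set T) (mD : measurable D).
Implicit Types f g : T -> R.

Lemma integrableRD f g : m.-integrable D (EFin \o f) -> m.-integrable D (EFin \o g) ->
  m.-integrable D (EFin \o (fun x => f x + g x)).
Proof. by move=> fi gi; exact: (integrableD mD fi gi). Qed.

Lemma integrableRB f g : m.-integrable D (EFin \o f) -> m.-integrable D (EFin \o g) ->
  m.-integrable D (EFin \o (fun x => f x - g x)).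
Proof. by move=> fi gi; exact: (integrableB mD fi gi). Qed.

Lemma integrableRZ k f : m.-integrable D (EFin \o f) ->
  m.-integrable D (EFin \o (fun x => k * f x)).
Proof. by move=> fi; exact: (integrableZl mD k fi). Qed.

End RealIntegrable.

(* Locked, so that the atoms of [lra] and [ring] are not unfolded down to the
   Lebesgue integral. *)
HB.lock Definition integ (R : realType) (D : set R) (f : R -> R) : R :=
  \int[@lebesgue_measure R]_(x in D) f x.
Canonical integ_unlockable := Unlockable integ.unlock.

Definition intble (R : realType) (D : set R) (f : R -> R) : Prop :=
  (@lebesgue_measure R).-integrable D (EFin \o f).

Section RealIntegral.
Context {R : realType}.
Local Notation mu := (@lebesgue_measure R).
Implicit Types (f g F : R -> R) (D : set R) (a b e h k p q x C : R).

Lemma integE D f : integ D f = \int[mu]_(x in D) f x. Proof. by rewrite unlock. Qed.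

Lemma intble_measurable D f : intble D f -> measurable_fun D f.
Proof. by move=> /measurable_int/measurable_EFinP. Qed.

Lemma intble_le D f g : measurable D -> measurable_fun D f ->
  (forall x, D x -> `|f x| <= g x) -> intble D g -> intble D f.
Proof.
move=> mD mf fg ig; apply: le_integrable ig => //.
  exact/measurable_EFinP.
move=> x Dx /=; rewrite lee_fin (le_trans (fg _ Dx))//.
exact: ler_norm.
Qed.

Lemma intbleD D f g : measurable D -> intble D f -> intble D g ->
  intble D (fun x => f x + g x).
Proof. by move=> mD fi gi; exact: integrableRD. Qed.

Lemma intbleB D f g : measurable D -> intble D f -> intble D g ->
  intble D (fun x => f x - g x).
Proof. by move=> mD fi gi; exact: integrableRB. Qed.

Lemma intbleZ D k f : measurable D -> intble D f -> intble D (fun x => k * f x).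
Proof. by move=> mD fi; exact: integrableRZ. Qed.

Lemma intbleN D f : measurable D -> intble D f -> intble D (fun x => - f x).
Proof. by move=> mD fi; exact: (integrableN fi). Qed.

Lemma intble_norm D f : measurable D -> intble D f -> intble D (fun x => `|f x|).
Proof. by move=> mD fi; have := integrable_norm fi. Qed.

Lemma intble_eq D f g : measurable D -> (forall x, D x -> f x = g x) -> intble D f -> intble D g.
Proof.
move=> mD fg; apply: eq_integrable => // x xD /=.
by rewrite fg//; exact: set_mem.
Qed.

Lemma intbleS D E f : measurable D -> measurable E -> E `<=` D -> intble D f -> intble E f.
Proof. by move=> mD mE ED; exact: integrableS. Qed.

Lemma integ_eq D f g : (forall x, D x -> f x = g x) -> integ D f = integ D g.
Proof.
by move=> fg; rewrite !integE; apply: eq_Rintegral => x xD; rewrite fg//; exact: set_mem.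
Qed.

Lemma integ_le D f g : measurable D -> intble D f -> intble D g ->
  (forall x, D x -> f x <= g x) -> integ D f <= integ D g.
Proof. by move=> mD fi gi H; rewrite !integE; apply: le_Rintegral => // x Dx; exact: H. Qed.

Lemma integ_ge0 D f : (forall x, D x -> 0 <= f x) -> 0 <= integ D f.
Proof. by move=> H; rewrite integE; apply: Rintegral_ge0 => x Dx; exact: H. Qed.

Lemma integD D f g : measurable D -> intble D f -> intble D g ->
  integ D (fun x => f x + g x) = integ D f + integ D g.
Proof. by move=> mD fi gi; rewrite !integE RintegralD. Qed.

Lemma integB D f g : measurable D -> intble D f -> intble D g ->
  integ D (fun x => f x - g x) = integ D f - integ D g.
Proof. by move=> mD fi gi; rewrite !integE RintegralB. Qed.

Lemma integZ D k f : measurable D -> intble D f ->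
  integ D (fun x => k * f x) = k * integ D f.
Proof. by move=> mD fi; rewrite !integE RintegralZl. Qed.

Lemma integN D f : measurable D -> intble D f ->
  integ D (fun x => - f x) = - integ D f.
Proof.
move=> mD fi; rewrite -mulN1r -integZ//.
by apply: integ_eq => x _; rewrite mulN1r.
Qed.

Lemma integ_norm D f : measurable D -> intble D f ->
  `|integ D f| <= integ D (fun x => `|f x|).
Proof. by move=> mD fi; rewrite !integE; exact: le_normr_Rintegral. Qed.

Lemma intble_ge0 D f : measurable_fun D f -> (forall x, D x -> 0 <= f x) ->
  (\int[mu]_(x in D) (f x)%:E < +oo)%E -> intble D f.
Proof.
move=> mf f0 lty; apply/integrableP; split; first exact/measurable_EFinP.
rewrite (_ : integral _ _ _ = \int[mu]_(x in D) (f x)%:E)%E//.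
by apply: eq_integral => x /set_mem Dx /=; rewrite ger0_norm ?f0.
Qed.

Lemma measurable_powR_cst D (q : R) : measurable_fun D (fun r : R => r `^ q).
Proof. by apply: measurable_funTS; exact: measurable_powR. Qed.

Lemma powR_cvg_y0 (q : R) : 0 < q -> x `^ (- q) @[x --> +oo] --> (0 : R).
Proof.
move=> q0; apply/cvgrPdist_lt => e e0; near=> x.
have x0 : 0 < x by near: x; exact: nbhs_pinfty_gt.
rewrite sub0r normrN ger0_norm ?powR_ge0// powRN invf_plt ?posrE ?powR_gt0//.
have -> : e^-1 = (e^-1 `^ q^-1) `^ q.
  by rewrite -powRrM mulVf ?gt_eqF// powRr1// invr_ge0 ltW.
have ex : e^-1 `^ q^-1 < x by near: x; exact: nbhs_pinfty_gt.
by rewrite gt0_ltr_powR// ?nnegrE ?powR_ge0// ?(ltW x0).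
Unshelve. all: end_near. Qed.

Lemma is_derive_powR_prim (q x : R) : q != 0 -> 0 < x ->
  is_derive x 1 (fun r : R => r `^ q / q) (x `^ (q - 1)).
Proof.
move=> q0 x0; have H := is_derive1_powR q x0.
have -> : (fun r : R => r `^ q / q) = (fun r => q^-1 *: r `^ q).
  by apply/funext => r; rewrite /GRing.scale/= mulrC.
by apply: is_derive_eq; rewrite /GRing.scale/= mulrA mulVf// mul1r.
Qed.

Lemma powR_FTC_y (a q : R) : 0 < a -> 0 < q ->
  (\int[mu]_(r in `]a, +oo[) (r `^ (- q - 1))%:E = (a `^ (- q) / q)%:E)%E.
Proof.
move=> a0 q0.
rewrite integral_itv_obnd_cbnd; last by apply/measurable_EFinP; exact: measurable_powR_cst.
have qn0 : - q != 0 by rewrite oppr_eq0 gt_eqF.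
rewrite (@ge0_continuous_FTC2y _ _ (fun r : R => r `^ (- q) / (- q)) _ 0).
- by rewrite -EFinB; congr EFin; rewrite sub0r invrN mulrN opprK.
- by move=> x _; exact: powR_ge0.
- apply: derivable_within_continuous => x; rewrite in_itv/= andbT => ax.
  by apply: derivable_powR; rewrite in_itv/= andbT (lt_le_trans a0).
- rewrite -(mul0r (- q)^-1); apply: cvgM; [exact: powR_cvg_y0|exact: cvg_cst].
- move=> x ax; have H := is_derive_powR_prim qn0 (lt_trans a0 ax).
  exact: ex_derive.
- have H := is_derive_powR_prim qn0 a0.
  have : {for a, continuous (fun r : R => r `^ (- q) / (- q))}.
    by apply: differentiable_continuous; apply/derivable1_diffP; exact: ex_derive.
  exact: cvg_at_right_filter.
- move=> x; rewrite in_itv/= andbT => ax.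
  have H := is_derive_powR_prim qn0 (lt_trans a0 ax).
  by rewrite derive1E derive_val.
Qed.

Lemma intble_y a q : 0 < a -> 0 < q -> intble `]a, +oo[ (fun r => r `^ (- q - 1)).
Proof.
move=> a0 q0; apply: intble_ge0.
- exact: measurable_powR_cst.
- by move=> x _; exact: powR_ge0.
- by rewrite powR_FTC_y// ltry.
Qed.

Lemma integ_y a q : 0 < a -> 0 < q ->
  integ `]a, +oo[ (fun r => r `^ (- q - 1)) = a `^ (- q) / q.
Proof. by move=> a0 q0; rewrite integE /Rintegral powR_FTC_y. Qed.

Lemma FTC_oc (F f : R -> R) (a b : R) : a <= b ->
  (forall x, a <= x <= b -> is_derive x 1 F (f x)) ->
  {within `[a, b], continuous f} ->
  (\int[mu]_(x in `]a, b]) (f x)%:E = (F b - F a)%:E)%E.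
Proof.
rewrite le_eqVlt => /predU1P[->|ab] dF cf.
  by rewrite set_itvoc0 integral_set0 subrr.
have cF x : a <= x <= b -> {for x, continuous F}.
  move=> /dF H; apply: differentiable_continuous.
  by apply/derivable1_diffP; exact: ex_derive.
rewrite integral_itv_obnd_cbnd; last first.
  apply/measurable_EFinP; apply: (@measurable_funS _ _ _ _ `[a, b]%classic) => //.
    by move=> x; exact: subset_itv_oc_cc.
  exact: subspace_continuous_measurable_fun.
rewrite (@continuous_FTC2 _ _ F)//.
- split.
  + by move=> x /itvP xab; have := dF x; rewrite !xab => /(_ isT) H; exact: ex_derive.
  + by apply: cvg_at_right_filter; apply: cF; rewrite lexx ltW.
  + by apply: cvg_at_left_filter; apply: cF; rewrite lexx ltW.
- move=> x /itvP xab; have := dF x; rewrite !xab => /(_ isT) H.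
  by rewrite derive1E derive_val.
Qed.

Lemma intble_cont f a b : {within `[a, b], continuous f} -> intble `]a, b] f.
Proof.
move=> cf.
have fi : mu.-integrable `[a, b] (EFin \o f).
  by apply: continuous_compact_integrable => //; exact: segment_compact.
by apply: integrableS fi => // x; exact: subset_itv_oc_cc.
Qed.

Lemma integ_FTC (F f : R -> R) a b : a <= b ->
  (forall x, a <= x <= b -> is_derive x 1 F (f x)) ->
  {within `[a, b], continuous f} -> integ `]a, b] f = F b - F a.
Proof. by move=> ab dF cf; rewrite integE /Rintegral (FTC_oc ab dF cf). Qed.

(** Monotone convergence along the intervals []a / n.+2, a]]. A singularity at 0 is thus handled by
    bounds away from 0, where the fundamental theorem of calculus applies. *)
Lemma integral_0c_le (f : R -> R) (a C : R) : 0 < a ->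
  measurable_fun `]0, a] f -> (forall x, 0 < x <= a -> 0 <= f x) ->
  (forall e : R, 0 < e <= a -> (\int[mu]_(x in `]e, a]) (f x)%:E <= C%:E)%E) ->
  (\int[mu]_(x in `]0%R, a]) (f x)%:E <= C%:E)%E.
Proof.
move=> a0 mf f0 H.
pose D (n : nat) := [set` `]a / n.+2%:R, a]].
have aD n : 0 < a / n.+2%:R by rewrite divr_gt0.
have ndD m n : (m <= n)%N -> D m `<=` D n.
  move=> mn x; rewrite /D/= !in_itv/= => /andP[H1 ->].
  rewrite andbT (le_lt_trans _ H1)// ler_pM2l// lef_pV2 ?posrE//.
  by rewrite ler_nat !ltnS.
have DA n : D n `<=` `]0, a]%classic.
  move=> x; rewrite /D/= !in_itv/= => /andP[H1 ->].
  by rewrite andbT (lt_trans _ H1).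
have mD n : measurable (D n) by exact: measurable_itv.
pose g n := (EFin \o f) \_ (D n).
have fE x : x \in `]0, a]%classic -> limn (g ^~ x) = (f x)%:E.
  rewrite inE/= in_itv/= => /andP[x0 xa].
  apply/cvg_lim => //; apply: cvg_near_cst; near=> n.
  have an : a / x < n%:R by near: n; exact: nbhs_infty_gtr.
  rewrite /g patchE ifT// inE /D/= in_itv/= xa andbT ltr_pdivrMr// mulrC.
  by rewrite -ltr_pdivrMr// (lt_le_trans an)// ler_nat -addn2 leq_addr.
have -> : (\int[mu]_(x in `]0%R, a]) (f x)%:E = \int[mu]_(x in `]0%R, a]) limn (g ^~ x))%E.
  by apply: eq_integral => x /fE.
rewrite monotone_convergence//=; last 3 first.
- move=> n; apply/(measurable_restrict _ _ _) => //.
    exact: mD.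
  by apply/measurable_EFinP; apply: measurable_funS mf => // x [].
- move=> n x /=; rewrite in_itv/= => /f0 fx0; rewrite /g patchE.
  by case: ifPn => // _; rewrite lee_fin.
- move=> x /=; rewrite in_itv/= => /f0 fx0 m n mn; rewrite /g !patchE.
  case: ifPn => [|_]; last by case: ifPn => // _; rewrite lee_fin.
  by rewrite inE => /(ndD _ _ mn) xn; rewrite ifT// inE.
apply: lime_le.
  apply: ereal_nondecreasing_is_cvgn => m n mn.
  rewrite -!integral_mkcondr !(setIidr (@DA _)).
  apply: ge0_subset_integral => //; last exact: ndD.
  - exact: mD.
  - exact: mD.
  - by apply/measurable_EFinP; apply: measurable_funS mf => //; exact: DA.
  - by move=> x /DA /=; rewrite in_itv/= => /f0; rewrite lee_fin.
apply: nearW => n; rewrite -integral_mkcondr (setIidr (@DA _)).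
apply: H; rewrite aD/= ler_pdivrMr// ler_peMr// ?ltW// ?ltr1n//.
Unshelve. all: end_near. Qed.

Lemma powR_0_le a q : 0 < a -> 0 < q ->
  (\int[mu]_(r in `]0%R, a]) (r `^ (q - 1))%:E <= (a `^ q / q)%:E)%E.
Proof.
move=> a0 q0; apply: integral_0c_le => //.
- exact: measurable_powR_cst.
- by move=> x _; exact: powR_ge0.
move=> e /andP[e0 ea].
have dF x : e <= x <= a -> is_derive x 1 (fun r : R => r `^ q / q) (x `^ (q - 1)).
  move=> /andP[ex _]; apply: is_derive_powR_prim; first by rewrite gt_eqF.
  exact: lt_le_trans ex.
rewrite (FTC_oc ea dF).
  by rewrite lee_fin gerBl divr_ge0 ?powR_ge0// ltW.
apply: derivable_within_continuous => x; rewrite in_itv/= => /andP[ex _].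
by apply: derivable_powR; rewrite in_itv/= andbT (lt_le_trans e0).
Qed.

Lemma intble_0 a q : 0 < a -> 0 < q -> intble `]0, a] (fun r => r `^ (q - 1)).
Proof.
move=> a0 q0; apply: intble_ge0.
- exact: measurable_powR_cst.
- by move=> x _; exact: powR_ge0.
- by apply: le_lt_trans (powR_0_le a0 q0) _; rewrite ltry.
Qed.

Lemma integ_0_le a q : 0 < a -> 0 < q ->
  integ `]0, a] (fun r => r `^ (q - 1)) <= a `^ q / q.
Proof.
move=> a0 q0; rewrite integE -lee_fin fineK; first exact: powR_0_le.
by apply: integrable_fin_num => //; exact: intble_0.
Qed.

Lemma shift_itvy (h a : R) :
  [set x | `]a, +oo[%classic (x + h)] = `]a - h, +oo[%classic.
Proof. by apply/seteqP; split => x /=; rewrite !in_itv/= !andbT ltrBlDr. Qed.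

Lemma itvy_split (a b : R) : a <= b ->
  `]a, +oo[%classic = `]a, b] `|` `]b, +oo[ :> set R.
Proof.
move=> ab; apply/seteqP; split => x /=; rewrite !in_itv/= !andbT.
  by move=> ax; case: (leP x b) => xb; [left; rewrite ax|right].
by case=> [/andP[]//|]; exact: le_lt_trans.
Qed.

Lemma integ_split f a b : a <= b -> intble `]a, +oo[ f ->
  integ `]a, +oo[ f = integ `]a, b] f + integ `]b, +oo[ f.
Proof.
move=> ab fi; rewrite !integE (itvy_split ab) Rintegral_setU//.
  by rewrite -itvy_split.
apply/disj_setPS => x [/=]; rewrite !in_itv/= andbT => /andP[_ xb].
by rewrite ltNge xb.
Qed.

Lemma intble_split f a b : a <= b -> intble `]a, b] f -> intble `]b, +oo[ f ->
  intble `]a, +oo[ f.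
Proof.
move=> ab /integrableP[m1 l1] /integrableP[m2 l2].
rewrite (itvy_split ab); apply/integrableP; split.
  by apply/measurable_funU.
rewrite ge0_integral_setU//.
- by rewrite lte_add_pinfty.
- by apply: measurableT_comp => //; apply/measurable_funU.
- apply/disj_setPS => x [/=]; rewrite !in_itv/= andbT => /andP[_ xb].
  by rewrite ltNge xb.
Qed.

Lemma intble_sub f a b : a <= b -> intble `]a, +oo[ f ->
  intble `]a, b] f /\ intble `]b, +oo[ f.
Proof.
move=> ab fi; split; apply: integrableS fi => //.
  by move=> x /=; rewrite !in_itv/= andbT => /andP[].
by move=> x /=; rewrite !in_itv/= !andbT; exact: le_lt_trans.
Qed.

Lemma integ_oc a b q : 0 < a -> a <= b -> 0 < q ->
  integ `]a, b] (fun r => r `^ (- q - 1)) = (a `^ (- q) - b `^ (- q)) / q.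
Proof.
move=> a0 ab q0; have b0 := lt_le_trans a0 ab.
have := integ_split ab (intble_y a0 q0).
by rewrite !integ_y// mulrBl => ->; rewrite addrK.
Qed.

Lemma shift_preimage (h a b : R) :
  (fun x : R => x + h) @^-1` `]a, b] = `]a - h, b - h]%classic.
Proof. by apply/seteqP; split => x /=; rewrite !in_itv/= ltrBlDr lerBrDr. Qed.

Lemma measurable_shift (h : R) :
  measurable_fun [set: measurableTypeR R] (fun x : measurableTypeR R => (x + h : measurableTypeR R)).
Proof. exact: measurable_funD. Qed.

(** By uniqueness of Lebesgue measure it is enough to compare lengths of half-open intervals. *)
Lemma lebesgue_measure_shift (h : R) (A : set R) : measurable A ->
  pushforward mu ((fun x => x + h) : measurableTypeR R -> measurableTypeR R) A = mu A.
Proof.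
move=> mA; apply/esym/lebesgue_measure_unique => //.
  exact: measurable_shift.
move=> _ _ [[u v]] _ <-/=.
rewrite /pushforward shift_preimage !lebesgue_measure_itv/=.
by rewrite !lte_fin ltrD2r; case: ifPn => // _; rewrite -!EFinB; congr EFin; ring.
Qed.

Lemma ge0_integral_shift (h : R) (D : set R) (f : R -> \bar R) : measurable D ->
  measurable_fun D f -> (forall x, D x -> 0 <= f x)%E ->
  (\int[mu]_(x in D) f x = \int[mu]_(x in [set x | D (x + h)%R]) f (x + h)%R)%E.
Proof.
move=> mD mf f0; have mh := measurable_shift h.
rewrite -(@ge0_integral_pushforward _ _ _ _ R _ mh mu D f)//.
  by apply: eq_measure_integral => //= A mA _; exact/esym/lebesgue_measure_shift.
by move=> x /set_mem; exact: f0.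
Qed.

Lemma ge0_integral_opp (D : set R) (f : R -> \bar R) : measurable D ->
  measurable_fun D f -> (forall x, D x -> 0 <= f x)%E ->
  (\int[mu]_(x in D) f x = \int[mu]_(x in [set x | D (- x)%R]) f (- x)%R)%E.
Proof.
move=> mD mf f0.
have mN : measurable_fun [set: measurableTypeR R] (-%R : _ -> measurableTypeR R).
  exact: oppr_measurable.
rewrite -(@ge0_integral_pushforward _ _ _ _ R _ mN mu D f)//.
  by apply: eq_measure_integral => //= A mA _; exact/esym/lebesgue_measureN.
by move=> x /set_mem; exact: f0.
Qed.

Lemma intble_shift h D f : measurable D -> intble D f ->
  intble [set x | D (x + h)] (fun x => f (x + h)).
Proof.
move=> mD /integrableP[mf lf]; have mh := measurable_shift h.
have mD' : measurable [set x | D (x + h)].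
  rewrite (_ : [set _ | _] = setT `&` (fun x : R => x + h) @^-1` D); last by rewrite setTI.
  exact: mh.
apply/integrableP; split.
  have -> : EFin \o (fun x => f (x + h)) = (EFin \o f) \o (fun x : measurableTypeR R => (x + h : measurableTypeR R)) by [].
  apply: (@measurable_comp _ _ _ _ _ _ D) => //; last exact: measurable_funTS.
  by move=> _ [x Dx <-].
move: lf; rewrite (ge0_integral_shift h)//.
exact: measurableT_comp.
Qed.

Lemma integ_shift h D f : measurable D -> intble D f ->
  integ D f = integ [set x | D (x + h)] (fun x => f (x + h)).
Proof.
move=> mD fi; have mf := measurable_int _ fi.
rewrite !integE /Rintegral; congr fine; rewrite integralE [RHS]integralE.
rewrite (ge0_integral_shift h mD (measurable_funepos mf))//.
rewrite (ge0_integral_shift h mD (measurable_funeneg mf))//.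
by congr (_ - _)%E; apply: eq_integral => x _; rewrite ?funeposE ?funenegE.
Qed.

End RealIntegral.

(** * Concave caps *)

Section PowerInequalities.
Context {R : realType}.
Implicit Types s x d y l : R.

(** Young's inequality for the product of y^l and 1 with exponents [l^-1] and [(1 - l)^-1]: the
    concave power lies below its tangent at 1. *)
Lemma powR_le_affine y l : 0 <= y -> 0 < l < 1 -> y `^ l <= 1 - l + l * y.
Proof.
move=> y0 /andP[l0 l1].
have l1' : 0 < 1 - l by rewrite subr_gt0.
have := @conjugate_powR R (y `^ l) 1 l^-1 (1 - l)^-1.
rewrite powR_ge0 ler01 !invr_gt0 !invrK mulr1 powR1 mul1r -powRrM mulfV ?gt_eqF// powRr1//.
move=> /(_ isT isT l0 l1'); rewrite addrC subrK => /(_ erefl).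
by move=> /le_trans; apply; rewrite mulrC addrC.
Qed.

(** Used to show [1 <= weightI s rho x1]. Put r = d/x and X = x^(2s). Since d^(2s) >= X r^2, the
    claim reduces to 1 - X - r^2 (1 - X r^2) = (1 - r^2) (1 - X (1 + r^2)) >= 0, and X (1 + r^2) <=
    (x^2 + d^2)/x <= 1. *)
Lemma concave_profile_ge s x d : 1 <= 2 * s <= 2 -> 0 < d -> d <= x -> x + d = 1 ->
  d ^+ 2 * (1 - d `^ (2 * s)) <= x ^+ 2 * (1 - x `^ (2 * s)).
Proof.
move=> /andP[s1 s2] d0 dx xd.
have x0 : 0 < x by exact: lt_le_trans dx.
have x1 : x <= 1 by rewrite -xd lerDl ltW.
have X1 : x `^ (2 * s) <= x by rewrite ge1r_powR// x0.
have X0 : 0 <= x `^ (2 * s) by exact: powR_ge0.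
set X := x `^ _ in X0 X1 *.
have Rd : d = x * (d / x) by rewrite mulrCA mulfV ?mulr1// gt_eqF.
set r := d / x in Rd.
have r0 : 0 < r by rewrite divr_gt0.
have r1 : r <= 1 by rewrite ler_pdivrMr// mul1r.
have E : d `^ (2 * s) = X * r `^ (2 * s) by rewrite Rd powRM// ?(ltW x0) ?(ltW r0).
have Er : r ^+ 2 <= r `^ (2 * s).
  by rewrite -powR_mulrn ?(ltW r0)// ger_powR// r0.
have : x ^+ 2 * r ^+ 2 = d ^+ 2 by rewrite -exprMn -Rd.
rewrite E; set Z := r `^ _ in Er *; move=> Er2.
have H1 : d ^+ 2 * (1 - X * Z) <= d ^+ 2 * (1 - X * r ^+ 2).
  rewrite ler_wpM2l ?sqr_ge0// lerD2l lerN2 ler_wpM2l//.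
apply: (le_trans H1).
have H2 : X * (1 + r ^+ 2) <= 1.
  have : x * (1 + r ^+ 2) <= 1.
    rewrite -(ler_pM2l x0) mulr1 mulrA -expr2 mulrDr mulr1 Er2.
    nra.
  move=> H; apply: le_trans H; apply: ler_wpM2r => //.
  by rewrite addr_ge0// sqr_ge0.
rewrite -Er2.
rewrite -mulrA ler_wpM2l ?sqr_ge0//.
have : 0 <= (1 - r ^+ 2) * (1 - X * (1 + r ^+ 2)).
  by apply: mulr_ge0; rewrite subr_ge0// expr_le1// ltW.
by move=> H3; rewrite -subr_ge0; apply: le_trans H3 _; rewrite le_eqVlt; apply/orP; left; apply/eqP; ring.
Qed.

(** The last hypothesis of [integ_weight_far] for x1 = 1 - d, where q = x1 (1 + x1). It amounts to s
    q (1 - q) <= rho2 (s + q (1 - s)), which is clear for q >= 1; for q < 1 the affine bound on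
    d^(2s-1) replaces [rho2] by a polynomial in d. *)
Lemma tangent_value_le1 s d (rho2 := d ^+ 2 * (1 - d `^ (2 * s)))
    (q := (1 - d) * (2 - d)) : 1 / 2 < s < 1 -> 0 < d -> d < 1 / 2 ->
  (1 - s + s / q) * (1 - rho2 / q) <= 1.
Proof.
move=> /andP[s0 s1] d0 d1.
have q34 : 3 / 4 < q by rewrite /q; nra.
have q0 : 0 < q by lra.
have d2s : d `^ (2 * s) <= d * (1 - (2 * s - 1) + (2 * s - 1) * d).
  have -> : 2 * s = 1 + (2 * s - 1) by ring.
  rewrite powRD; last by rewrite (gt_eqF d0) implybT.
  rewrite powRr1 ?(ltW d0)// [1 + _ - 1]addrC addKr.
  by apply: ler_wpM2l; [exact: ltW|apply: powR_le_affine; [exact: ltW|lra]].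
have rho_ge : d ^+ 2 * ((1 - d) * (1 + (2 * s - 1) * d)) <= rho2.
  rewrite /rho2 ler_wpM2l ?sqr_ge0//.
  by rewrite -subr_ge0; move: d2s; rewrite -subr_ge0; congr (0 <= _); ring.
have -> : (1 - s + s / q) * (1 - rho2 / q) =
    ((q * (1 - s) + s) * (q - rho2)) / q ^+ 2 by field; rewrite gt_eqF.
rewrite ler_pdivrMr ?exprn_gt0// mul1r.
suff H : s * q * (1 - q) <= rho2 * (s + q * (1 - s)).
  by rewrite -subr_ge0; move: H; rewrite -subr_ge0; congr (0 <= _); ring.
have sq0 : 0 < s + q * (1 - s) by nra.
have r0 : 0 <= rho2.
  by apply: le_trans rho_ge; apply: mulr_ge0; [exact: sqr_ge0|nra].
case: (lerP 1 q) => q1.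
  apply: (@le_trans _ _ 0); last by rewrite mulr_ge0// ltW.
  by rewrite mulr_ge0_le0//; [rewrite mulr_ge0//; lra|lra].
apply: (@le_trans _ _ (d ^+ 2 * ((1 - d) * (1 + (2 * s - 1) * d)) * (s + q * (1 - s)))); last first.
  by rewrite ler_wpM2r// ltW.
have -> : s * q * (1 - q) = (1 - d) * (s * (2 - d) * (1 - q)) by rewrite /q; ring.
have -> : d ^+ 2 * ((1 - d) * (1 + (2 * s - 1) * d)) * (s + q * (1 - s)) =
  (1 - d) * (d ^+ 2 * (1 + (2 * s - 1) * d) * (s + q * (1 - s))) by ring.
apply: ler_wpM2l; first by lra.
(* Once the factor 1 - d is cancelled, the difference of the two sides is exactly the sum of the
   terms in [h1] and [h2]. *)
have h1 : 0 <= (1 - s) * d ^+ 2 * ((1 - d) * q - 2 * d * s * (1 - q)).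
  apply: mulr_ge0; first by rewrite mulr_ge0 ?sqr_ge0//; lra.
  have : d * s * (1 - q) <= 1 / 2 * 1 * (1 / 4).
    apply: ler_pM; [by nra|by lra| |by lra].
    by apply: ler_pM; lra.
  have : 1 / 2 * (3 / 4) <= (1 - d) * q by apply: ler_pM; lra.
  lra.
have h2 : 0 <= s * (1 - 2 * d) * (2 - 3 * d) by apply: mulr_ge0; [apply: mulr_ge0|]; lra.
rewrite -subr_ge0; apply: le_trans (addr_ge0 h1 h2) _.
rewrite le_eqVlt; apply/orP; left; apply/eqP; rewrite /q; ring.
Qed.

End PowerInequalities.

(** * Second differences and the fractional Laplacian of even concave caps *)

Section SecondDifference.
Context {R : realType}.
Implicit Types (s x y r t : R) (w u : R -> R).

Definition sdiff u x r : R := u (x + r) + u (x - r) - 2 * u x.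

(** Pairing x + r with x - r makes the integral absolutely convergent for bounded u that is C^2 near
    x, so no principal value is needed. *)
Definition fracLap s u x : R :=
  - integ `]0, +oo[ (fun r => sdiff u x r * r `^ (- (2 * s) - 1)).

Definition concave11 w := forall x y t, -1 <= x <= 1 -> -1 <= y <= 1 -> 0 <= t <= 1 ->
  t * w x + (1 - t) * w y <= w (t * x + (1 - t) * y).

Section ConcaveCap.
Variables (w : R -> R) (wN : forall x, w (- x) = w x) (wc : concave11 w)
  (w1 : forall x, 1 <= `|x| -> w x = 0).

Lemma cap_ge0 x : 0 <= w x.
Proof.
case: (leP 1 `|x|) => [/w1->//|]; rewrite ltr_norml => /andP[x0 x1].
have := @wc 1 (-1) ((1 + x) / 2).
have -> : (1 + x) / 2 * 1 + (1 - (1 + x) / 2) * (-1) = x by field.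
have -> : w (-1) = 0 by rewrite w1// normrN normr1.
have -> : w 1 = 0 by rewrite w1// normr1.
rewrite !mulr0 addr0; apply; lra.
Qed.

(** x is a convex combination of y and -y, where the even function w takes the same value. *)
Lemma cap_le x y : `|x| <= `|y| -> w y <= w x.
Proof.
move=> xy; case: (leP 1 `|y|) => [/w1->|]; first exact: cap_ge0.
wlog y0 : y xy / 0 <= y.
  case: (leP 0 y) => [y0|y0] H; first exact: H.
  by rewrite -(wN y) -(normrN y); apply: H; rewrite ?normrN// oppr_ge0 ltW.
rewrite (ger0_norm y0) => y1; move: xy; rewrite (ger0_norm y0) ler_norml => /andP[x0 x1].
move: y0; rewrite le_eqVlt => /predU1P[y0|y0].
  have -> : x = y by lra.
  by [].
have := @wc y (- y) ((x + y) / (2 * y)).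
have -> : (x + y) / (2 * y) * y + (1 - (x + y) / (2 * y)) * - y = x by field; rewrite gt_eqF.
rewrite wN -mulrDl [_ + (1 - _)]addrC subrK mul1r; apply; first lra.
  lra.
rewrite divr_ge0/=; [|lra|lra].
by rewrite ler_pdivrMr; lra.
Qed.

Lemma cap_ge_tent x : `|x| <= 1 -> w 0 * (1 - `|x|) <= w x.
Proof.
wlog x0 : x / 0 <= x.
  case: (leP 0 x) => [x0|x0] H; first exact: H.
  by rewrite -(wN x) -normrN; apply: H; rewrite oppr_ge0 ltW.
rewrite (ger0_norm x0) => x1.
have := @wc 1 0 x; rewrite (@w1 1) ?normr1// !mulr0 mulr1 add0r addr0 mulrC; apply; lra.
Qed.

Lemma cap_sdiff_le0 x r : 0 <= r -> -1 <= x - r -> x + r <= 1 -> sdiff w x r <= 0.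
Proof.
move=> r0 xr1 xr2; have := @wc (x + r) (x - r) (1 / 2).
have -> : 1 / 2 * (x + r) + (1 - 1 / 2) * (x - r) = x by field.
rewrite /sdiff => H.
have : 1 / 2 * w (x + r) + (1 - 1 / 2) * w (x - r) <= w x by apply: H; lra.
lra.
Qed.

Lemma powR_shift2 s r : 0 < r -> r `^ (- (2 * s + 2) - 1) = r `^ (- (2 * s) - 1) / r ^+ 2.
Proof.
move=> r0; have -> : - (2 * s + 2) - 1 = (- (2 * s) - 1) + (- 2%:R) by ring.
rewrite powRD; last by rewrite (gt_eqF r0) implybT.
by rewrite [r `^ (- 2%:R)]powRN powR_mulrn// ltW.
Qed.

(** Here S <= 0 for all r > 0. The kernel r^(-2s-3) dominates r^(-2s-1) on (0, 1], so the sign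
    hypothesis makes the integral of S r^(-2s-1) over (0, 1] nonnegative. On r > 1 the bound S >= -2
    w(x1) costs exactly w(x1)/s. *)
Lemma cap_fracLap_le_inner s x1 (S := sdiff w x1) : 1 / 2 < s < 1 -> 0 <= x1 ->
  x1 <= 1 / 2 ->
  intble `]0, +oo[ (fun r => S r * r `^ (- (2 * s) - 1)) ->
  intble `]0, +oo[ (fun r => S r * r `^ (- (2 * s + 2) - 1)) ->
  0 <= integ `]0, +oo[ (fun r => S r * r `^ (- (2 * s + 2) - 1)) ->
  s * fracLap s w x1 <= w x1.
Proof.
move=> hs x10 x12 i1 i3 S3.
have s0 : 0 < 2 * s by case/andP: hs; lra.
have x11 : x1 < 1 by lra.
(* For r > 1 - x1 concavity on [-1, 1] says nothing, but then w(x1 + r) = 0 and x1 <= 1/2 gives 2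
   w(x1) >= w(0) >= w(x1 - r) by the tent bound. *)
have S0 r : 0 < r -> S r <= 0.
  move=> r0; case: (leP (x1 + r) 1) => xr.
    apply: cap_sdiff_le0; lra.
  have h1 : w (x1 - r) <= w 0 by apply: cap_le; rewrite normr0.
  have := @cap_ge_tent x1; rewrite (ger0_norm x10) => /(_ (ltW x11)) h2.
  have h3 : w 0 * (1 / 2) <= w 0 * (1 - x1) by apply: ler_wpM2l; [exact: cap_ge0|lra].
  by rewrite /S /sdiff (@w1 (x1 + r)) ?ger0_norm; lra.
have iy := @intble_y R 1 (2 * s) ltr01 s0.
have := integ_y (@ltr01 R) s0; rewrite powR1 div1r => Iy.
have [i1a i1b] := intble_sub (@ler01 R) i1.
have [i3a i3b] := intble_sub (@ler01 R) i3.
rewrite /fracLap (integ_split (@ler01 R) i1).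
move: S3; rewrite (integ_split (@ler01 R) i3) => S3'.
have h1 : integ `]0, 1] (fun r => S r * r `^ (- (2 * s + 2) - 1)) <= integ `]0, 1] (fun r => S r * r `^ (- (2 * s) - 1)).
  apply: integ_le => // r /=; rewrite in_itv/= => /andP[r0 r1].
  apply: ler_wnM2l; first exact: S0.
  rewrite powR_shift2// ler_pdivlMr ?exprn_gt0// ler_piMr ?powR_ge0//.
  by rewrite expr_le1// ltW.
have h2 : integ `]1, +oo[ (fun r => S r * r `^ (- (2 * s + 2) - 1)) <= 0.
  rewrite -oppr_ge0 -integN//; apply: integ_ge0 => r /=.
  rewrite in_itv/= andbT => r1; rewrite oppr_ge0 mulr_le0_ge0 ?powR_ge0//.
  by apply: S0; lra.
have h3 : - (2 * w x1) * (2 * s)^-1 <= integ `]1, +oo[ (fun r => S r * r `^ (- (2 * s) - 1)).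
  rewrite -Iy -integZ//; apply: integ_le => //.
    exact: intbleZ.
  move=> r _; apply: ler_wpM2r; first exact: powR_ge0.
  by rewrite /S /sdiff; have := cap_ge0 (x1 + r); have := cap_ge0 (x1 - r); lra.
have s0' : 0 < s by case/andP: hs; lra.
have h4 : - (2 * w x1) * (2 * s)^-1 = - (w x1 / s) by field; rewrite gt_eqF.
have h5 : w x1 = s * (w x1 / s) by field; rewrite gt_eqF.
rewrite [leRHS]h5; apply: ler_wpM2l; first exact: ltW.
move: h3; rewrite h4; move: (w x1 / s) => f h3; lra.
Qed.

(** g is a weight that changes sign from negative to positive at m, and G is its tail integral. On
    each of the pieces cut out by d, x1, max(x1, m) and 1 + x1, the factor w(x1 - r) is compared
    with a constant or with a tent of height w(0). The resulting lower bounds, all multiples of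
    w(0), add up to at least zero. *)
Lemma cap_weighted_ge0 (g G : R -> R) d m x1 : 0 < d -> d <= x1 -> d <= m -> m <= 1 ->
  x1 <= 1 ->
  (forall r, 0 < r -> r <= m -> g r <= 0) -> (forall r, 0 < r -> m <= r -> 0 <= g r) ->
  (forall a, 0 < a -> intble `]a, +oo[ g) ->
  (forall a, 0 < a -> integ `]a, +oo[ g = G a) -> G d = 1 -> 1 <= G x1 ->
  (forall a, x1 <= a -> m <= a -> a <= 1 + x1 ->
    intble `]a, 1 + x1] (fun r => (r - x1) * g r) /\
    integ `]a, 1 + x1] (fun r => (r - x1) * g r) <= 1 - G (1 + x1)) ->
  intble `]d, +oo[ (fun r => w (x1 - r) * g r) ->
  0 <= integ `]d, +oo[ (fun r => w (x1 - r) * g r).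
Proof.
move=> d0 dx1 dm m1 x11 g_le0 g_ge0 ig Ig Gd Gx1 Hfar iV.
have x10 : 0 < x1 by exact: lt_le_trans dx1.
have igc a b : 0 < a -> a <= b -> intble `]a, b] g.
  by move=> a0 ab; have [] := intble_sub ab (ig _ a0).
have Igc a b : 0 < a -> a <= b -> integ `]a, b] g = G a - G b.
  move=> a0 ab; have b0 := lt_le_trans a0 ab.
  by have := integ_split ab (ig _ a0); rewrite !Ig// => ->; rewrite addrK.
have w00 : 0 <= w 0 by exact: cap_ge0.
have ww0 x : w x <= w 0 by apply: cap_le; rewrite normr0.
have [iV1 iV2] := intble_sub dx1 iV.
rewrite (integ_split dx1 iV).
(* [rr] is max(x1, m): g is nonpositive on []x1, rr]], which may be empty, and nonnegative after
   it. *)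
have [rr [x1r mr r1 rrx]] : exists rr, [/\ x1 <= rr, m <= rr, rr <= 1 + x1 &
    forall r, x1 < r -> r <= rr -> r <= m].
  exists (Num.max x1 m); split; rewrite ?le_max ?ge_max ?lexx ?orbT//.
    by apply/andP; split; lra.
  by move=> r xr; rewrite le_max leNgt xr.
have rr0 : 0 < rr by exact: lt_le_trans x1r.
have [iV3 iV4] := intble_sub x1r iV2.
have [iV5 iV6] := intble_sub r1 iV4.
rewrite (integ_split x1r iV2) (integ_split r1 iV4).
have B1 : w 0 * (1 - G x1) <= integ `]d, x1] (fun r => w (x1 - r) * g r).
  (* As r increases to x1, w(x1 - r) increases. If [W0] is its value where g changes sign (or w(0)
     when m > x1), then (w(x1 - r) - W0) g(r) >= 0 throughout. *)
  have [W0 [HW1 HW2 HW3]] : exists W0, [/\ W0 <= w 0,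
      forall r, 0 < r -> r <= x1 -> r <= m -> w (x1 - r) <= W0 &
      forall r, 0 < r -> r <= x1 -> m < r -> W0 <= w (x1 - r)].
    case: (leP m x1) => mx1.
      exists (w (x1 - m)); split=> // r r0 rx1 rm;
        by apply: cap_le; rewrite !ger0_norm; move: r0 rx1 rm mx1; goal_lra.
    exists (w 0); split=> // r r0 rx1 mr'; by move: (lt_le_trans mr' rx1); rewrite ltNge ltW.
  apply: (@le_trans _ _ (W0 * (1 - G x1))).
    by apply: ler_wnM2r; [lra|].
  rewrite -Gd -Igc// -integZ//; last exact: igc.
  apply: integ_le => //; first by apply: intbleZ => //; exact: igc.
  move=> r /=; rewrite in_itv/= => /andP[dr rx].
  have r0 : 0 < r by exact: lt_trans dr.
  case: (leP r m) => rm.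
    by apply: ler_wnM2r; [exact: g_le0|exact: HW2].
  by apply: ler_wpM2r; [apply: g_ge0 => //; exact: ltW|exact: HW3].
have B2 : w 0 * (G x1 - G rr) <= integ `]x1, rr] (fun r => w (x1 - r) * g r).
  rewrite -Igc// -integZ//; last exact: igc.
  apply: integ_le => //; first by apply: intbleZ => //; exact: igc.
  move=> r /=; rewrite in_itv/= => /andP[xr rrr].
  apply: ler_wnM2r; last exact: ww0.
  by apply: g_le0; [exact: lt_trans xr|exact: rrx].
have B4 : 0 <= integ `]1 + x1, +oo[ (fun r => w (x1 - r) * g r).
  apply: integ_ge0 => r /=; rewrite in_itv/= andbT => xr.
  by apply: mulr_ge0; [exact: cap_ge0|apply: g_ge0; move: xr x10 m1; goal_lra].
have [if1 If1] := Hfar rr x1r mr r1.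
(* The tent bound w(x1 - r) >= w(0) (1 - (r - x1)) against a nonnegative g; the linear part is what
   [Hfar] controls. *)
have B3 : w 0 * (G rr - G (1 + x1)) - w 0 * (1 - G (1 + x1))
   <= integ `]rr, 1 + x1] (fun r => w (x1 - r) * g r).
  apply: (@le_trans _ _ (w 0 * (G rr - G (1 + x1)) -
      w 0 * integ `]rr, 1 + x1] (fun r => (r - x1) * g r))).
    by rewrite lerD2l lerN2; exact: ler_wpM2l.
  rewrite -Igc// -!integZ//; last exact: igc.
  have im := igc _ _ rr0 r1.
  rewrite -integB//; [|exact: intbleZ..].
  apply: integ_le => //; first by apply: intbleB => //; exact: intbleZ.
  move=> r /=; rewrite in_itv/= => /andP[rr1 rx].
  have g0 : 0 <= g r by apply: g_ge0; move: rr0 rr1 mr; goal_lra.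
  have h1 : w 0 * (1 - (r - x1)) <= w (x1 - r).
    have := @cap_ge_tent (x1 - r); rewrite ler0_norm; last by move: rr1 x1r; goal_lra.
    by rewrite opprB; apply; move: rx; goal_lra.
  by have := ler_wpM2r g0 h1; goal_lra.
move: (ler_wpM2l w00 Gx1) B1 B2 B3 B4; goal_lra.
Qed.

End ConcaveCap.

(** For rho >= 0 and a nonnegative integral of S against r^(-2s-3), integrating S against this
    weight gives at most -2s times the Laplacian. A lower bound for the weighted integral therefore
    bounds the Laplacian from above. *)
Definition weight s rho r : R :=
  2 * s * r `^ (- (2 * s) - 1) - (2 * s + 2) * rho * r `^ (- (2 * s + 2) - 1).

(* The primitive of [- weight s rho] that vanishes at infinity. *)
Definition weightI s rho r : R := r `^ (- (2 * s)) - rho * r `^ (- (2 * s + 2)).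

Section Weight.
Variables (s rho : R).
Hypotheses (s0 : 0 < s) (rho0 : 0 <= rho).

Let s20 : 0 < 2 * s. Proof. by rewrite mulr_gt0. Qed.
Let s22 : 0 < 2 * s + 2. Proof. by rewrite addr_gt0. Qed.

Lemma weightE r : 0 < r ->
  weight s rho r = r `^ (- (2 * s) - 1) * (2 * s - (2 * s + 2) * rho / r ^+ 2).
Proof. by move=> r0; rewrite /weight powR_shift2//; ring. Qed.

Lemma weightIE r : 0 < r -> weightI s rho r = r `^ (- (2 * s)) * (1 - rho / r ^+ 2).
Proof.
move=> r0; rewrite /weightI; have -> : - (2 * s + 2) = - (2 * s) + - 2%:R by ring.
rewrite powRD; last by rewrite (gt_eqF r0) implybT.
by rewrite [r `^ (- 2%:R)]powRN powR_mulrn ?(ltW r0)//; ring.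
Qed.

Lemma intble_weight a : 0 < a -> intble `]a, +oo[ (weight s rho).
Proof.
by move=> a0; apply: intbleB => //; apply: intbleZ => //; exact: intble_y.
Qed.

Lemma integ_weight a : 0 < a -> integ `]a, +oo[ (weight s rho) = weightI s rho a.
Proof.
move=> a0; rewrite integB//; do ?by apply: intbleZ => //; exact: intble_y.
rewrite !integZ//; do ?exact: intble_y.
by rewrite !integ_y// /weightI; field; rewrite !gt_eqF.
Qed.

Lemma weight_sign m r : 0 <= m -> m ^+ 2 = (2 * s + 2) * rho / (2 * s) -> 0 < r ->
  (r <= m -> weight s rho r <= 0) /\ (m <= r -> 0 <= weight s rho r).
Proof.
move=> m0 m2 r0; rewrite weightE//; split=> rm.
  rewrite mulr_ge0_le0 ?powR_ge0// subr_le0 ler_pdivlMr ?exprn_gt0//.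
  by rewrite mulrC -ler_pdivlMr// -m2 ler_pXn2r ?nnegrE ?(ltW r0).
rewrite mulr_ge0 ?powR_ge0// subr_ge0 ler_pdivrMr ?exprn_gt0//.
by rewrite [2 * s * _]mulrC -ler_pdivrMr// -m2 ler_pXn2r ?nnegrE ?(ltW r0).
Qed.

End Weight.

Lemma powRN2 r : 0 < r -> r `^ (-2) = (r ^+ 2)^-1.
Proof. by move=> r0; rewrite [r `^ (-2)]powRN (powR_mulrn 2)// ltW. Qed.

(* The right-hand side is the tangent at y = 1/q of the concave function
   (1 - s + s y)(1 - rho y), in the variable y = r^-2. *)
Lemma weightI_le_tangent s rho q r : 0 < s < 1 -> 0 <= rho -> 0 < r -> rho <= r ^+ 2 ->
  weightI s rho r <= (1 - s + s / q) * (1 - rho / q) +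
    (s - rho * (1 - s) - 2 * s * rho / q) * ((r ^+ 2)^-1 - q^-1).
Proof.
move=> s01 rho0 r0 rr2; rewrite weightIE//.
have -> : r `^ (- (2 * s)) = ((r ^+ 2)^-1) `^ s.
  by rewrite -powRN2// -powRrM; congr powR; ring.
have y0 : 0 < (r ^+ 2)^-1 by rewrite invr_gt0 exprn_gt0.
have ry : rho * (r ^+ 2)^-1 <= 1 by rewrite ler_pdivrMr ?exprn_gt0// mul1r.
move: (r ^+ 2)^-1 (q^-1) y0 ry => y z y0 ry.
have ys : y `^ s <= 1 - s + s * y by apply: powR_le_affine => //; exact: ltW.
apply: (@le_trans _ _ ((1 - s + s * y) * (1 - rho * y))).
  by apply: ler_wpM2r => //; rewrite subr_ge0.
have s0 : 0 <= s by case/andP: s01 => /ltW.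
have := mulr_ge0 (mulr_ge0 s0 rho0) (sqr_ge0 (y - z)).
clear; lra.
Qed.

(** Write G for [weightI s rho]. Integration by parts turns the claim into (a - x1) G(a) + integral
    of G over [a, 1 + x1] <= 1. Replacing G by its tangent bound in r^-2 gives something that is at
    most the integral of that bound over all of [x1, 1 + x1], which equals its value at r^2 = q. *)
Lemma integ_weight_far s rho x1 a (q := x1 * (1 + x1)) : 0 < s < 1 -> 0 <= rho ->
  0 < x1 -> x1 <= a -> a <= 1 + x1 -> rho <= a ^+ 2 ->
  0 <= s - rho * (1 - s) - 2 * s * rho / q ->
  (1 - s + s / q) * (1 - rho / q) <= 1 ->
  intble `]a, 1 + x1] (fun r => (r - x1) * weight s rho r) /\
  integ `]a, 1 + x1] (fun r => (r - x1) * weight s rho r) <= 1 - weightI s rho (1 + x1).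
Proof.
move=> s01 rho0 x10 xa a1 rhoa; rewrite {}/q.
have q0 : x1 * (1 + x1) != 0 by rewrite mulf_neq0 ?gt_eqF// addr_gt0.
have a0 : 0 < a by exact: lt_le_trans xa.
have le_ar r : a <= r -> rho <= r ^+ 2.
  move=> ar; apply: (le_trans rhoa); rewrite ler_pXn2r ?nnegrE ?(ltW a0)//.
  by rewrite (le_trans (ltW a0)).
have HG r : a <= r -> _ := fun ar =>
  @weightI_le_tangent s rho (x1 * (1 + x1)) r s01 rho0 (lt_le_trans a0 ar) (le_ar r ar).
move: (s - _ - _) ((1 - s + _) * _) HG => hp h0 HG hp0 h01.
have cweight : {within `[a, 1 + x1], continuous (fun r => (r - x1) * weight s rho r)}.
  apply: derivable_within_continuous => r; rewrite in_itv/= => /andP[ar _].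
  have r0 : 0 < r by exact: lt_le_trans ar.
  have D4 := is_derive1_powR (- (2 * s) - 1) r0.
  have D5 := is_derive1_powR (- (2 * s + 2) - 1) r0.
  by rewrite /weight; exact: ex_derive.
split; first exact: intble_cont.
(* [N] is a primitive of the tangent bound. The mean of r^-2 over [x1, 1 + x1] is 1/(x1 (1 + x1)),
   which is why the tangent is taken there: the slope term cancels and [N] grows by exactly [h0]. *)
pose N r : R := (h0 - hp / (x1 * (1 + x1))) * r - hp * r `^ (-1).
pose F r : R := N r - (r - x1) * weightI s rho r.
pose f r : R := h0 + hp * (r `^ (-2) - (x1 * (1 + x1))^-1) - weightI s rho r +
  (r - x1) * weight s rho r.
have dF r : a <= r <= 1 + x1 -> is_derive r 1 F (f r).
  move=> /andP[ar _]; have r0 : 0 < r by exact: lt_le_trans ar.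
  have D1 := is_derive1_powR (-1) r0.
  have D2 := is_derive1_powR (- (2 * s)) r0.
  have D3 := is_derive1_powR (- (2 * s + 2)) r0.
  rewrite /F /N /weightI /f /weight /weightI; apply: is_derive_eq.
  have -> : -1 - 1 = -2 :> R by ring.
  by rewrite /GRing.scale/=; ring.
have cf : {within `[a, 1 + x1], continuous f}.
  apply: derivable_within_continuous => r; rewrite in_itv/= => /andP[ar _].
  have r0 : 0 < r by exact: lt_le_trans ar.
  have D1 := is_derive1_powR (-2) r0.
  have D2 := is_derive1_powR (- (2 * s)) r0.
  have D3 := is_derive1_powR (- (2 * s + 2)) r0.
  have D4 := is_derive1_powR (- (2 * s) - 1) r0.
  have D5 := is_derive1_powR (- (2 * s + 2) - 1) r0.
  by rewrite /f /weight /weightI; exact: ex_derive.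
apply: (@le_trans _ _ (integ `]a, 1 + x1] f)).
  apply: integ_le => //; [exact: intble_cont|exact: intble_cont|].
  move=> r /=; rewrite in_itv/= => /andP[ar _].
  rewrite /f lerDr subr_ge0 powRN2; last exact: lt_trans ar.
  exact: HG (ltW ar).
rewrite (integ_FTC a1 dF cf).
(* As [hp] is nonnegative, the tangent bound decreases in r, so (a - x1) times its value at a is at
   most its integral over [x1, a]. *)
have Nlow : (a - x1) * weightI s rho a <= N a - N x1.
  apply: (@le_trans _ _ ((a - x1) * (h0 + hp * ((a ^+ 2)^-1 - (x1 * (1 + x1))^-1)))).
    by rewrite ler_wpM2l ?subr_ge0// HG.
  rewrite /N !powR_inv1 ?(ltW a0) ?(ltW x10)//.
  rewrite -subr_ge0 (_ : _ - _ = hp * ((a - x1) ^+ 2 / (x1 * a ^+ 2))).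
    by rewrite mulr_ge0// divr_ge0 ?sqr_ge0// mulr_ge0 ?sqr_ge0// ltW.
  by field; rewrite !gt_eqF// addr_gt0.
have Nq : N (1 + x1) - N x1 = h0.
  rewrite /N !powR_inv1 ?(ltW x10)//; last by rewrite addr_ge0// ltW.
  by field; rewrite !gt_eqF// addr_gt0.
rewrite /F addrK mul1r opprB; move: Nlow Nq h01; clear.
move: (N _) (N _) (N _) (weightI s rho a) (weightI _ _ _) => *; lra.
Qed.

Lemma tangent_slope_ge0 s x1 rho : 1 / 2 < s < 1 -> 1 / 2 < x1 ->
  rho <= 3 / 16 -> 0 <= rho -> 0 <= s - rho * (1 - s) - 2 * s * rho / (x1 * (1 + x1)).
Proof.
move=> /andP[s0 s1] x1h r316 r0.
have q34 : 3 / 4 <= x1 * (1 + x1) by nra.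
have q43 : (x1 * (1 + x1))^-1 <= 4 / 3.
  by rewrite -[4 / 3]invf_div lef_pV2 ?posrE; lra.
have := @ler_wpM2l _ (s * rho) _ _ _ q43; rewrite mulr_ge0//; last by lra.
move=> /(_ isT); nra.
Qed.

Section ConcaveCapOuter.
Variables (w : R -> R) (wN : forall x, w (- x) = w x) (wc : concave11 w)
  (w1 : forall x, 1 <= `|x| -> w x = 0).

(** S is integrated against [weight s rho]. On (0, d], with d = 1 - x1, both S and the weight are
    nonpositive. For r > d the value w(x1 + r) is zero, so S = w(x1 - r) - 2 w(x1); the weight has
    integral 1 there, so the second term contributes -2 w(x1) and the first is nonnegative by
    [cap_weighted_ge0]. Hence -2s times the Laplacian is at least -2 w(x1). *)
Lemma cap_fracLap_le_outer s x1 (S := sdiff w x1) : 1 / 2 < s < 1 -> 1 / 2 < x1 ->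
  x1 < 1 ->
  intble `]0, +oo[ (fun r => S r * r `^ (- (2 * s) - 1)) ->
  intble `]0, +oo[ (fun r => S r * r `^ (- (2 * s + 2) - 1)) ->
  0 <= integ `]0, +oo[ (fun r => S r * r `^ (- (2 * s + 2) - 1)) ->
  s * fracLap s w x1 <= w x1.
Proof.
move=> hs x12 x11 i1 i3 S3.
have [s12 s1] := andP hs.
have s0 : 0 < s by lra.
have [d dE] : {d | d = 1 - x1} by exists (1 - x1).
have d0 : 0 < d by lra.
have d12 : d < 1 / 2 by lra.
have x10 : 0 < x1 by lra.
(* This choice makes [weightI s rho d = 1]. *)
have [rho rhoE] : {rho | rho = d ^+ 2 * (1 - d `^ (2 * s))} by eexists.
have ds0 : 0 < d `^ (2 * s) by exact: powR_gt0.
have dsd : d `^ (2 * s) <= d by rewrite ge1r_powR ?d0//; lra.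
have ds2 : d ^+ 2 <= d `^ (2 * s).
  by rewrite -powR_mulrn ?(ltW d0)// ger_powR ?d0//; lra.
have rho0 : 0 <= rho by rewrite rhoE mulr_ge0 ?sqr_ge0//; lra.
have rho1 : rho <= d ^+ 2 by rewrite rhoE ler_piMr ?sqr_ge0//; lra.
(* From d^(2s) >= d^2, rho <= y (1 - y) with y = d^2 <= 1/4, and y (1 - y) is increasing up to
   1/4. *)
have rho316 : rho <= 3 / 16.
  have d14 : d ^+ 2 <= 1 / 4 by nra.
  have h1 : 0 <= (1 / 4 - d ^+ 2) * (3 / 4 - d ^+ 2) by apply: mulr_ge0; lra.
  have h2 : rho <= d ^+ 2 * (1 - d ^+ 2).
    by rewrite rhoE ler_wpM2l ?sqr_ge0//; lra.
  lra.
(* [m] is the zero of [weight s rho]. It lies in [d, 1]: at least d because d^(2s) <= d < 1/2, at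
   most 1 because rho <= 3/16. *)
have [m [m0 m2]] : exists m, 0 <= m /\ m ^+ 2 = (2 * s + 2) * rho / (2 * s).
  exists (Num.sqrt ((2 * s + 2) * rho / (2 * s))); split; first exact: sqrtr_ge0.
  by rewrite sqr_sqrtr// divr_ge0// ?mulr_ge0//; move: s0; goal_lra.
have dm : d <= m.
  rewrite -(ler_pXn2r (n := 2)) ?nnegrE ?(ltW d0)// m2 ler_pdivlMr; last by lra.
  have -> : (2 * s + 2) * rho = d ^+ 2 * ((2 * s + 2) * (1 - d `^ (2 * s))).
    by rewrite rhoE; ring.
  rewrite ler_wpM2l ?sqr_ge0//.
  have : 0 <= (2 * s + 2) * (1 / 2 - d `^ (2 * s)) by apply: mulr_ge0; move: s0 d12 dsd; goal_lra.
  move: s1; goal_lra.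
have m1 : m <= 1.
  rewrite -(ler_pXn2r (n := 2)) ?nnegrE// m2 ler_pdivrMr; last by lra.
  by rewrite expr1n mul1r; nra.
have rho_m : rho <= m ^+ 2.
  by rewrite m2 ler_pdivlMr; [nra|lra].
have Gd : weightI s rho d = 1.
  rewrite weightIE// powRN rhoE [X in 1 - X]mulrAC mulfV ?mul1r ?subKr ?mulVf ?gt_eqF//.
  by rewrite exprn_gt0.
have Gx1 : 1 <= weightI s rho x1.
  rewrite weightIE// powRN ler_pdivlMl ?powR_gt0// mulr1.
  have : rho <= x1 ^+ 2 * (1 - x1 `^ (2 * s)).
    by rewrite rhoE; apply: concave_profile_ge; move: s12 s1 d0 d12 x12 dE; goal_lra.
  rewrite mulrC -ler_pdivrMr ?exprn_gt0//; goal_lra.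
have far a : x1 <= a -> m <= a -> a <= 1 + x1 ->
    intble `]a, 1 + x1] (fun r => (r - x1) * weight s rho r) /\
    integ `]a, 1 + x1] (fun r => (r - x1) * weight s rho r) <= 1 - weightI s rho (1 + x1).
  move=> xa ma a1; apply: integ_weight_far => //; first by lra.
  - apply: (le_trans rho_m); rewrite ler_pXn2r ?nnegrE//; move: m0 ma xa x10; goal_lra.
  - exact: tangent_slope_ge0.
  - have -> : x1 * (1 + x1) = (1 - d) * (2 - d) by rewrite dE; ring.
    by rewrite rhoE; exact: tangent_value_le1.
have iS : intble `]0, +oo[ (fun r => S r * weight s rho r).
  apply: (@intble_eq _ _ (fun r => 2 * s * (S r * r `^ (- (2 * s) - 1)) -
     (2 * s + 2) * rho * (S r * r `^ (- (2 * s + 2) - 1)))) => //.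
    by move=> r _; rewrite /weight; ring.
  by apply: intbleB => //; exact: intbleZ.
have iw := @intble_weight s rho s0 d d0.
have [iSd iSy] := intble_sub (ltW d0) iS.
have SE r : d < r -> w (x1 - r) * weight s rho r =
    S r * weight s rho r + 2 * w x1 * weight s rho r.
  move=> dr; have xr : 1 <= `|x1 + r| by rewrite ger0_norm; move: dr dE d0 x10; goal_lra.
  by rewrite /S /sdiff (w1 xr); ring.
have iV : intble `]d, +oo[ (fun r => w (x1 - r) * weight s rho r).
  apply: (@intble_eq _ _ (fun r => S r * weight s rho r + 2 * w x1 * weight s rho r)) => //.
    by move=> r /=; rewrite in_itv/= andbT => /SE.
  by apply: intbleD => //; exact: intbleZ.
have wsign := @weight_sign s rho s0 m.
have dx1 : d <= x1 by move: d12 x12; goal_lra.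
have H : 0 <= integ `]d, +oo[ (fun r => w (x1 - r) * weight s rho r).
  apply: (@cap_weighted_ge0 w wN wc w1 (weight s rho) (weightI s rho) d m x1) => //.
  - exact: ltW.
  - by move=> r r0 rm; have [->] := wsign r m0 m2 r0.
  - by move=> r r0 rm; have [_ ->] := wsign r m0 m2 r0.
  - by move=> a a0; exact: intble_weight.
  - by move=> a a0; exact: integ_weight.
have h2 : integ `]d, +oo[ (fun r => w (x1 - r) * weight s rho r) =
    integ `]d, +oo[ (fun r => S r * weight s rho r) + 2 * w x1.
  have -> : 2 * w x1 = 2 * w x1 * integ `]d, +oo[ (weight s rho).
    by rewrite integ_weight// Gd mulr1.
  rewrite -integZ// -integD//; last exact: intbleZ.
  by apply: integ_eq => r /=; rewrite in_itv/= andbT => /SE.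
have h1 : 0 <= integ `]0, d] (fun r => S r * weight s rho r).
  apply: integ_ge0 => r /=; rewrite in_itv/= => /andP[r0 rd].
  apply: mulr_le0; last by have [->//] := wsign r m0 m2 r0; exact: le_trans dm.
  by apply: cap_sdiff_le0 => //; move: r0 rd d12 x12 dE; goal_lra.
have E : integ `]0, d] (fun r => S r * weight s rho r) +
    integ `]d, +oo[ (fun r => S r * weight s rho r) = - (2 * s) * fracLap s w x1 -
    (2 * s + 2) * rho * integ `]0, +oo[ (fun r => S r * r `^ (- (2 * s + 2) - 1)).
  rewrite -integ_split ?(ltW d0)//.
  rewrite /fracLap mulrNN -!integZ// -integB//; [|exact: intbleZ..].
  by apply: integ_eq => r _; rewrite /weight /S; ring.
have c0 : 0 <= (2 * s + 2) * rho by rewrite mulr_ge0//; move: s0; goal_lra.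
have := mulr_ge0 c0 S3; move: E h1 h2 H; clear.
move: (integ `]0, d] _) (integ `]d, +oo[ _) (integ `]d, +oo[ _) (_ * _ * integ _ _).
move: (fracLap _ _ _) (w x1) => *; lra.
Qed.

Lemma cap_fracLap_le s x1 (S := sdiff w x1) : 1 / 2 < s < 1 -> 0 <= x1 < 1 ->
  intble `]0, +oo[ (fun r => S r * r `^ (- (2 * s) - 1)) ->
  intble `]0, +oo[ (fun r => S r * r `^ (- (2 * s + 2) - 1)) ->
  0 <= integ `]0, +oo[ (fun r => S r * r `^ (- (2 * s + 2) - 1)) ->
  s * fracLap s w x1 <= w x1.
Proof.
move=> hs /andP[x10 x11]; case: (leP x1 (1 / 2)) => x12.
  exact: cap_fracLap_le_inner.
exact: cap_fracLap_le_outer.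
Qed.

End ConcaveCapOuter.
End SecondDifference.

(** * Laplacian near a flat point *)

Section KernelDifferences.
Context {R : realType}.
Implicit Types (f g : R -> R) (h r q t x : R).

Lemma derive_ge0_le f g h : 0 <= h ->
  (forall t, 0 <= t <= h -> is_derive t 1 f (g t)) ->
  (forall t, 0 <= t <= h -> 0 <= g t) -> f 0 <= f h.
Proof.
rewrite le_eqVlt => /predU1P[<-//|h0] df g0.
have [||c] := @MVT R f g 0 h h0.
- by move=> x /itvP xh; apply: df; rewrite !xh.
- apply: derivable_within_continuous => x; rewrite in_itv/= => /df H.
  exact: ex_derive.
- move=> /itvP ch; rewrite subr0 => E.
  by rewrite -subr_ge0 E mulr_ge0 ?(ltW h0)// g0 ?ch.
Qed.

Lemma second_derive_ge0 (f g k : R -> R) h : 0 <= h -> f 0 = 0 -> g 0 = 0 ->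
  (forall t, 0 <= t <= h -> is_derive t 1 f (g t)) ->
  (forall t, 0 <= t <= h -> is_derive t 1 g (k t)) ->
  (forall t, 0 <= t <= h -> 0 <= k t) -> 0 <= f h.
Proof.
move=> h0 f0 g0 df dg k0; rewrite -f0; apply: (derive_ge0_le h0 df) => t /andP[t0 th].
rewrite -g0; apply: (derive_ge0_le t0 (g := k)) => u /andP[u0 ut].
  by apply: dg; rewrite u0 (le_trans ut).
by apply: k0; rewrite u0 (le_trans ut).
Qed.

Lemma is_derive_powR_add (a c t : R) : 0 < c + t ->
  is_derive t 1 (fun t => (c + t) `^ a) (a * (c + t) `^ (a - 1)).
Proof.
move=> ct; have H := is_derive1_powR a ct.
have D := is_deriveD (is_derive_cst c t 1) (is_derive_id t (1 : R)).
by have := is_derive1_comp (f := fun y : R => y `^ a) (g := cst c + @id R) H D; rewrite add0r mulr1.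
Qed.

Lemma is_derive_powR_sub (a c t : R) : 0 < c - t ->
  is_derive t 1 (fun t => (c - t) `^ a) (- (a * (c - t) `^ (a - 1))).
Proof.
move=> ct; have H := is_derive1_powR a ct.
have D := is_deriveB (is_derive_cst c t 1) (is_derive_id t (1 : R)).
by have := is_derive1_comp (f := fun y : R => y `^ a) (g := cst c - @id R) H D; rewrite sub0r mulrN1.
Qed.

(** For a >= 0, (r + t) (r - t) <= r^2 gives a lower bound on the product of the two outer powers,
    and the arithmetic-geometric mean inequality finishes. The second alternative takes the place of
    a sign hypothesis on a. *)
Lemma powR_midpoint (a r t : R) : 0 <= t -> t < r ->
  2 * r `^ (- a) <= (r + t) `^ (- a) + (r - t) `^ (- a) \/ a < 0.
Proof.
move=> t0 tr; case: (ltP a 0) => a0; [by right|left].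
have r0 : 0 < r by exact: le_lt_trans tr.
have rt0 : 0 < r - t by rewrite subr_gt0.
have rt1 : 0 < r + t by rewrite ltr_pwDl.
have AB : r `^ (- a) ^+ 2 <= (r + t) `^ (- a) * (r - t) `^ (- a).
  rewrite -powRM ?(ltW rt0) ?(ltW rt1)// -[_ ^+ 2]/(_ * _) -powRM ?(ltW r0)//.
  rewrite !powRN lef_pV2 ?posrE ?powR_gt0 ?mulr_gt0//.
  apply: ge0_ler_powR => //; rewrite ?nnegrE ?mulr_ge0 ?(ltW r0) ?(ltW rt0) ?(ltW rt1)//.
  by rewrite -subr_ge0 (_ : _ - _ = t ^+ 2); [exact: sqr_ge0|ring].
have := powR_ge0 r (- a); have := powR_ge0 (r + t) (- a); have := powR_ge0 (r - t) (- a).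
move: (r `^ _) ((r + t) `^ _) ((r - t) `^ _) AB => X A B AB B0 A0 X0.
rewrite -(ler_pXn2r (n := 2)) ?nnegrE ?mulr_ge0 ?addr_ge0//.
have := sqr_ge0 (A - B); nra.
Qed.

Section Bounds.
Variables (q r h : R).
Hypotheses (q0 : 0 < q) (h0 : 0 <= h) (hr : h < r).
Local Notation D := ((r + h) `^ (- q - 1) + (r - h) `^ (- q - 1) - 2 * r `^ (- q - 1)).

Let r0 : 0 < r. Proof. exact: le_lt_trans hr. Qed.

Let dfst K t : 0 <= t <= h ->
  is_derive t 1 (fun t => (r + t) `^ (- q - 1) + (r - t) `^ (- q - 1) -
      2 * r `^ (- q - 1) - K * (t * t))
   (- (q + 1) * (r + t) `^ (- q - 2) + (q + 1) * (r - t) `^ (- q - 2) - K * (2 * t)).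
Proof.
move=> /andP[t0 th].
have D1 : 0 < r + t by rewrite ltr_pwDl.
have D2 : 0 < r - t by rewrite subr_gt0 (le_lt_trans th).
have E1 := is_derive_powR_add (- q - 1) D1.
have E2 := is_derive_powR_sub (- q - 1) D2.
apply: is_derive_eq.
rewrite /GRing.scale/= (_ : - q - 1 - 1 = - q - 2); last by ring.
ring.
Qed.

Let dsnd K t : 0 <= t <= h ->
  is_derive t 1 (fun t => - (q + 1) * (r + t) `^ (- q - 2) + (q + 1) * (r - t) `^ (- q - 2) -
      K * (2 * t))
   ((q + 1) * (q + 2) * ((r + t) `^ (- (q + 2) - 1) + (r - t) `^ (- (q + 2) - 1)) - 2 * K).
Proof.
move=> /andP[t0 th].
have D1 : 0 < r + t by rewrite ltr_pwDl.
have D2 : 0 < r - t by rewrite subr_gt0 (le_lt_trans th).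
have E1 := is_derive_powR_add (- q - 2) D1.
have E2 := is_derive_powR_sub (- q - 2) D2.
apply: is_derive_eq.
rewrite /GRing.scale/= (_ : - q - 2 - 1 = - (q + 2) - 1); last by ring.
ring.
Qed.

(** The second derivative of the kernel is itself convex, so its values at r + t and r - t sum to at
    least twice its value at r. *)
Lemma kernel_sdiff_ge : h ^+ 2 * ((q + 1) * (q + 2) * r `^ (- (q + 2) - 1)) <= D.
Proof.
rewrite -subr_ge0.
pose K := (q + 1) * (q + 2) * r `^ (- (q + 2) - 1).
have := @second_derive_ge0 _ _ _ h h0 _ _ (@dfst K) (@dsnd K).
rewrite /= !addr0 !subr0 !mulr0 subr0.
have -> : D - h ^+ 2 * K = D - K * (h * h) by ring.
apply; [ring|ring|] => t /andP[t0 th].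
have tr : t < r by exact: le_lt_trans hr.
have [H|] := powR_midpoint (q + 2 + 1) t0 tr; last by have := q0; lra.
rewrite (_ : - (q + 2) - 1 = - (q + 2 + 1)); last by ring.
rewrite /K mulrCA -mulrBr mulr_ge0//; first by rewrite mulr_ge0// addr_ge0// ltW.
by rewrite subr_ge0 (_ : - (q + 2) - 1 = - (q + 2 + 1))//; ring.
Qed.

(** The second derivative of the kernel is decreasing, so on [r - h, r + h] it is at most its value
    at r - h. *)
Lemma kernel_sdiff_le : D <= h ^+ 2 * ((q + 1) * (q + 2) * (r - h) `^ (- (q + 2) - 1)).
Proof.
rewrite -subr_ge0.
pose K := (q + 1) * (q + 2) * (r - h) `^ (- (q + 2) - 1).
have d1 t : 0 <= t <= h -> _ := fun th => is_deriveN (@dfst K t th).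
have d2 t : 0 <= t <= h -> _ := fun th => is_deriveN (@dsnd K t th).
have := @second_derive_ge0 _ _ _ h h0 _ _ d1 d2.
rewrite /= !opprfctE /= !addr0 !subr0 !mulr0 subr0.
have -> : h ^+ 2 * K - D = - (D - K * (h * h)) by ring.
apply; [ring|ring|] => t /andP[t0 th].
have c0 : 0 <= (q + 1) * (q + 2) by rewrite mulr_ge0// addr_ge0// ltW.
have rh0 : 0 < r - h by rewrite subr_gt0.
have dec y : r - h <= y -> y `^ (- (q + 2) - 1) <= (r - h) `^ (- (q + 2) - 1).
  move=> ry; have y0 : 0 < y by exact: lt_le_trans ry.
  rewrite (_ : - (q + 2) - 1 = - (q + 2 + 1)); last by ring.
  rewrite !powRN lef_pV2 ?posrE ?powR_gt0//.
  apply: ge0_ler_powR; rewrite ?nnegrE ?(ltW y0) ?(ltW rh0)//.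
  by rewrite !addr_ge0// ltW.
have e1 : r - h <= r + t by have := h0; lra.
have e2 : r - h <= r - t by have := h0; lra.
rewrite oppr_ge0 subr_le0 /K mulrCA; apply: ler_wpM2l => //.
by have := dec _ e1; have := dec _ e2; lra.
Qed.
End Bounds.


Lemma ge0_of_small (F : R -> R) (A : R) (e : R) : 0 < e -> F x @[x --> 0^'+] --> 0 ->
  (forall h, 0 < h -> h <= e -> 0 <= A + F h) -> 0 <= A.
Proof.
move=> e0 F0 H; rewrite -[A]addr0.
apply: (@ler_cvg_to _ (0^'+) _ R (fun=> 0) (fun h => A + F h)) => //.
- exact: cvg_cst.
- by apply: cvgD => //; exact: cvg_cst.
- near=> h; apply: H; first by near: h; exact: nbhs_right_gt.
  by near: h; apply: nbhs_right_le.
Unshelve. all: end_near. Qed.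

Lemma intble_bounded (D : set R) f g (B : R) : measurable D -> measurable_fun D f ->
  (forall x, D x -> `|f x| <= B) -> (forall x, D x -> 0 <= g x) -> intble D g ->
  intble D (fun x => f x * g x).
Proof.
move=> mD mf fB g0 ig; apply: (@intble_le _ _ _ (fun x => B * g x)) => //.
- by apply: measurable_funM => //; exact: intble_measurable.
- by move=> x Dx; rewrite normrM (ger0_norm (g0 _ Dx)) ler_wpM2r ?g0 ?fB.
- exact: intbleZ.
Qed.

Lemma cont_measurable (D : set R) f : continuous f -> measurable D -> measurable_fun D f.
Proof.
by move=> cf mD; apply: measurable_funTS; exact: continuous_measurable_fun.
Qed.

Lemma sdiff_continuous (u : R -> R) x : continuous u -> continuous (sdiff u x).
Proof.
move=> cu r; rewrite /sdiff; apply: cvgB; last exact: cvg_cst.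
apply: cvgD; apply: continuous_comp; try exact: cu.
  by apply: cvgD; [exact: cvg_cst|exact: cvg_id].
by apply: cvgB; [exact: cvg_cst|exact: cvg_id].
Qed.

Lemma intble_sdiff_tail (u : R -> R) x B a q : continuous u -> (forall y, `|u y| <= B) ->
  0 < a -> 0 < q -> intble `]a, +oo[ (fun r => sdiff u x r * r `^ (- q - 1)).
Proof.
move=> cu uB a0 q0; apply: (@intble_bounded _ _ _ (4 * B)) => //.
- by apply: cont_measurable => //; exact: sdiff_continuous.
- move=> r _; rewrite /sdiff.
  have := uB (x + r); have := uB (x - r); have := uB x; rewrite !ler_norml.
  by move=> /andP[? ?] /andP[? ?] /andP[? ?]; apply/andP; split; lra.
- by move=> r _; exact: powR_ge0.
- exact: intble_y.
Qed.

Lemma intble_sdiff (u : R -> R) x B C a q p : continuous u -> (forall y, `|u y| <= B) ->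
  0 < a -> 0 < q -> 0 < p -> (forall r, 0 < r <= a -> `|sdiff u x r| <= C * r `^ (p + q)) ->
  intble `]0, +oo[ (fun r => sdiff u x r * r `^ (- q - 1)).
Proof.
move=> cu uB a0 q0 p0 H; apply: (intble_split (ltW a0)); last exact: intble_sdiff_tail.
apply: (@intble_le _ _ _ (fun r => C * r `^ (p - 1))) => //.
- apply: measurable_funM; last exact: measurable_powR_cst.
  by apply: cont_measurable => //; exact: sdiff_continuous.
- move=> r /=; rewrite in_itv/= => /andP[r0 ra].
  rewrite normrM (ger0_norm (powR_ge0 _ _)).
  have := H r; rewrite r0 ra => /(_ isT) Hr.
  apply: (le_trans (ler_wpM2r (powR_ge0 _ _) Hr)).
  rewrite -mulrA -powRD ?(gt_eqF r0) ?implybT//.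
  by rewrite (_ : p + q + (- q - 1) = p - 1)//; ring.
- by apply: intbleZ => //; exact: intble_0.
Qed.

End KernelDifferences.

(** * Moving a second difference of the Laplacian onto the kernel *)

Section LaplacianDifference.
Context {R : realType}.
Implicit Types (u T : R -> R) (h r q x e B C M : R).

(** Trades a second difference in x for one in r, which translations of the integration variable can
    move onto the kernel. The price is the term in [sdiff u x h]. *)
Lemma sdiff_sdiff u x h r :
  sdiff u (x + h) r + sdiff u (x - h) r - 2 * sdiff u x r =
  sdiff u x (r + h) + sdiff u x (r - h) - 2 * sdiff u x r - 2 * sdiff u x h.
Proof.
rewrite /sdiff.
have -> : x + h + r = x + (r + h) by ring.
have -> : x + h - r = x - (r - h) by ring.
have -> : x - h + r = x + (r - h) by ring.
have -> : x - h - r = x - (r + h) by ring.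
ring.
Qed.

Lemma continuous_addr u h : continuous u -> continuous (fun r => u (r + h)).
Proof.
move=> cu r; apply: (@continuous_comp _ _ _ (fun r => r + h) u); last exact: cu.
by apply: cvgD; [exact: cvg_id|exact: cvg_cst].
Qed.

(** Translation turns the second difference of T into that of the kernel, which is about h^2 (q + 1)
    (q + 2) r^(-q-3). The translated integrals start at different points. They are brought to the
    common start 5h either by discarding a range where T <= 0 or at the cost of -T <= C r^4. *)
Lemma integ_sdiff_tail_le T q e h M C : 0 < q -> 0 < h -> 8 * h <= e ->
  continuous T -> (forall r, `|T r| <= M) ->
  (forall r, 0 < r -> r <= e -> T r <= 0) ->
  (forall r, 0 < r -> r <= e -> - T r <= C * r ^+ 4) ->
  integ `]4 * h, +oo[ (fun r => (T (r + h) + T (r - h) - 2 * T r) * r `^ (- q - 1)) <=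
  h ^+ 2 * ((q + 1) * (q + 2)) * (integ `]5 * h, +oo[ (fun r => T r * r `^ (- (q + 2) - 1))
    + M * (((e - h) `^ (- (q + 2)) - e `^ (- (q + 2))) / (q + 2)))
    + 2 * (C * (5 * h) ^+ 4) * ((4 * h) `^ (- q) / q).
Proof.
move=> q0 h0 he cT TM T0 TC.
have q20 : 0 < q + 2 by rewrite addr_gt0.
pose k r := r `^ (- q - 1); pose k3 r := r `^ (- (q + 2) - 1).
have c0 : 0 <= h ^+ 2 * ((q + 1) * (q + 2)).
  by rewrite mulr_ge0 ?sqr_ge0// mulr_ge0// addr_ge0// ltW.
have M0 : 0 <= M by exact: le_trans (TM 0).
have e0 : 0 < e by lra.
have C0 : 0 <= C.
  have := TC e e0 (lexx e); have := T0 e e0 (lexx e).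
  move=> h1 h2; have : 0 <= C * e ^+ 4 by lra.
  by rewrite pmulr_lge0// exprn_gt0.
have mT (D : set R) : measurable D -> measurable_fun D T by exact: cont_measurable.
have ik (a : R) : 0 < a -> intble `]a, +oo[ k by move=> a0; exact: intble_y.
have ik3 (a : R) : 0 < a -> intble `]a, +oo[ k3 by move=> a0; exact: intble_y.
have bnd (f : R -> R) (a : R) : 0 < a -> measurable_fun `]a, +oo[ f -> (forall r, 0 <= f r) ->
    intble `]a, +oo[ f -> intble `]a, +oo[ (fun r => T r * f r).
  move=> a0 mf f0 fi; apply: (@intble_bounded _ _ _ _ M) => //; first exact: mT.
have iTk (a : R) : 0 < a -> intble `]a, +oo[ (fun r => T r * k r).
  move=> a0; apply: bnd => //; last exact: ik.
    exact: measurable_powR_cst.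
  by move=> r; exact: powR_ge0.
have iTk3 (a : R) : 0 < a -> intble `]a, +oo[ (fun r => T r * k3 r).
  move=> a0; apply: bnd => //; last exact: ik3.
    exact: measurable_powR_cst.
  by move=> r; exact: powR_ge0.
have iks (a b : R) : b < a -> intble `]a, +oo[ (fun r => k (r - b)).
  move=> ba; have := @intble_shift R (- b) `]a - b, +oo[%classic k.
  rewrite shift_itvy opprK subrK; apply => //.
  by apply: ik; rewrite subr_gt0.
have ik3s (a b : R) : b < a -> intble `]a, +oo[ (fun r => k3 (r - b)).
  move=> ba; have := @intble_shift R (- b) `]a - b, +oo[%classic k3.
  rewrite shift_itvy opprK subrK; apply => //.
  by apply: ik3; rewrite subr_gt0.
have iTks (a b : R) : 0 < a -> b < a -> intble `]a, +oo[ (fun r => T r * k (r - b)).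
  move=> a0 ba; apply: bnd => //; [|by move=> r; exact: powR_ge0|exact: iks].
  by apply: intble_measurable; exact: iks.
have i4 : 0 < 4 * h by lra.
have i5 : 0 < 5 * h by lra.
have i3 : 0 < 3 * h by lra.
have sA : integ `]5 * h, +oo[ (fun r => T r * k (r - h)) =
    integ `]4 * h, +oo[ (fun r => T (r + h) * k r).
  rewrite (@integ_shift R h)//; last by apply: iTks; move: h0; goal_lra.
  rewrite shift_itvy (_ : 5 * h - h = 4 * h); last by ring.
  by apply: integ_eq => r _; rewrite addrK.
have iA : intble `]4 * h, +oo[ (fun r => T (r + h) * k r).
  have := @intble_shift R h `]5 * h, +oo[%classic (fun r => T r * k (r - h)).
  rewrite shift_itvy (_ : 5 * h - h = 4 * h); last by ring.
  move=> H; apply: intble_eq (H _ _) => //; first by move=> r _; rewrite addrK.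
  by apply: iTks; move: h0; goal_lra.
have iB3 : intble `]3 * h, +oo[ (fun r => T r * k (r - - h)) by apply: iTks; move: h0; goal_lra.
have sB : integ `]3 * h, +oo[ (fun r => T r * k (r - - h)) =
    integ `]4 * h, +oo[ (fun r => T (r - h) * k r).
  rewrite (@integ_shift R (- h))//.
  rewrite shift_itvy (_ : 3 * h - - h = 4 * h); last by ring.
  by apply: integ_eq => r _; rewrite opprK subrK.
have iB : intble `]4 * h, +oo[ (fun r => T (r - h) * k r).
  have := @intble_shift R (- h) `]3 * h, +oo[%classic (fun r => T r * k (r - - h)).
  rewrite shift_itvy (_ : 3 * h - - h = 4 * h); last by ring.
  by move=> H; apply: intble_eq (H _ _) => //; move=> r _; rewrite opprK subrK.
have h35 : 3 * h <= 5 * h by lra.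
have h45 : 4 * h <= 5 * h by lra.
(* The part over []3 * h, 5 * h]] is nonpositive because T is, and is dropped. *)
have lB : integ `]4 * h, +oo[ (fun r => T (r - h) * k r) <=
    integ `]5 * h, +oo[ (fun r => T r * k (r - - h)).
  rewrite -sB (integ_split h35 iB3) gerDr.
  rewrite -oppr_ge0 -integN//; last by have [] := intble_sub h35 iB3.
  apply: integ_ge0 => r /=; rewrite in_itv/= => /andP[r3 r5].
  by rewrite -mulNr mulr_ge0 ?powR_ge0// oppr_ge0; apply: T0; move: r3 r5 h0 he; goal_lra.
have lC : - integ `]4 * h, +oo[ (fun r => T r * k r) <=
    - integ `]5 * h, +oo[ (fun r => T r * k r) + C * (5 * h) ^+ 4 * ((4 * h) `^ (- q) / q).
  have [iC1 iC2] := intble_sub h45 (iTk _ i4).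
  rewrite (integ_split h45 (iTk _ i4)) opprD addrC lerD2l.
  have [ik1 ik2] := intble_sub h45 (ik _ i4).
  apply: (@le_trans _ _ (C * (5 * h) ^+ 4 * integ `]4 * h, 5 * h] k)).
    rewrite -integN// -integZ//; apply: integ_le => //.
    - exact: intbleN.
    - exact: intbleZ.
    move=> r /=; rewrite in_itv/= => /andP[r4 r5].
    rewrite -mulNr ler_wpM2r ?powR_ge0//.
    apply: (@le_trans _ _ (C * r ^+ 4)); first by apply: TC; move: r4 r5 h0 he; goal_lra.
    by rewrite ler_wpM2l// lerXn2r ?nnegrE//; move: r4 r5 h0; goal_lra.
  apply: ler_wpM2l; first by rewrite mulr_ge0// exprn_ge0// ltW.
  rewrite -(integ_y i4 q0) (integ_split h45 (ik _ i4)) lerDl.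
  by apply: integ_ge0 => r _; exact: powR_ge0.
have -> : integ `]4 * h, +oo[ (fun r => (T (r + h) + T (r - h) - 2 * T r) * k r) =
   integ `]4 * h, +oo[ (fun r => T (r + h) * k r) + integ `]4 * h, +oo[ (fun r => T (r - h) * k r)
   - 2 * integ `]4 * h, +oo[ (fun r => T r * k r).
  rewrite -integD// -integZ//; last exact: iTk.
  rewrite -integB//; [|exact: intbleD|by apply: intbleZ => //; exact: iTk].
  by apply: integ_eq => r _; ring.
have mainI : integ `]5 * h, +oo[ (fun r => T r * k (r - h)) +
    integ `]5 * h, +oo[ (fun r => T r * k (r - - h)) -
    2 * integ `]5 * h, +oo[ (fun r => T r * k r) <=
    h ^+ 2 * ((q + 1) * (q + 2)) * (integ `]5 * h, +oo[ (fun r => T r * k3 r)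
    + M * (((e - h) `^ (- (q + 2)) - e `^ (- (q + 2))) / (q + 2))).
  have j1 : intble `]5 * h, +oo[ (fun r => T r * k (r - h)) by apply: iTks; move: h0; goal_lra.
  have j2 : intble `]5 * h, +oo[ (fun r => T r * k (r - - h)) by apply: iTks; move: h0; goal_lra.
  have j3 := iTk _ i5.
  have j12 : intble `]5 * h, +oo[ (fun r => T r * k (r - h) + T r * k (r - - h)) by exact: intbleD.
  have j4 : intble `]5 * h, +oo[ (fun r => 2 * (T r * k r)) by exact: intbleZ.
  rewrite -integD// -integZ// -integB//.
  have j := intbleB _ j12 j4.
  have he5 : 5 * h <= e by move: he h0; goal_lra.
  have [ja jb] := intble_sub he5 (j (measurable_itv _)).
  rewrite (integ_split he5 (j (measurable_itv _))) (integ_split he5 (iTk3 _ i5)).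
  have [ta tb] := intble_sub he5 (iTk3 _ i5).
  rewrite -addrA mulrDr; apply: lerD.
    rewrite -integZ//; apply: integ_le => //; first exact: intbleZ.
    move=> r /=; rewrite in_itv/= => /andP[r5 re].
    have hr : h < r by move: r5 h0; goal_lra.
    have D := kernel_sdiff_ge q0 (ltW h0) hr.
    have Tr : T r <= 0 by apply: T0; move: r5 re h0; goal_lra.
    by have := ler_wnM2l Tr D; rewrite /k /k3 opprK; goal_lra.
  (* Beyond e the sign of T is unknown. Writing T = M - (M - T), the upper kernel bound is applied
     to M and the lower one to M - T; the mismatch is M times a difference of kernels that tends to
     0 with h. *)
  have he1 : h < e by move: he h0; goal_lra.
  have eh : 0 < e - h by rewrite subr_gt0.
  have kk : intble `]e, +oo[ (fun r => k3 (r - h) - k3 r).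
    by apply: intbleB => //; [exact: ik3s|exact: ik3].
  have -> : ((e - h) `^ (- (q + 2)) - e `^ (- (q + 2))) / (q + 2) =
      integ `]e, +oo[ (fun r => k3 (r - h) - k3 r).
    rewrite integB//; [|exact: ik3s|exact: ik3].
    rewrite mulrBl -!integ_y//; congr (_ - _).
    rewrite (@integ_shift R (- h) `]e - h, +oo[%classic)//; last exact: ik3.
    by rewrite shift_itvy opprK subrK.
  have tt : intble `]e, +oo[ (fun r => T r * k3 r + M * (k3 (r - h) - k3 r)).
    by apply: intbleD => //; exact: intbleZ.
  rewrite -integZ// -integD//; last exact: intbleZ.
  rewrite -integZ//; apply: integ_le => //; first exact: intbleZ.
  move=> r /=; rewrite in_itv/= andbT => er.
  have hr : h < r by move: er he h0; goal_lra.
  have D1 := kernel_sdiff_ge q0 (ltW h0) hr.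
  have D2 := kernel_sdiff_le q0 (ltW h0) hr.
  have := TM r; rewrite ler_norml => /andP[_ TM2].
  have f1 : 0 <= M - T r by rewrite subr_ge0.
  rewrite -subr_ge0 in D1; have e1 := mulr_ge0 f1 D1.
  have e2 := ler_wpM2l M0 D2.
  by rewrite /k /k3 opprK; move: e1 e2; goal_lra.
move: sA lB lC mainI => <-; rewrite mulrDr.
move: (integ _ _) (integ _ _) (integ _ _) (integ _ _) (integ _ _) (_ * _ * integ _ _) .
goal_lra.
Qed.
End LaplacianDifference.

(** * Sign of the r^(-3-2s) integral at a flat point *)

Section FlatLaplacian.
Context {R : realType}.
Implicit Types (u T : R -> R) (h r q x e B C M : R).

Lemma exprMpowR r n (a : R) : 0 < r -> r ^+ n * r `^ a = r `^ (n%:R + a).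
Proof.
by move=> r0; rewrite -powR_mulrn ?ltW// -powRD// (gt_eqF r0) implybT.
Qed.

(** The bound u''(x) = O(|x - x1|^2) expressed by second differences, so that it covers affine
    pieces (with C = 0) as well as smooth functions whose second derivative vanishes at a
    maximum. *)
Definition flat_at u x1 e C := forall x r, `|x - x1| <= e -> 0 < r -> r <= e ->
  `|sdiff u x r| <= C * (`|x - x1| + r) ^+ 2 * r ^+ 2.

Lemma flat_intble u s x1 e B C x : 0 < s < 1 -> continuous u ->
  (forall x, `|u x| <= B) -> 0 < e -> flat_at u x1 e C -> `|x - x1| <= e ->
  intble `]0, +oo[ (fun r => sdiff u x r * r `^ (- (2 * s) - 1)).
Proof.
move=> /andP[s0 s1] cu uB e0 uflat xe.
apply: (@intble_sdiff _ _ _ B (C * (e + e) ^+ 2) e (2 * s) (2 - 2 * s)) => //; [lra|lra|].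
move=> r /andP[r0 re].
have C0 : 0 <= C.
  have := uflat _ _ xe e0 (lexx e) => H; have := le_trans (normr_ge0 _) H.
  rewrite -mulrA pmulr_lge0// mulr_gt0// exprn_gt0//.
  by rewrite ltr_wpDl.
rewrite subrK powR_mulrn ?(ltW r0)//; apply: (le_trans (uflat _ _ xe r0 re)).
rewrite ler_wpM2r ?sqr_ge0// ler_wpM2l// lerXn2r ?nnegrE ?addr_ge0 ?(ltW r0) ?(ltW e0)//.
exact: lerD.
Qed.

Lemma flat_intble3 u s x1 e B C : 0 < s < 1 -> continuous u ->
  (forall x, `|u x| <= B) -> 0 < e -> flat_at u x1 e C ->
  intble `]0, +oo[ (fun r => sdiff u x1 r * r `^ (- (2 * s + 2) - 1)).
Proof.
move=> /andP[s0 s1] cu uB e0 uflat.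
have xx1 : `|x1 - x1| <= e by rewrite subrr normr0 ltW.
apply: (@intble_sdiff _ _ _ B C e (2 * s + 2) (2 - 2 * s)) => //; [lra|lra|].
move=> r /andP[r0 re].
rewrite (_ : 2 - 2 * s + (2 * s + 2) = 4%:R); last by ring.
rewrite powR_mulrn ?(ltW r0)//; apply: (le_trans (uflat _ _ xx1 r0 re)).
by rewrite subrr normr0 add0r -mulrA -exprD.
Qed.

(** Difference quotients avoid any differentiability assumption on the Laplacian. The second
    difference of [fracLap s u] at x1 is at least -h^2 (c2 I + o(1)) and at most C h^4, where I is
    the integral in question. Dividing by h^2 and letting h tend to 0 leaves c2 I >= 0. *)
Lemma integ_flat_ge0 u s x1 e B C : 0 < s < 1 -> continuous u ->
  (forall x, `|u x| <= B) -> 0 < e -> flat_at u x1 e C ->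
  (forall r, 0 < r -> r <= e -> sdiff u x1 r <= 0) ->
  (forall h, 0 < h -> h <= e -> sdiff (fracLap s u) x1 h <= C * h ^+ 4) ->
  0 <= integ `]0, +oo[ (fun r => sdiff u x1 r * r `^ (- (2 * s + 2) - 1)).
Proof.
move=> hs cu uB e0 uflat T0 HL; have /andP[s0 s1] := hs.
have xx1 : `|x1 - x1| <= e by rewrite subrr normr0 ltW.
have q0 : 0 < 2 * s by rewrite mulr_gt0.
have p0 : 0 < 2 - 2 * s by lra.
have q20 : 0 < 2 * s + 2 by lra.
have C0 : 0 <= C.
  have := uflat _ _ xx1 e0 (lexx e) => H; have := le_trans (normr_ge0 _) H.
  by rewrite subrr normr0 add0r -mulrA pmulr_lge0// mulr_gt0// exprn_gt0.
have B0 : 0 <= B by exact: le_trans (uB 0).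
set I := integ _ _.
pose c2 := (2 * s + 1) * (2 * s + 2).
have c20 : 0 < c2 by rewrite mulr_gt0// addr_gt0.
pose p := 2 - 2 * s.
have [c5 [c5E c50]] : exists c5 : R, 5 ^+ 4 = c5 /\ 0 <= c5.
  by exists (5 ^+ 4); rewrite exprn_ge0.
pose om h := ((e - h) `^ (- (2 * s + 2)) - e `^ (- (2 * s + 2))) / (2 * s + 2).
(* One summand for each error of order h^(2+p), with p = 2 - 2s: the range r <= 4h ([L1]), the
   correction in [sdiff u x1 h] ([L5]), the shifted limits ([L3]), and the range r <= 5h missing
   from [I] ([L4]). *)
pose K := 100 * C * (4 `^ p / p) + 2 * C / (2 * s) + 2 * c5 * C / (2 * s) +
   c2 * (C * (5 `^ p / p)).
pose F h := C * h ^+ 2 + K * h `^ p + c2 * (4 * B * om h).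
suff : 0 <= c2 * I by rewrite pmulr_rge0.
apply: (@ge0_of_small _ F _ (e / 8)); first by rewrite divr_gt0.
  have E0 : C * 0 ^+ 2 + K * 0 + c2 * (4 * B * om 0) = 0 by rewrite /om subr0 subrr; ring.
  rewrite /F -[X in _ --> X]E0.
  have cid : {for 0, continuous (fun h : R => h)} by exact: cvg_id.
  have com : {for 0, continuous om}.
    have e00 : 0 < e - 0 by rewrite subr0.
    have H := is_derive_powR_sub (- (2 * s + 2)) e00.
    apply: differentiable_continuous; apply/derivable1_diffP.
    by apply: ex_derive.
  have cvr (f : R -> R) : {for 0, continuous f} -> f x @[x --> 0^'+] --> f 0.
    by move=> cf; exact: cvg_at_right_filter.
  apply: cvgD; [apply: cvgD|].
  - apply: cvgM; first exact: cvg_cst.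
    have := cvr (fun h => h ^+ 2); apply.
    exact: exprn_continuous.
  - by apply: cvgM; [exact: cvg_cst|exact: powR_cvg0].
  - apply: cvgM; first exact: cvg_cst.
    by apply: cvgM; [exact: cvg_cst|exact: cvr].
move=> h h0 he.
have he1 : h <= e by move: he h0 e0; goal_lra.
have he8 : 8 * h <= e by move: he; goal_lra.
have h20 : 0 < h ^+ 2 by rewrite exprn_gt0.
rewrite -(pmulr_rge0 _ h20) /F.
have ip : `|x1 + h - x1| <= e by rewrite addrAC subrr add0r gtr0_norm.
have im : `|x1 - h - x1| <= e by rewrite addrAC subrr add0r normrN gtr0_norm.
have jp := flat_intble hs cu uB e0 uflat ip; have jm := flat_intble hs cu uB e0 uflat im.
have j0 := flat_intble hs cu uB e0 uflat xx1.
pose T := sdiff u x1.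
pose Q r := T (r + h) + T (r - h) - 2 * T r - 2 * T h.
have jQ : intble `]0, +oo[ (fun r => Q r * r `^ (- (2 * s) - 1)).
  apply: (@intble_eq _ _ (fun r => sdiff u (x1 + h) r * r `^ (- (2 * s) - 1) +
    sdiff u (x1 - h) r * r `^ (- (2 * s) - 1) - 2 * (sdiff u x1 r * r `^ (- (2 * s) - 1)))) => //.
    by move=> r _; rewrite /Q /T -sdiff_sdiff; ring.
  by apply: intbleB => //; [exact: intbleD|exact: intbleZ].
have EQ : integ `]0, +oo[ (fun r => Q r * r `^ (- (2 * s) - 1)) = - sdiff (fracLap s u) x1 h.
  rewrite {1}/sdiff /fracLap.
  rewrite -[RHS]/(- (- _ + - _ - 2 * (- _))) mulrN !opprD !opprK.
  rewrite -integD// -integZ// -integB//; [|exact: intbleD|exact: intbleZ].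
  by apply: integ_eq => r _; rewrite /Q /T -sdiff_sdiff; ring.
have h4 : 0 < 4 * h by rewrite mulr_gt0.
have h5 : 0 < 5 * h by rewrite mulr_gt0.
have [jQ1 jQ2] := intble_sub (ltW h4) jQ.
have E1 := integ_split (ltW h4) jQ.
have hq : h `^ (- (2 * s)) * h ^+ 4 = h ^+ 2 * h `^ p.
  rewrite -!powR_mulrn ?(ltW h0)// -!powRD ?(gt_eqF h0) ?implybT//.
  by congr powR; rewrite /p; ring.
(* For small r the left side of [sdiff_sdiff] is used. Flatness bounds each of its second
   differences by 25 C h^2 r^2, as h + r <= 5h, and their coefficients have absolute values 1, 1,
   2. *)
have L1 : integ `]0, 4 * h] (fun r => Q r * r `^ (- (2 * s) - 1)) <=
    100 * C * h ^+ 2 * (4 `^ p / p * h `^ p).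
  apply: (@le_trans _ _ (integ `]0, 4 * h] (fun r => 100 * C * h ^+ 2 * r `^ (p - 1)))).
    apply: integ_le => //; first by apply: intbleZ => //; exact: intble_0.
    move=> r /=; rewrite in_itv/= => /andP[r0 r4].
    have re : r <= e by move: r4 he8 h0; goal_lra.
    have := uflat _ _ ip r0 re; have := uflat _ _ im r0 re; have := uflat _ _ xx1 r0 re.
    rewrite /Q /T -sdiff_sdiff.
    have -> : `|x1 + h - x1| = h by rewrite addrAC subrr add0r gtr0_norm.
    have -> : `|x1 - h - x1| = h by rewrite addrAC subrr add0r normrN gtr0_norm.
    rewrite subrr normr0 add0r.
    have b1 : C * (h + r) ^+ 2 * r ^+ 2 <= 25 * C * h ^+ 2 * r ^+ 2.
      rewrite ler_wpM2r ?sqr_ge0// -[25 * C]mulrC -mulrA ler_wpM2l//; move: h0 r0 r4; goal_nra.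
    have b2 : C * r ^+ 2 * r ^+ 2 <= 25 * C * h ^+ 2 * r ^+ 2.
      rewrite ler_wpM2r ?sqr_ge0// -[25 * C]mulrC -mulrA ler_wpM2l//; move: h0 r0 r4; goal_nra.
    rewrite !ler_norml => /andP[m1 m2] /andP[m3 m4] /andP[m5 m6].
    have Q1 : sdiff u (x1 + h) r + sdiff u (x1 - h) r - 2 * sdiff u x1 r <=
      100 * C * h ^+ 2 * r ^+ 2 by move: m1 m2 m3 m4 m5 m6 b1 b2; clear; lra.
    apply: (le_trans (ler_wpM2r (powR_ge0 _ _) Q1)).
    rewrite -[leLHS]mulrA exprMpowR//.
    by rewrite (_ : 2%:R + (- (2 * s) - 1) = p - 1)// /p; ring.
  rewrite integZ//; last exact: intble_0.
  rewrite ler_wpM2l//; first by rewrite mulr_ge0 ?(ltW h20)// mulr_ge0.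
  apply: (le_trans (integ_0_le h4 p0)).
  by rewrite powRM ?(ltW h0)// mulrAC.
have TC r : 0 < r -> r <= e -> - T r <= C * r ^+ 4.
  move=> r0 re; have := uflat _ _ xx1 r0 re; rewrite subrr normr0 add0r -mulrA -exprD.
  by rewrite ler_norml => /andP[+ _]; rewrite /T lerNl.
have TM r : `|T r| <= 4 * B.
  rewrite /T /sdiff; have := uB (x1 + r); have := uB (x1 - r); have := uB x1.
  rewrite !ler_norml; move=> /andP[a1 a2] /andP[a3 a4] /andP[a5 a6].
  by apply/andP; split; move: a1 a2 a3 a4 a5 a6; goal_lra.
have L2 := integ_sdiff_tail_le q0 h0 he8 (@sdiff_continuous R u x1 cu) TM T0 TC.
have p4 : 0 < (4 : R) `^ (2 * s) by exact: powR_gt0.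
have q4 : (4 * h) `^ (- (2 * s)) <= h `^ (- (2 * s)).
  rewrite !powRN lef_pV2 ?posrE ?powR_gt0//.
  by apply: ge0_ler_powR; rewrite ?nnegrE ?(ltW q0) ?(ltW h0) ?(ltW h4)//; move: h0; goal_lra.
have L3 : 2 * (C * (5 * h) ^+ 4) * ((4 * h) `^ (- (2 * s)) / (2 * s)) <=
    2 * c5 * C / (2 * s) * (h ^+ 2 * h `^ p).
  rewrite -hq.
  rewrite exprMn c5E.
  have -> : 2 * (C * (c5 * h ^+ 4)) * ((4 * h) `^ (- (2 * s)) / (2 * s)) =
    2 * c5 * C / (2 * s) * h ^+ 4 * (4 * h) `^ (- (2 * s)) by ring.
  rewrite [h `^ _ * h ^+ 4]mulrC [leRHS]mulrA ler_wpM2l//.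
  by rewrite mulr_ge0// ?exprn_ge0 ?(ltW h0)// divr_ge0 ?(ltW q0)// mulr_ge0// mulr_ge0.
have jT := flat_intble3 hs cu uB e0 uflat.
have L4 : integ `]5 * h, +oo[ (fun r => T r * r `^ (- (2 * s + 2) - 1)) <=
    I + C * (5 `^ p / p * h `^ p).
  have he5 : 5 * h <= e by move: he8 h0; goal_lra.
  have [jT1 jT2] := intble_sub (ltW h5) jT.
  rewrite /I (integ_split (ltW h5) jT).
  suff : - integ `]0, 5 * h] (fun r => T r * r `^ (- (2 * s + 2) - 1)) <=
      C * (5 `^ p / p * h `^ p).
    by rewrite /T; move: (integ _ _) (integ _ _) (C * _); goal_lra.
  apply: (@le_trans _ _ (C * integ `]0, 5 * h] (fun r => r `^ (p - 1)))).
    rewrite -integN// -integZ//; last exact: intble_0.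
    apply: integ_le => //; first exact: intbleN.
      by apply: intbleZ => //; exact: intble_0.
    move=> r /=; rewrite in_itv/= => /andP[r0 r5].
    rewrite -mulNr; have re : r <= e by exact: le_trans he5.
    apply: (le_trans (ler_wpM2r (powR_ge0 _ _) (TC r r0 re))).
    rewrite -[leLHS]mulrA exprMpowR//.
    by rewrite (_ : 4%:R + (- (2 * s + 2) - 1) = p - 1)// /p; ring.
  rewrite ler_wpM2l//; apply: (le_trans (integ_0_le h5 p0)).
  by rewrite powRM ?(ltW h0)// mulrAC.
have jT4 : intble `]4 * h, +oo[ (fun r => r `^ (- (2 * s) - 1)) by exact: intble_y.
have E2 : integ `]4 * h, +oo[ (fun r => Q r * r `^ (- (2 * s) - 1)) =
    integ `]4 * h, +oo[ (fun r => (T (r + h) + T (r - h) - 2 * T r) * r `^ (- (2 * s) - 1)) -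
    2 * T h * ((4 * h) `^ (- (2 * s)) / (2 * s)).
  rewrite -(integ_y h4 q0) -integZ//.
  have jR : intble `]4 * h, +oo[ (fun r => (T (r + h) + T (r - h) - 2 * T r) * r `^ (- (2 * s) - 1)).
    apply: (@intble_eq _ _ (fun r => Q r * r `^ (- (2 * s) - 1) + 2 * T h * r `^ (- (2 * s) - 1))) => //.
      by move=> r _; rewrite /Q; ring.
    by apply: intbleD => //; exact: intbleZ.
  rewrite -integB//; last exact: intbleZ.
  by apply: integ_eq => r _; rewrite /Q; ring.
have L5 : - (2 * T h * ((4 * h) `^ (- (2 * s)) / (2 * s))) <=
    2 * C / (2 * s) * (h ^+ 2 * h `^ p).
  rewrite -hq.
  have -> : - (2 * T h * ((4 * h) `^ (- (2 * s)) / (2 * s))) =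
    2 / (2 * s) * ((- T h) * (4 * h) `^ (- (2 * s))) by ring.
  have -> : 2 * C / (2 * s) * (h `^ (- (2 * s)) * h ^+ 4) =
    2 / (2 * s) * (C * h ^+ 4 * h `^ (- (2 * s))) by ring.
  rewrite ler_wpM2l//; first by rewrite divr_ge0// ltW.
  have Th := TC h h0 he1.
  apply: (le_trans (ler_wpM2r (powR_ge0 _ _) Th)).
  by rewrite ler_wpM2l// mulr_ge0// exprn_ge0// ltW.
have L6 : h ^+ 2 * c2 * (integ `]5 * h, +oo[ (fun r => T r * r `^ (- (2 * s + 2) - 1)) +
     4 * B * om h) <= h ^+ 2 * c2 * (I + C * (5 `^ p / p * h `^ p) + 4 * B * om h).
  rewrite ler_wpM2l//; first by rewrite mulr_ge0// ltW.
  exact: lerD.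
have HD := HL h h0 he1.
have -> : h ^+ 2 * (c2 * I + (C * h ^+ 2 + K * h `^ p + c2 * (4 * B * om h))) =
  C * h ^+ 4 + (100 * C * h ^+ 2 * (4 `^ p / p * h `^ p) +
  (2 * C / (2 * s) * (h ^+ 2 * h `^ p) + (2 * c5 * C / (2 * s) * (h ^+ 2 * h `^ p) +
   h ^+ 2 * c2 * (I + C * (5 `^ p / p * h `^ p) + 4 * B * om h)))) by rewrite /K; ring.
apply: le_trans (lerD HD (lerD L1 (lerD L5 (lerD L3 L6)))).
move: EQ E1 E2 L2; rewrite -/c2 -/(om h); clear.
move: (sdiff (fracLap s u) _ _) (integ `]0, +oo[ _) (integ `]0, _] _) => a b c.
move: (integ _ (fun r => Q r * _)) (integ _ (fun r => (T _ + _ - _) * _)) => d f.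
move: (_ * (_ + 4 * B * om h)) (2 * _ * (_ / _)) (2 * T h * _) => g k l.
lra.
Qed.
End FlatLaplacian.

(** * Comparison principle *)

Section Comparison.
Context {R : realType}.
Implicit Types (f u T : R -> R) (h r q x e c L : R).

(** The equation holds pointwise and for the unnormalised Laplacian, so L is the eigenvalue divided
    by the normalising constant. *)
Definition eigenpair s L f : Prop :=
  [/\ continuous f, forall x, 1 <= `|x| -> f x = 0, forall x, `|x| < 1 -> 0 < f x &
    forall x, `|x| < 1 -> intble `]0, +oo[ (fun r => sdiff f x r * r `^ (- (2 * s) - 1)) /\
      fracLap s f x = L * f x].

Lemma cont_max f (a b : R) : a <= b -> continuous f ->
  exists2 c, a <= c <= b & forall t, a <= t <= b -> f t <= f c.
Proof.
move=> ab cf; have [|c cab cmax] := @EVT_max R f a b ab.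
  exact: continuous_subspaceT.
by exists c; [rewrite in_itv/= in cab|move=> t tab; apply: cmax; rewrite in_itv].
Qed.

Lemma cont_min f (a b : R) : a <= b -> continuous f ->
  exists2 c, a <= c <= b & forall t, a <= t <= b -> f c <= f t.
Proof.
move=> ab cf; have [|c cab cmin] := @EVT_min R f a b ab.
  exact: continuous_subspaceT.
by exists c; [rewrite in_itv/= in cab|move=> t tab; apply: cmin; rewrite in_itv].
Qed.

Lemma integ_kernel_ge T q (a b c : R) : 0 < q -> 0 < a -> a <= b ->
  intble `]0, +oo[ (fun r => T r * r `^ (- q - 1)) ->
  (forall r, 0 < r -> 0 <= T r) -> (forall r, a < r -> r <= b -> c <= T r) ->
  c * ((a `^ (- q) - b `^ (- q)) / q) <= integ `]0, +oo[ (fun r => T r * r `^ (- q - 1)).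
Proof.
move=> q0 a0 ab iT T0 Tc; rewrite -integ_oc//.
have [iT1 iT2] := intble_sub (ltW a0) iT.
have [iT3 iT4] := intble_sub ab iT2.
rewrite (integ_split (ltW a0) iT) (integ_split ab iT2).
have b0 : 0 < b by exact: lt_le_trans ab.
have I1 : 0 <= integ `]0, a] (fun r => T r * r `^ (- q - 1)).
  apply: integ_ge0 => r /=; rewrite in_itv/= => /andP[r0 _].
  by rewrite mulr_ge0 ?powR_ge0// T0.
have I2 : 0 <= integ `]b, +oo[ (fun r => T r * r `^ (- q - 1)).
  apply: integ_ge0 => r /=; rewrite in_itv/= andbT => br.
  by rewrite mulr_ge0 ?powR_ge0// T0// (lt_trans b0).
have ik : intble `]a, b] (fun r => r `^ (- q - 1)).
  by have [] := intble_sub ab (intble_y a0 q0).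
have I3 : c * integ `]a, b] (fun r => r `^ (- q - 1)) <=
    integ `]a, b] (fun r => T r * r `^ (- q - 1)).
  rewrite -integZ//; apply: integ_le => //; first exact: intbleZ.
  move=> r /=; rewrite in_itv/= => /andP[ar rb].
  by rewrite ler_wpM2r ?powR_ge0// Tc.
by apply: (le_trans I3); rewrite addrCA lerDl addr_ge0.
Qed.

Lemma integ_kernel_tail_ge T q (a c : R) : 0 < q -> 0 < a ->
  intble `]0, +oo[ (fun r => T r * r `^ (- q - 1)) ->
  (forall r, 0 < r -> 0 <= T r) -> (forall r, a < r -> c <= T r) ->
  c * (a `^ (- q) / q) <= integ `]0, +oo[ (fun r => T r * r `^ (- q - 1)).
Proof.
move=> q0 a0 iT T0 Tc; rewrite -integ_y//.
have [iT1 iT2] := intble_sub (ltW a0) iT.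
rewrite (integ_split (ltW a0) iT) -integZ//; last exact: intble_y.
rewrite ler_wpDl//.
  apply: integ_ge0 => r /=; rewrite in_itv/= => /andP[r0 _].
  by rewrite mulr_ge0 ?powR_ge0// T0.
apply: integ_le => //; first by apply: intbleZ => //; exact: intble_y.
move=> r /=; rewrite in_itv/= andbT => ar.
by rewrite ler_wpM2r ?powR_ge0// Tc.
Qed.

Lemma powRN_lt q (a b : R) : 0 < q -> 0 < a -> a < b -> b `^ (- q) < a `^ (- q).
Proof.
move=> q0 a0 ab; have b0 : 0 < b by exact: lt_trans ab.
rewrite !powRN ltf_pV2 ?posrE ?powR_gt0//.
by rewrite gt0_ltr_powR// nnegrE ltW.
Qed.

Lemma integ_kernel_eq0 T q : 0 < q -> continuous T ->
  intble `]0, +oo[ (fun r => T r * r `^ (- q - 1)) ->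
  (forall r, 0 < r -> 0 <= T r) -> integ `]0, +oo[ (fun r => T r * r `^ (- q - 1)) <= 0 ->
  forall r, 0 < r -> T r = 0.
Proof.
move=> q0 cT iT T0 I0 r r0; apply/eqP/negPn/negP => Tr.
have Tr0 : 0 < T r by rewrite lt_def Tr T0.
have Tr2 : 0 < T r / 2 by rewrite divr_gt0.
have /cvgrPdist_lt /(_ _ Tr2) := cT r.
move=> /nbhs_ballP[d /= d0 dT].
pose a := Num.max (r / 2) (r - d / 2).
have a0 : 0 < a by rewrite lt_max divr_gt0.
have ar : a < r by rewrite gt_max; apply/andP; split; lra.
have : T r / 2 * ((a `^ (- q) - r `^ (- q)) / q) <= 0.
  apply: le_trans I0; apply: integ_kernel_ge => //; first exact: ltW.
  move=> t at_ tr.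
  have : ball r d t.
    rewrite /ball/= ger0_norm ?subr_ge0//.
    move: at_; rewrite gt_max => /andP[_ rt]; lra.
  move=> /dT; rewrite ltr_norml => /andP[_]; lra.
apply/negP; rewrite -ltNge mulr_gt0// divr_gt0// subr_gt0.
exact: powRN_lt.
Qed.

Lemma fracLap_lin s f u t x (k := fun r => r `^ (- (2 * s) - 1)) :
  intble `]0, +oo[ (fun r => sdiff f x r * k r) ->
  intble `]0, +oo[ (fun r => sdiff u x r * k r) ->
  intble `]0, +oo[ (fun r => sdiff (fun y => t * f y - u y) x r * k r) /\
  fracLap s (fun y => t * f y - u y) x = t * fracLap s f x - fracLap s u x.
Proof.
move=> jf ju.
have E r : sdiff (fun y => t * f y - u y) x r * k r =
    t * (sdiff f x r * k r) - sdiff u x r * k r by rewrite /sdiff; ring.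
have j1 := intbleZ t (measurable_itv _) jf.
split.
  apply: (intble_eq _ (f := fun r => t * (sdiff f x r * k r) - sdiff u x r * k r)) => //.
  exact: intbleB.
rewrite /fracLap (integ_eq (g := fun r => t * (sdiff f x r * k r) - sdiff u x r * k r)) => [|r _]; last exact: E.
by rewrite integB// integZ//; ring.
Qed.

(** The witness e = 1/(2 + 2s|L|) is below 1, so 2s >= 1 gives e^(-2s) >= e^-1 > 2s L. It is the
    width of the boundary strips in the comparison argument. *)
Lemma exists_small_eta s L : 1 <= 2 * s ->
  exists e, [/\ 0 < e, e < 1 & L < e `^ (- (2 * s)) / (2 * s)].
Proof.
move=> s1; have s0 : 0 < 2 * s by exact: lt_le_trans s1.
have d0 : 0 < 2 + 2 * s * `|L| by rewrite ltr_wpDr// mulr_ge0// ltW.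
exists (2 + 2 * s * `|L|)^-1; split; first by rewrite invr_gt0.
  by rewrite invf_lt1// ltr_wpDr// ?ltr1n// mulr_ge0// ltW.
rewrite ltr_pdivlMr// powRN.
apply: (@lt_le_trans _ _ (2 + 2 * s * `|L|)).
  rewrite mulrC (@le_lt_trans _ _ (2 * s * `|L|))//.
    by rewrite ler_wpM2l ?(ltW s0)// ler_norm.
  by rewrite ltrDr.
rewrite -[leLHS]invrK lef_pV2 ?posrE ?powR_gt0 ?invr_gt0//.
rewrite ge1r_powR// invr_gt0 d0 invf_le1//.
by rewrite (@le_trans _ _ 2)// ?ler1n// lerDl mulr_ge0// ltW.
Qed.

(** A maximum principle in narrow strips replaces boundary estimates of u/f. With t the maximum of
    u/f on [-1 + e, 1 - e], D = t f - u is nonnegative there and has a zero. A negative minimum x2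
    of D would lie within e of an end, so D vanishes at x2 + r or at x2 - r for all r > e. Then
    (-Delta)^s D(x2) <= D(x2) e^(-2s)/(2s) < L D(x2), whereas D is a supersolution. Hence D >= 0,
    and the supersolution inequality at its zero forces D = 0. *)
Lemma subsolution_proportional s L f u : 1 / 2 < s < 1 -> eigenpair s L f ->
  continuous u -> (forall x, 1 <= `|x| -> u x = 0) ->
  (forall x, `|x| < 1 -> intble `]0, +oo[ (fun r => sdiff u x r * r `^ (- (2 * s) - 1)) /\
      fracLap s u x <= L * u x) ->
  exists t, forall x, u x = t * f x.
Proof.
move=> /andP[s12 s1] [cf f0 fp Lf] cu u0 Lu.
have q0 : 0 < 2 * s by lra.
have q1 : 1 <= 2 * s by lra.
have [e [e0 e1 Le]] := exists_small_eta L q1.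
have Kle : -1 + e <= 1 - e by lra.
have inK x : x \in `[-1 + e, 1 - e] -> `|x| < 1.
  by rewrite in_itv/= ltr_norml => /andP[? ?]; apply/andP; split; lra.
have [x0 x0K x0max] : exists2 c, c \in `[-1 + e, 1 - e] &
    forall t, t \in `[-1 + e, 1 - e] -> u t / f t <= u c / f c.
  apply: EVT_max => //; apply: continuous_in_subspaceT => x /set_mem/= /inK x1.
  apply: cvgM; first exact: cu.
  by apply: cvgV; [rewrite gt_eqF// fp|exact: cf].
pose t := u x0 / f x0; exists t.
pose D y := t * f y - u y.
have cD : continuous D.
  move=> y; apply: cvgB; last exact: cu.
  by apply: cvgM; [exact: cvg_cst|exact: cf].
have D0 x : 1 <= `|x| -> D x = 0 by move=> x1; rewrite /D f0// u0// mulr0 subrr.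
have DK x : x \in `[-1 + e, 1 - e] -> 0 <= D x.
  move=> xK; rewrite subr_ge0 -ler_pdivrMr; first exact: x0max.
  by apply: fp; exact: inK.
have Dx0 : D x0 = 0.
  by rewrite /D /t divfK ?subrr// gt_eqF// fp// inK.
have LD x : `|x| < 1 -> intble `]0, +oo[ (fun r => sdiff D x r * r `^ (- (2 * s) - 1)) /\
    L * D x <= fracLap s D x.
  move=> x1; have [jf Ef] := Lf x x1; have [ju Eu] := Lu x x1.
  have [jD ->] := fracLap_lin t jf ju; split=> //.
  by move: Eu; rewrite Ef /D; goal_lra.
have le11 : (-1 : R) <= 1 by lra.
have Dge0 : forall y, 0 <= D y.
  have [x2 x2I x2min] := cont_min le11 cD.
  have gmin y : 0 <= D x2 \/ D x2 <= D y.
    case: (ltP (D x2) 0) => Dx2; [right|by left].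
    case: (leP `|y| 1) => y1; last by rewrite (D0 y) ?ltW.
    by apply: x2min; rewrite -ler_norml.
  case: (ltP (D x2) 0) => Dx2; last first.
    move=> y; case: (leP `|y| 1) => y1; last by rewrite D0// ltW.
    by apply: le_trans Dx2 _; apply: x2min; rewrite -ler_norml.
  have {}gmin y : D x2 <= D y by case: (gmin y) => //; rewrite leNgt Dx2.
  have x21 : `|x2| < 1 by rewrite ltNge; apply/negP => /D0 E; rewrite E ltxx in Dx2.
  have x2K : x2 \notin `[-1 + e, 1 - e].
    by apply/negP => /DK; rewrite leNgt Dx2.
  have [jD LDx] := LD _ x21.
  have T0 r : 0 < r -> 0 <= sdiff D x2 r.
    by move=> r0; move: (gmin (x2 + r)) (gmin (x2 - r)); rewrite /sdiff; goal_lra.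
  have Tc r : e < r -> - D x2 <= sdiff D x2 r.
    move=> er; have := gmin (x2 + r); have := gmin (x2 - r); rewrite /sdiff.
    move: x2K; rewrite in_itv/= negb_and -!ltNge => /orP[xe|xe].
      by rewrite (D0 (x2 - r)); [goal_lra|rewrite ler_normr; apply/orP; right; move: er xe; goal_lra].
    by rewrite (D0 (x2 + r)); [goal_lra|rewrite ler_normr; apply/orP; left; move: er xe; goal_lra].
  have := integ_kernel_tail_ge q0 e0 jD T0 Tc; move: LDx; rewrite /fracLap.
  move: (integ _ _) => I LI eI.
  have : D x2 * (e `^ (- (2 * s)) / (2 * s)) < D x2 * L by rewrite ltr_nM2l.
  by move: LI eI; goal_lra.
have x01 := inK _ x0K.
have [jD LDx] := LD _ x01.
have T0 r : 0 < r -> 0 <= sdiff D x0 r.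
  by move=> _; rewrite /sdiff Dx0 mulr0 subr0 addr_ge0.
(* At the zero x0 the supersolution inequality says that the integral of a nonnegative second
   difference is at most 0. *)
have I0 : integ `]0, +oo[ (fun r => sdiff D x0 r * r `^ (- (2 * s) - 1)) <= 0.
  by rewrite -oppr_ge0; apply: le_trans LDx; rewrite Dx0 mulr0.
have Tz := integ_kernel_eq0 q0 (@sdiff_continuous R D x0 cD) jD T0 I0.
have Dp r : 0 < r -> D (x0 + r) = 0 /\ D (x0 - r) = 0.
  move=> r0; have := Tz r r0; rewrite /sdiff Dx0 mulr0 subr0.
  by move=> /eqP; rewrite paddr_eq0// => /andP[/eqP-> /eqP->].
move=> x; apply/esym/eqP; rewrite -subr_eq0; apply/eqP; rewrite -/(D x).
case: (ltgtP x x0) => [xx|xx|->//].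
  by have := (Dp (x0 - x)); rewrite subr_gt0 subKr => /(_ xx)[].
by have := (Dp (x - x0)); rewrite subr_gt0 [x0 + _]addrC subrK => /(_ xx)[].
Qed.

Lemma sdiffN f x r : sdiff (fun y => f (- y)) x r = sdiff f (- x) r.
Proof.
rewrite /sdiff opprD opprB [r - x]addrC.
by rewrite [f (- x - r) + _]addrC.
Qed.

(** The reflection of f is a subsolution too, hence a multiple of f, and the values at 0 fix the
    factor. *)
Lemma eigenpair_even s L f : 1 / 2 < s < 1 -> eigenpair s L f -> forall x, f (- x) = f x.
Proof.
move=> hs Ef; have [cf f0 fp Lf] := Ef.
have [t Ht] : exists t, forall x, f (- x) = t * f x.
  apply: (@subsolution_proportional s L f (fun y => f (- y)) hs Ef).
  - move=> x; apply: (@continuous_comp _ _ _ -%R f); [exact: opp_continuous|exact: cf].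
  - by move=> x x1; rewrite f0// normrN.
  - move=> x x1; have Nx1 : `|- x| < 1 by rewrite normrN.
    have [jx Ex] := Lf _ Nx1.
    have E : (fun r => sdiff (fun y => f (- y)) x r * r `^ (- (2 * s) - 1)) =
       (fun r => sdiff f (- x) r * r `^ (- (2 * s) - 1)).
      by apply/funext => r; rewrite sdiffN.
    by rewrite /fracLap E; split=> //; move: Ex; rewrite /fracLap => ->.
have t1 : t = 1.
  have := Ht 0; rewrite oppr0 => E; apply: (@mulIf _ (f 0)); last by rewrite -E mul1r.
  by rewrite gt_eqF// fp// normr0.
by move=> x; rewrite Ht t1 mul1r.
Qed.

Lemma eigenpair_max s L f : eigenpair s L f ->
  exists x, `|x| < 1 /\ forall y, f y <= f x.
Proof.
move=> [cf f0 fp _].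
have le11 : (-1 : R) <= 1 by lra.
have [x xI xmax] := cont_max le11 cf.
have fx0 : 0 < f x.
  apply: (@lt_le_trans _ _ (f 0)); first by rewrite fp// normr0.
  by apply: xmax; apply/andP; split; lra.
exists x; split; first by rewrite ltNge; apply/negP => /f0 E; rewrite E ltxx in fx0.
move=> y; case: (leP `|y| 1) => y1; last by rewrite (f0 y) ?ltW.
by apply: xmax; rewrite -ler_norml.
Qed.

(** The equation is read at a maximum point x >= 0, where -S_f(x, r) is nonnegative, at least f(x)
    for 1 - x < r <= 1 + x, and equal to 2 f(x) beyond. Integration gives L >= ((1 - x)^(-2s) + (1 +
    x)^(-2s))/(2s) >= 1/s. The inequality is strict because f is already small just inside the
    boundary. *)
Lemma eigenvalue_gap s L f : 1 / 2 < s < 1 -> eigenpair s L f -> 1 < s * L.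
Proof.
move=> hs Ef; have [s12 s1] := andP hs; have [cf f0 fp Lf] := Ef.
have fN := eigenpair_even hs Ef.
have q0 : 0 < 2 * s by lra.
have [x [x0 x1 xmax]] : exists x, [/\ 0 <= x, x < 1 & forall y, f y <= f x].
  have [x [x1 xmax]] := eigenpair_max Ef; exists `|x|; split=> //.
  by move=> y; case: (ger0P x) => _; rewrite ?fN.
have x1' : `|x| < 1 by rewrite ger0_norm.
have M0 := fp _ x1'.
have [jx Ex] := Lf _ x1'.
have d0 : 0 < 1 - x by lra.
have M2 : 0 < f x / 2 by rewrite divr_gt0.
have /cvgrPdist_lt /(_ _ M2) := cf 1.
move=> /nbhs_ballP[c /= c0 cf1].
have f10 : f 1 = 0 by rewrite f0// normr1.
(* [a] is so close to 1 - x that f(x + r) <= f(x)/2 for a < r <= 1 - x; this range supplies the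
   strictly positive surplus [A0]. *)
have [a [a0 ad ac]] : exists a, [/\ 0 < a, a < 1 - x & 1 - x - c < a].
  exists (Num.max ((1 - x) / 2) (1 - x - c / 2)).
  by rewrite lt_max gt_max lt_max divr_gt0//; split=> //; [apply/andP; split; move: c0 d0; goal_lra|apply/orP; right; move: c0; goal_lra].
have near1 r : a < r -> r <= 1 - x -> f (x + r) <= f x / 2.
  move=> ar rx; have Hb : `|1 - (x + r)| < c by rewrite ger0_norm; move: ar rx ac; goal_lra.
  by have := cf1 (x + r) Hb; rewrite /= f10 sub0r normrN => /(le_lt_trans (ler_norm _))/ltW.
have iT : intble `]0, +oo[ (fun r => - sdiff f x r * r `^ (- (2 * s) - 1)).
  by apply: (intble_eq _ (f := fun r => - (sdiff f x r * r `^ (- (2 * s) - 1)))) => // [r _|]; [rewrite mulNr|exact: intbleN].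
have EI : L * f x = integ `]0, +oo[ (fun r => - sdiff f x r * r `^ (- (2 * s) - 1)).
  by rewrite -Ex /fracLap -integN//; apply: integ_eq => r _; rewrite mulNr.
have dx : 1 - x <= 1 + x by move: x0; goal_lra.
have e0 : 0 < 1 + x by move: x0; goal_lra.
move: EI; rewrite (integ_split (ltW a0) iT).
have [j1 j2] := intble_sub (ltW a0) iT.
rewrite (integ_split (ltW ad) j2); have [j3 j4] := intble_sub (ltW ad) j2.
rewrite (integ_split dx j4); have [j5 j6] := intble_sub dx j4.
have ik b e : 0 < b -> b <= e -> intble `]b, e] (fun r => r `^ (- (2 * s) - 1)).
  by move=> b0 be; have [] := intble_sub be (intble_y b0 q0).
have I1 : 0 <= integ `]0, a] (fun r => - sdiff f x r * r `^ (- (2 * s) - 1)).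
  apply: integ_ge0 => r _; rewrite mulr_ge0 ?powR_ge0// oppr_ge0 /sdiff.
  by move: (xmax (x + r)) (xmax (x - r)); goal_lra.
have I2 : f x / 2 * ((a `^ (- (2 * s)) - (1 - x) `^ (- (2 * s))) / (2 * s)) <=
    integ `]a, 1 - x] (fun r => - sdiff f x r * r `^ (- (2 * s) - 1)).
  rewrite -integ_oc ?(ltW ad)// -integZ//; last by apply: ik => //; exact: ltW.
  apply: integ_le => //; first by apply: intbleZ => //; apply: ik => //; exact: ltW.
  move=> r /=; rewrite in_itv/= => /andP[ar rx]; rewrite ler_wpM2r ?powR_ge0//.
  by rewrite /sdiff; move: (near1 r ar rx) (xmax (x - r)); goal_lra.
have I3 : f x * (((1 - x) `^ (- (2 * s)) - (1 + x) `^ (- (2 * s))) / (2 * s)) <=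
    integ `]1 - x, 1 + x] (fun r => - sdiff f x r * r `^ (- (2 * s) - 1)).
  rewrite -integ_oc// -integZ//; last exact: ik.
  apply: integ_le => //; first by apply: intbleZ => //; exact: ik.
  move=> r /=; rewrite in_itv/= => /andP[ar rx]; rewrite ler_wpM2r ?powR_ge0//.
  rewrite /sdiff (f0 (x + r)); last by rewrite ger0_norm; move: ar x0 x1; goal_lra.
  by move: (xmax (x - r)); goal_lra.
have I4 : 2 * f x * ((1 + x) `^ (- (2 * s)) / (2 * s)) <=
    integ `]1 + x, +oo[ (fun r => - sdiff f x r * r `^ (- (2 * s) - 1)).
  rewrite -integ_y// -integZ//; last exact: intble_y.
  apply: integ_le => //; first by apply: intbleZ => //; exact: intble_y.
  move=> r /=; rewrite in_itv/= andbT => xr; rewrite ler_wpM2r ?powR_ge0//.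
  rewrite /sdiff (f0 (x + r)); last by rewrite ger0_norm; move: xr x0 x1; goal_lra.
  have xr' : 1 <= `|x - r| by rewrite ler0_norm; move: xr x0 x1; goal_lra.
  by rewrite (f0 (x - r) xr'); move: M0; goal_lra.
have A0 : 0 < f x / 2 * ((a `^ (- (2 * s)) - (1 - x) `^ (- (2 * s))) / (2 * s)).
  by rewrite mulr_gt0// divr_gt0// subr_gt0 powRN_lt.
have [H|] := powR_midpoint (2 * s) x0 x1; last by rewrite ltNge ltW.
rewrite powR1 mulr1 in H.
have H2 : f x * 2 / (2 * s) <= f x * (((1 - x) `^ (- (2 * s)) - (1 + x) `^ (- (2 * s))) / (2 * s)) +
   2 * f x * ((1 + x) `^ (- (2 * s)) / (2 * s)).
  rewrite (_ : _ + _ = f x * ((1 + x) `^ (- (2 * s)) + (1 - x) `^ (- (2 * s))) / (2 * s)); last by ring.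
  by rewrite ler_wpM2r ?invr_ge0 ?(ltW q0)// ler_wpM2l// ltW.
move=> EI.
have H3 : f x * 2 / (2 * s) < L * f x.
  move: EI A0 I1 I2 I3 I4 H2.
  move: (integ _ _) (integ _ _) (integ _ _) (integ _ _) (f x / 2 * _) (f x * (_ / _)) (2 * f x * _) (L * f x) (f x * 2 / _).
  goal_lra.
rewrite -(ltr_pM2r M0) mul1r.
have s0 : 0 < s by move: q0; goal_lra.
have : s * (f x * 2 / (2 * s)) < s * (L * f x) by rewrite ltr_pM2l.
by rewrite [s * (L * _)]mulrA (_ : s * (f x * 2 / (2 * s)) = f x)//; field; rewrite gt_eqF.
Qed.

End Comparison.

(** * Concave envelope *)

Section Envelope.
Context {R : realType}.
Implicit Types (f w : R -> R) (x y z p a b : R).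

(* The least concave majorant on [-1, 1]; the last field says that it is affine
   where it does not touch [f]. *)
Definition concave_envelope f w : Prop :=
  [/\ continuous w, forall x, w (- x) = w x, concave11 w, forall x, 1 <= `|x| -> w x = 0 &
   [/\ forall x, f x <= w x, forall M, (forall x, f x <= M) -> forall x, `|x| < 1 -> w x <= M &
    forall x, `|x| < 1 -> f x < w x ->
      exists p q a b, [/\ -1 <= a, a < x, x < b & b <= 1] /\
        [/\ forall y, `|y| <= 1 -> w y <= p * y + q,
            forall y, a <= y -> y <= b -> w y = p * y + q, w a = f a & w b = f b]]].

Section Construction.
Variables (f : R -> R).
Hypotheses (cf : continuous f) (fN : forall x, f (- x) = f x)
  (f0 : forall x, 1 <= `|x| -> f x = 0) (fp : forall x, 0 <= f x).

Let le11 : (-1 : R) <= 1. Proof. lra. Qed.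

Let contact p : exists y, -1 <= y <= 1 /\ forall z, -1 <= z <= 1 -> f z - p * z <= f y - p * y.
Proof.
have cg : continuous (fun y => f y - p * y).
  move=> y; apply: cvgB; first exact: cf.
  by apply: cvgM; [exact: cvg_cst|exact: cvg_id].
by have [y yI ymax] := cont_max le11 cg; exists y.
Qed.

Let Y p := sval (cid (contact p)).
Let YI p : -1 <= Y p <= 1. Proof. by rewrite /Y; case: cid => y []. Qed.
Let Ymax p z : -1 <= z <= 1 -> f z - p * z <= f (Y p) - p * Y p.
Proof. exact: (svalP (cid (contact p))).2. Qed.
(** The convex conjugate of f up to sign: the height of the lowest line of slope p above f on
    [-1, 1]. The envelope is the pointwise minimum of these lines. *)
Let g p := f (Y p) - p * Y p.

Let f_le_g p z : -1 <= z <= 1 -> f z <= p * z + g p.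
Proof. by move=> /(Ymax p); rewrite /g lerBlDl. Qed.

Let g_lip p p' : g p' - `|p - p'| <= g p.
Proof.
apply: le_trans (Ymax p (YI p')); rewrite /g -addrA lerD2l.
rewrite lerBlDr -lerBlDl opprK [- _ + _]addrC -mulrBl.
apply: le_trans (ler_norm _) _; rewrite normrM ler_piMr//.
by rewrite ler_norml; exact: YI.
Qed.

Let g_cont : continuous g.
Proof.
move=> p; apply/cvgrPdist_le => e e0; near=> p'.
have pp : `|p - p'| <= e.
  by near: p'; apply: (@cvgr_dist_le _ _ _ _ _ id); [exact: cvg_id|].
have h1 := g_lip p p'; have h2 := g_lip p' p.
by rewrite distrC in h2; rewrite ler_norml; apply/andP; split; lra.
Unshelve. all: end_near. Qed.

Let g_ge p : `|p| <= g p.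
Proof.
have f1 : f 1 = 0 by rewrite f0// normr1.
have fN1 : f (-1) = 0 by rewrite f0// normrN normr1.
have h1 : -1 <= (1 : R) <= 1 by rewrite le11 lexx.
have h2 : -1 <= (-1 : R) <= 1 by rewrite le11 lexx.
have := f_le_g p h1; have := f_le_g p h2; rewrite f1 fN1 ler_norml => H1 H2.
by apply/andP; split; lra.
Qed.

(** The bound g(p) >= |p|, which holds because the line lies above f(1) = f(-1) = 0, makes p x +
    g(p) >= |p| (1 - |x|) coercive. The minimum over p is therefore attained, at a slope bounded in
    terms of 1 - |x|. *)
Let slope x : `|x| < 1 -> exists p, `|p| * (1 - `|x|) <= g 0 /\
  forall p', p * x + g p <= p' * x + g p'.
Proof.
move=> x1; have x1' : 0 < 1 - `|x| by rewrite subr_gt0.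
have g00 : 0 <= g 0 by exact: le_trans (g_ge 0).
pose P := g 0 / (1 - `|x|).
have P0 : 0 <= P by rewrite divr_ge0// ltW.
have ch : continuous (fun p => p * x + g p).
  move=> p; apply: cvgD; last exact: g_cont.
  by apply: cvgM; [exact: cvg_id|exact: cvg_cst].
have [|p /andP[p1 p2] pmin] := @cont_min R _ (- P) P _ ch; first by rewrite ge0_cp.
have low p' : `|p'| * (1 - `|x|) <= p' * x + g p'.
  have h1 := g_ge p'.
  have h2 : - (`|p'| * `|x|) <= p' * x by rewrite -normrM lerNl; apply: le_trans (ler_norm _) _; rewrite normrN.
  lra.
exists p; split.
  apply: le_trans (low p) _; have := pmin 0; rewrite mul0r add0r; apply.
  by rewrite oppr_le0 P0.
move=> p'; case: (leP `|p'| P) => p'P.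
  by apply: pmin; rewrite -ler_norml.
apply: (@le_trans _ _ (g 0)).
  by have := pmin 0; rewrite mul0r add0r; apply; rewrite oppr_le0 P0.
apply: le_trans (low p').
by rewrite -ler_pdivrMr// ltW.
Qed.

Let P x := if pselect (`|x| < 1) is left H then sval (cid (slope H)) else 0.
Let w x := if `|x| < 1 then P x * x + g (P x) else 0.

Let wE x : `|x| < 1 -> w x = P x * x + g (P x). Proof. by rewrite /w => ->. Qed.
Let w1 x : 1 <= `|x| -> w x = 0. Proof. by rewrite /w ltNge => ->. Qed.
Let P_bound x : `|x| < 1 -> `|P x| * (1 - `|x|) <= g 0.
Proof. by move=> x1; rewrite /P; case: pselect => // H; case: cid => p []. Qed.
Let P_min x : `|x| < 1 -> forall p', P x * x + g (P x) <= p' * x + g p'.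
Proof. by move=> x1; rewrite /P; case: pselect => // H; case: cid => p []. Qed.

Let w_le x p : `|x| <= 1 -> w x <= p * x + g p.
Proof.
move=> x1; rewrite /w; case: ifPn => [x1'|_]; first exact: P_min.
by apply: le_trans (fp x) _; apply: f_le_g; rewrite -ler_norml.
Qed.

Let w_ge x : f x <= w x.
Proof.
rewrite /w; case: ifPn => [x1|]; last by rewrite -leNgt => x1; rewrite f0.
by apply: f_le_g; rewrite -ler_norml ltW.
Qed.

Let g_even p : g (- p) = g p.
Proof.
have H q : g q <= g (- q).
  have YN : -1 <= - Y q <= 1 by rewrite lerNl opprK lerNl andbC; exact: YI.
  by have := Ymax (- q) YN; rewrite fN mulrNN.
by apply/eqP; rewrite eq_le; have := H (- p); rewrite opprK => ->; rewrite H.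
Qed.

Let w_even x : w (- x) = w x.
Proof.
have H y : `|y| < 1 -> w (- y) <= w y.
  move=> y1; rewrite [leRHS]wE//.
  have := @w_le (- y) (- P y); rewrite normrN ltW// mulrNN g_even.
  by apply.
case: (ltP `|x| 1) => x1; last by rewrite !w1// normrN.
apply/eqP; rewrite eq_le H//=; have := H (- x); rewrite normrN opprK.
by apply.
Qed.

(** An infimum of lines is concave inside. If the combination is an end point, every point with
    positive weight has absolute value 1, where w is zero by definition. *)
Let w_concave : concave11 w.
Proof.
move=> x y t xI yI /andP[t0 t1].
have x1 : `|x| <= 1 by rewrite ler_norml.
have y1 : `|y| <= 1 by rewrite ler_norml.
have t1' : 0 <= 1 - t by rewrite subr_ge0.
have zI : `|t * x + (1 - t) * y| <= 1.
  apply: le_trans (ler_normD _ _) _; rewrite !normrM (ger0_norm t0) (ger0_norm t1').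
  have := ler_wpM2l t0 x1; have := ler_wpM2l t1' y1; lra.
case: (ltP `|t * x + (1 - t) * y| 1) => z1.
  rewrite [leRHS]wE//; set p := P _.
  have := ler_wpM2l t0 (w_le p x1); have := ler_wpM2l t1' (w_le p y1); lra.
rewrite [leRHS]w1//.
have tx : t * `|x| = t /\ (1 - t) * `|y| = 1 - t.
  have h : 1 <= t * `|x| + (1 - t) * `|y|.
    apply: le_trans z1 _; apply: le_trans (ler_normD _ _) _.
    by rewrite !normrM (ger0_norm t0) (ger0_norm t1').
  have := ler_wpM2l t0 x1; have := ler_wpM2l t1' y1; lra.
have tz (u v : R) : 0 <= u -> `|v| <= 1 -> u * `|v| = u -> u * w v = 0.
  move=> u0 v1 /eqP; rewrite -subr_eq0 -[X in _ - X]mulr1 -mulrBr mulf_eq0.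
  by case/orP => [/eqP->|]; [rewrite mul0r|rewrite subr_eq0 => /eqP E; rewrite w1 ?mulr0// E].
by case: tx => tx ty; rewrite (tz t x)// (tz (1 - t) y)// addr0.
Qed.

Let w_ge0 x : 0 <= w x. Proof. exact: le_trans (fp x) (w_ge x). Qed.

Let w_lip x y : `|x| < 1 -> `|y| <= 1 -> w y - w x <= `|P x| * `|y - x|.
Proof.
move=> x1 y1; have := w_le (P x) y1; rewrite (wE x1) => H.
by rewrite -normrM; apply: le_trans (ler_norm _); rewrite mulrBr; lra.
Qed.

(* A steep line through (1, small) bounds [w] near the end point. *)
Let w_end e : 0 < e -> exists2 d, 0 < d & forall y, 1 - d < y -> y < 1 -> w y <= e.
Proof.
move=> e0; have e2 : 0 < e / 2 by rewrite divr_gt0.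
have /cvgrPdist_lt /(_ _ e2) := @cf 1.
move=> /nbhs_ballP[c /= c0 cf1].
have f1 : f 1 = 0 by rewrite f0// normr1.
have [M fM] : exists M, forall y, -1 <= y <= 1 -> f y <= M.
  by have [m _ Hm] := cont_max le11 cf; exists (f m).
pose N := (`|M| + 1) / c.
have N0 : 0 < N by rewrite divr_gt0// ltr_wpDl.
have gN : g (- N) <= N + e / 2.
  rewrite /g mulNr opprK; have /andP[Y1 Y2] := YI (- N); set y := Y _ in Y1 Y2 *.
  case: (ltP (1 - y) c) => yc.
    have Hb : `|1 - y| < c by rewrite ger0_norm// subr_ge0.
    have := cf1 y Hb; rewrite /= f1 sub0r normrN => /(le_lt_trans (ler_norm _)) fy.
    have : N * y <= N by rewrite ler_piMr// ltW.
    lra.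
  have fy : f y <= M by apply: fM; rewrite Y1.
  have : N * c <= N * (1 - y) by rewrite ler_wpM2l// ltW.
  rewrite /N divfK ?gt_eqF// -/N => h.
  by have := ler_norm M; lra.
exists (Num.min 1 (e / 2 / N)); first by rewrite lt_min ltr01 divr_gt0.
move=> y; rewrite ltrBlDr -ltrBlDl lt_min => /andP[y0 yN] y1.
have y1' : `|y| <= 1 by rewrite ler_norml; apply/andP; split; lra.
apply: le_trans (w_le (- N) y1') _.
by move: yN; rewrite ltr_pdivlMr// => yN; lra.
Qed.

(** The minimising slopes are bounded uniformly near x, so w is Lipschitz there. *)
Let w_cont_in x : `|x| < 1 -> {for x, continuous w}.
Proof.
move=> x1; apply/cvgrPdist_le => e e0.
pose d := (1 - `|x|) / 2.
have d0 : 0 < d by rewrite divr_gt0// subr_gt0.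
have g00 : 0 <= g 0 by exact: le_trans (g_ge 0).
have K0 : 0 < g 0 / d + 1 by rewrite ltr_wpDl// divr_ge0// ltW.
near=> y.
have yx : `|x - y| <= e / (g 0 / d + 1).
  near: y; apply: (@cvgr_dist_le _ _ _ _ _ id); first exact: cvg_id.
  by rewrite divr_gt0.
have yd : `|x - y| <= d.
  by near: y; apply: (@cvgr_dist_le _ _ _ _ _ id); [exact: cvg_id|].
have xd : `|x| = 1 - 2 * d by rewrite /d; field.
have yb : `|y| <= 1 - d.
  have := ler_normB x (x - y); rewrite opprB addrC subrK; lra.
have PB z : `|z| <= 1 - d -> `|P z| <= g 0 / d.
  move=> zd; have z1 : `|z| < 1 by lra.
  rewrite ler_pdivlMr//; apply: le_trans (P_bound z1).
  by rewrite ler_wpM2l//; lra.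
have y1 : `|y| < 1 by lra.
have h1 := w_lip x1 (ltW y1); have h2 := w_lip y1 (ltW x1).
have Px : `|P x| <= g 0 / d by apply: PB; lra.
have Py := PB _ yb.
move: yx; rewrite ler_pdivlMr// => yx.
have xy0 : 0 <= `|x - y| by [].
have k1 := ler_wpM2r xy0 Px; have k2 := ler_wpM2r xy0 Py.
rewrite distrC in h1.
by rewrite ler_norml; apply/andP; split; lra.
Unshelve. all: end_near. Qed.

Let w_cont : continuous w.
Proof.
move=> x; case: (ltP `|x| 1) => x1; first exact: w_cont_in.
apply/cvgrPdist_le => e e0; rewrite (w1 x1).
have [d d0 wd] := w_end e0.
near=> y.
have yx : `|x - y| < d.
  by near: y; apply: (@cvgr_dist_lt _ _ _ _ _ id); [exact: cvg_id|].
rewrite sub0r normrN (ger0_norm (w_ge0 _)).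
case: (ltP `|y| 1) => y1; last by rewrite w1// ltW.
have -> : w y = w `|y| by case: (ger0P y) => // _; rewrite w_even.
apply: wd => //.
by have := ler_normB x (x - y); rewrite opprB addrC subrK; have := lerB_dist x y; lra.
Unshelve. all: end_near. Qed.

(* If all contact points of the supporting line at [x] were on one side, the line
   could be lowered at [x] by tilting it. *)
Let contact_left x p : `|x| < 1 -> (forall p', p * x + g p <= p' * x + g p') ->
  f x < p * x + g p -> exists a, [/\ -1 <= a, a < x & f a = p * a + g p].
Proof.
move=> x1 pmin fx; have := x1; rewrite ltr_norml => /andP[x1l x1r].
apply/not_existsP => H.
pose m y := p * y + g p - f y.
have cm : continuous m.
  move=> y; apply: cvgB; last exact: cf.
  by apply: cvgD; [apply: cvgM; [exact: cvg_cst|exact: cvg_id]|exact: cvg_cst].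
have [y0 /andP[y01 y02] y0min] := cont_min (ltW x1l) cm.
have m0 : 0 < m y0.
  have mge : 0 <= m y0 by rewrite subr_ge0; apply: f_le_g; rewrite y01 (le_trans y02)// ltW.
  rewrite lt_def mge andbT; apply/negP => /eqP E.
  have {}E : f y0 = p * y0 + g p by apply/esym/eqP; rewrite -subr_eq0; apply/eqP.
  case: (ltgtP y0 x) => [yx||yx]; last 2 first.
  - by rewrite ltNge y02.
  - by rewrite yx in E; rewrite -E ltxx in fx.
  by apply: (H y0); split.
have cm' : {for x, continuous m} by exact: cm.
have /cvgrPdist_lt := cm'.
have mx2 : 0 < m x / 2.
  by rewrite divr_gt0// (lt_le_trans m0)// y0min// (ltW x1l) lexx.
move=> /(_ _ mx2) /nbhs_ballP[c /= c0 mc].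
pose z := Num.min ((x + 1) / 2) (x + c / 2).
have xz : x < z by rewrite lt_min; apply/andP; split; lra.
have z1 : z < 1 by rewrite gt_min; apply/orP; left; lra.
have zc y : x <= y -> y <= z -> m x / 2 <= m y.
  move=> xy yz; have Hb : `|x - y| < c.
    rewrite ler0_norm ?subr_le0// opprB.
    have : z <= x + c / 2 by rewrite ge_min lexx orbT.
    lra.
  by have := mc y Hb; rewrite /= ltr_norml => /andP[_]; lra.
pose k := Num.min (m y0) (m x / 2).
have k0 : 0 < k by rewrite lt_min m0.
have mk y : -1 <= y -> y <= z -> k <= m y.
  move=> y1 yz; case: (leP y x) => yx.
    by rewrite ge_min y0min// y1.
  by rewrite ge_min zc ?orbT// ltW.
(* The tilt may use only half of the slack k, because z - y can be as large as 2 for y in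
   [-1, z]. *)
pose t := k / 2.
have t0 : 0 < t by rewrite divr_gt0.
have gt_ : g (p + t) <= g p - t * z.
  have /andP[Y1 Y2] := YI (p + t); rewrite {1}/g; set y := Y _ in Y1 Y2 *.
  case: (leP y z) => yz.
    have := mk y Y1 yz; rewrite /m => h.
    have : t * (z - y) <= t * 2 by rewrite ler_wpM2l ?(ltW t0)//; lra.
    by rewrite /t in t0 *; lra.
  have : t * z <= t * y by rewrite ler_wpM2l ?(ltW t0)// ltW.
  have : f y <= p * y + g p by apply: f_le_g; rewrite Y1.
  lra.
have := pmin (p + t).
have : t * x < t * z by rewrite ltr_pM2l.
lra.
Qed.

(** At a point where w exceeds f, the minimising line touches f on both sides. It bounds w from
    above and agrees with w at the two contact points, so concavity makes w equal to it between
    them. *)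
Lemma concave_envelope_exists : exists w, concave_envelope f w.
Proof.
exists w; split; [exact: w_cont|exact: w_even|exact: w_concave|exact: w1|].
split; first exact: w_ge.
  move=> M fM x x1; have := @w_le x 0 (ltW x1); rewrite mul0r add0r => /le_trans; apply.
  by rewrite /g mul0r subr0.
move=> x x1 fx; exists (P x), (g (P x)).
have fx' : f x < P x * x + g (P x) by rewrite -(wE x1).
have [a [a1 ax fa]] := contact_left x1 (P_min x1) fx'.
have [b [b1 xb fb]] : exists b, [/\ b <= 1, x < b & f b = P x * b + g (P x)].
  have Nx1 : `|- x| < 1 by rewrite normrN.
  have [||b [b1 bx fb]] := @contact_left (- x) (- P x) Nx1.
  - by move=> p'; rewrite mulrNN g_even mulrN -mulNr -(g_even p'); exact: P_min.
  - by rewrite fN mulrNN g_even.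
  exists (- b); split; [by rewrite lerNl|by rewrite ltrNr|].
  by rewrite fN fb g_even mulrN mulNr.
have x1' := x1; rewrite ltr_norml in x1'; case/andP: x1' => x1l x1r.
have wl y : `|y| <= 1 -> w y <= P x * y + g (P x) by exact: w_le.
have aI : `|a| <= 1 by rewrite ler_norml a1 ltW// (lt_trans ax).
have bI : `|b| <= 1 by rewrite ler_norml b1 andbT ltW// (lt_trans x1l).
have wa : w a = P x * a + g (P x).
  by apply/eqP; rewrite eq_le wl//= -fa w_ge.
have wb : w b = P x * b + g (P x).
  by apply/eqP; rewrite eq_le wl//= -fb w_ge.
exists a, b; split; split=> //; [|by rewrite wa|by rewrite wb].
move=> y ay yb; apply/eqP; rewrite eq_le wl/=; last first.
  by rewrite ler_norml (le_trans a1)//= (le_trans yb).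
have ab : 0 < b - a by rewrite subr_gt0 (lt_trans ax).
have aI' : -1 <= a <= 1 by rewrite -ler_norml.
have bI' : -1 <= b <= 1 by rewrite -ler_norml.
have tI : 0 <= (b - y) / (b - a) <= 1.
  apply/andP; split; first by rewrite divr_ge0// ?(ltW ab)// subr_ge0.
  by rewrite ler_pdivrMr// mul1r lerD2l lerN2.
have := w_concave aI' bI' tI.
have -> : (b - y) / (b - a) * a + (1 - (b - y) / (b - a)) * b = y by field; rewrite gt_eqF.
apply: le_trans; rewrite wa wb.
by rewrite le_eqVlt; apply/orP; left; apply/eqP; field; rewrite gt_eqF.
Qed.
End Construction.
End Envelope.

Lemma abs_lt1 {R : realType} (a b x : R) : -1 <= a -> b <= 1 -> a < x -> x < b -> `|x| < 1.
Proof. by move=> a1 b1 ax xb; rewrite ltr_norml (le_lt_trans a1)//= (lt_le_trans xb). Qed.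

(** * The concave envelope is a subsolution *)

Section EnvelopeSubsolution.
Context {R : realType}.
Implicit Types (f w u : R -> R) (x y z p q a b e h r s L : R).

(** Compactness is used on [-2, 2] and d is kept at most 1, so that when |x| > 2 both points lie
    where w vanishes. *)
Lemma uniform_continuity w e : continuous w -> (forall x, 1 <= `|x| -> w x = 0) -> 0 < e ->
  exists2 d, 0 < d & forall x y, `|x - y| <= d -> `|w x - w y| <= e.
Proof.
move=> cw w0 e0.
have /compact_near_coveringP := @segment_compact R (-2) 2.
move=> /(_ R (0^'+) (fun d x => forall y, `|x - y| <= d -> `|w x - w y| <= e) _) [].
  move=> x _; have e2 : 0 < e / 2 by rewrite divr_gt0.
  have /cvgrPdist_lt /(_ _ e2) := cw x.
  move=> /nbhs_ballP[c /= c0 wc].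
  have c2 : 0 < c / 2 by rewrite divr_gt0.
  exists (ball x (c / 2), [set d | d < c / 2]) => /=.
    split; first exact: nbhsx_ballx.
    exact: nbhs_right_lt.
  move=> [x' d] /= [xx' dc] y yd.
  have h1 : `|w x - w x'| < e / 2.
    by apply: wc; rewrite /ball/=; rewrite /ball/= in xx'; lra.
  have h2 : `|w x - w y| < e / 2.
    apply: wc; rewrite /ball/= in xx' *.
    have := ler_distD x' x y; lra.
  have := ler_distD (w x) (w x') (w y); rewrite [`|w x' - w x|]distrC; lra.
move=> d0 /= d00 Hd.
pose d := Num.min (d0 / 2) 1.
have dd : 0 < d by rewrite lt_min ltr01 divr_gt0.
have dd0 : d < d0 by rewrite gt_min; apply/orP; left; lra.
have d1 : d <= 1 by rewrite ge_min lexx orbT.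
exists d => // x y xy.
case: (leP `|x| 2) => x2.
  apply: (Hd d) => //=; last by rewrite in_itv/= -ler_norml.
  by rewrite /ball/= sub0r normrN gtr0_norm.
have y1 : 1 <= `|y| by have := lerB_dist x y; lra.
by rewrite !w0 ?subrr ?normr0 ?(ltW e0)//; lra.
Qed.

Lemma cont_bounded w : continuous w -> (forall x, 1 <= `|x| -> w x = 0) ->
  exists B, forall x, `|w x| <= B.
Proof.
move=> cw w0; have le11 : (-1 : R) <= 1 by lra.
have cn : continuous (fun x => `|w x|).
  by move=> x; apply: cvg_norm; exact: cw.
have [c _ cmax] := cont_max le11 cn.
exists `|w c| => x; case: (leP `|x| 1) => x1; last by rewrite w0 ?normr0// ltW.
by apply: cmax; rewrite -ler_norml.
Qed.

Lemma fracLap_even s w x : (forall x, w (- x) = w x) -> fracLap s w (- x) = fracLap s w x.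
Proof.
move=> wN; rewrite /fracLap; congr (- _); apply: integ_eq => r _; congr (_ * _).
rewrite -sdiffN; congr (sdiff _ _ _).
by apply/funext => y; rewrite wN.
Qed.

Lemma sdiff_even w x r : (forall x, w (- x) = w x) -> sdiff w (- x) r = sdiff w x r.
Proof.
by move=> wN; rewrite -sdiffN; congr (sdiff _ _ _); apply/funext => y; rewrite wN.
Qed.

Lemma cap_fracLap_le_abs w s x (S := sdiff w x) : (forall x, w (- x) = w x) -> concave11 w ->
  (forall x, 1 <= `|x| -> w x = 0) -> 1 / 2 < s < 1 -> `|x| < 1 ->
  intble `]0, +oo[ (fun r => S r * r `^ (- (2 * s) - 1)) ->
  intble `]0, +oo[ (fun r => S r * r `^ (- (2 * s + 2) - 1)) ->
  0 <= integ `]0, +oo[ (fun r => S r * r `^ (- (2 * s + 2) - 1)) ->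
  s * fracLap s w x <= w x.
Proof.
move=> wN wc w1 hs; rewrite /S.
case: (ger0P x) => x0 x1; first by apply: cap_fracLap_le => //; rewrite x0.
have E r : sdiff w x r = sdiff w (- x) r by rewrite sdiff_even.
rewrite -fracLap_even// -wN.
have -> : (fun r => sdiff w x r * r `^ (- (2 * s) - 1)) =
  (fun r => sdiff w (- x) r * r `^ (- (2 * s) - 1)) by apply/funext => r; rewrite E.
have -> : (fun r => sdiff w x r * r `^ (- (2 * s + 2) - 1)) =
  (fun r => sdiff w (- x) r * r `^ (- (2 * s + 2) - 1)) by apply/funext => r; rewrite E.
by apply: cap_fracLap_le => //; rewrite oppr_ge0 ltW.
Qed.

(** Small r are compared by sign only. For r > k, moving from x to y changes the second difference
    by at most 4e, its coefficients being 1, 1 and 2. *)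
Lemma fracLap_osc s w x y k e : 0 < s -> 0 < k ->
  intble `]0, +oo[ (fun r => sdiff w x r * r `^ (- (2 * s) - 1)) ->
  intble `]0, +oo[ (fun r => sdiff w y r * r `^ (- (2 * s) - 1)) ->
  (forall r, 0 < r -> r <= k -> sdiff w x r <= sdiff w y r) ->
  (forall z, `|w (z + (y - x)) - w z| <= e) ->
  fracLap s w y <= fracLap s w x + 4 * e * (k `^ (- (2 * s)) / (2 * s)).
Proof.
move=> s0 k0 jx jy near far; have q0 : 0 < 2 * s by rewrite mulr_gt0.
rewrite /fracLap -integ_y// (integ_split (ltW k0) jx) (integ_split (ltW k0) jy).
have [jx1 jx2] := intble_sub (ltW k0) jx; have [jy1 jy2] := intble_sub (ltW k0) jy.
have h1 : integ `]0, k] (fun r => sdiff w x r * r `^ (- (2 * s) - 1)) <=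
    integ `]0, k] (fun r => sdiff w y r * r `^ (- (2 * s) - 1)).
  apply: integ_le => // r /=; rewrite in_itv/= => /andP[r0 rk].
  by rewrite ler_wpM2r ?powR_ge0// near.
have h2 : integ `]k, +oo[ (fun r => sdiff w x r * r `^ (- (2 * s) - 1)) -
    4 * e * integ `]k, +oo[ (fun r => r `^ (- (2 * s) - 1)) <=
    integ `]k, +oo[ (fun r => sdiff w y r * r `^ (- (2 * s) - 1)).
  have ik := intble_y k0 q0; have ik4 := intbleZ (4 * e) (measurable_itv _) ik.
  rewrite -integZ// -integB//; apply: integ_le => //; first exact: intbleB.
  move=> r _; rewrite -mulrBl ler_wpM2r ?powR_ge0// /sdiff.
  have := far (x + r); have := far (x - r); have := far x.
  have -> : x + r + (y - x) = y + r by ring.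
  have -> : x - r + (y - x) = y - r by ring.
  have -> : x + (y - x) = y by ring.
  rewrite !ler_norml => /andP[? ?] /andP[? ?] /andP[? ?]; lra.
move: h1 h2.
move: (integ _ _) (integ _ _) (integ _ _) (integ _ _) (_ * integ _ _) => *; lra.
Qed.

Section Contact.
Variables (s L : R) (f w : R -> R).
Hypotheses (hs : 1 / 2 < s < 1) (Ef : eigenpair s L f) (Ew : concave_envelope f w).

Let q0 : 0 < 2 * s. Proof. by case/andP: hs; lra. Qed.

Lemma envelope_affine_sdiff p q a b x r : 
  (forall y, a <= y -> y <= b -> w y = p * y + q) -> 0 <= r -> a <= x - r -> x + r <= b ->
  sdiff w x r = 0.
Proof.
move=> wl r0 xa xb; rewrite /sdiff !wl; [ring|lra..].
Qed.

(** Off the contact set the second difference vanishes for small r. At a contact point it lies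
    between that of f and 0, so the integrability for f carries over. *)
Lemma intble_envelope x : `|x| < 1 ->
  intble `]0, +oo[ (fun r => sdiff w x r * r `^ (- (2 * s) - 1)).
Proof.
move=> x1; have [cw wN wc w1 [wf _ waff]] := Ew; have [cf f0 fp Lf] := Ef.
have [B wB] := cont_bounded cw w1.
have [x1l x1r] : -1 < x /\ x < 1 by move: x1; rewrite ltr_norml => /andP[].
case: (ltP (f x) (w x)) => fw.
  have [p [q [a [b [[a1 ax xb b1] [_ wl _ _]]]]]] := waff x x1 fw.
  pose k := Num.min (x - a) (b - x).
  have k0 : 0 < k by rewrite lt_min !subr_gt0 ax.
  apply: (@intble_sdiff _ w x B 0 k (2 * s) 1 cw wB k0 q0) => // r /andP[r0].
  rewrite le_min => /andP[ra rb].
  by rewrite (envelope_affine_sdiff wl) ?normr0 ?mul0r//; lra.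
have {}fw : w x = f x by apply/eqP; rewrite eq_le fw wf.
pose k := 1 - `|x|; have k0 : 0 < k by rewrite subr_gt0.
apply: (intble_split (ltW k0)); last exact: (@intble_sdiff_tail R w x B k (2 * s) cw wB k0 q0).
have [jf _] := Lf x x1.
have [jf1 _] := intble_sub (ltW k0) jf.
apply: (@intble_le _ _ _ (fun r => `|sdiff f x r * r `^ (- (2 * s) - 1)|)) => //; last exact: intble_norm.
  apply: measurable_funM; last exact: measurable_powR_cst.
  by apply: cont_measurable => //; exact: sdiff_continuous.
move=> r /=; rewrite in_itv/= => /andP[r0 rk]; rewrite !normrM ler_wpM2r//.
have Sw : sdiff w x r <= 0.
  apply: (cap_sdiff_le0 wc) => //; first exact: ltW.
    by have := ler_norm (- x); rewrite normrN /k in rk *; lra.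
  by have := ler_norm x; rewrite /k in rk *; lra.
have Sf : sdiff f x r <= sdiff w x r.
  by rewrite /sdiff fw; have := wf (x + r); have := wf (x - r); lra.
by rewrite !ler0_norm ?lerN2// (le_trans Sf).
Qed.

(** A majorant touching f at x has larger second differences there, hence a smaller Laplacian. *)
Lemma envelope_contact x : `|x| < 1 -> w x = f x -> fracLap s w x <= L * w x.
Proof.
move=> x1 wx; have [cw wN wc w1 [wf _ waff]] := Ew; have [cf f0 fp Lf] := Ef.
have [jf <-] : intble `]0, +oo[ (fun r => sdiff f x r * r `^ (- (2 * s) - 1)) /\
  fracLap s f x = L * w x by rewrite wx; exact: Lf.
rewrite /fracLap lerN2; apply: integ_le => //; first exact: intble_envelope.
move=> r _; rewrite ler_wpM2r ?powR_ge0// /sdiff wx.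
by have := wf (x + r); have := wf (x - r); lra.
Qed.

Section Affine.
Variables (p q a b : R).
Hypotheses (a1 : -1 <= a) (ab : a < b) (b1 : b <= 1)
  (wl : forall y, `|y| <= 1 -> w y <= p * y + q)
  (wE : forall y, a <= y -> y <= b -> w y = p * y + q).

(** The subsolution inequality holds at the contact point a, and the Laplacian of w cannot jump up
    when moving from a into the affine interval: S_w(a, r) <= S_w(x, r) for small r, and larger r
    change little by uniform continuity. *)
Lemma envelope_left_interior e : -1 < a -> w a = f a -> 0 < e ->
  exists2 d, 0 < d & forall x, a < x -> x < a + d -> x < b -> fracLap s w x - L * w x <= e.
Proof.
move=> a1' wa e0; have [cw wN wc w1 [wf _ _]] := Ew.
have ab' := ab; have b1' := b1.
have L0 : 0 < L.
  have := eigenvalue_gap hs Ef; have s0 : 0 < s by have := q0; lra.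
  by move=> /(lt_trans ltr01); rewrite pmulr_rgt0.
pose r0 := Num.min (1 + a) ((b - a) / 2).
have r00 : 0 < r0 by rewrite lt_min; apply/andP; split; lra.
have K0 : 0 < 4 * (r0 `^ (- (2 * s)) / (2 * s)) + L.
  by rewrite ltr_wpDl// mulr_ge0// divr_ge0 ?powR_ge0// ltW// q0.
set K := _ + L in K0.
have [d d0 wd] := uniform_continuity cw w1 (divr_gt0 e0 K0).
have d0' : 0 < Num.min d ((b - a) / 2) by rewrite lt_min d0/=; lra.
exists (Num.min d ((b - a) / 2)) => // x ax; rewrite -ltrBlDl lt_min => /andP[xd xb'] xb.
have aI : `|a| < 1 by rewrite ltr_norml a1'/=; lra.
have xI : `|x| < 1 by exact: abs_lt1 ax xb.
have Da : fracLap s w a <= L * w a by exact: envelope_contact.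
have h1 : fracLap s w x <= fracLap s w a + 4 * (e / K) * (r0 `^ (- (2 * s)) / (2 * s)).
  apply: fracLap_osc => //; [by have := q0; lra|exact: intble_envelope|exact: intble_envelope| |].
    move=> r rp; rewrite le_min => /andP[r1 r2].
    have [ar xr xrb] : [/\ a <= a + r, a + r <= b & x + r <= b].
      by split; move: ab xb' r2 rp; goal_lra.
    rewrite /sdiff (wE (y := a + r)) ?(wE (y := a)) ?(wE (y := x + r)) ?(wE (y := x)) ?lexx ?(ltW ab) ?(ltW ax) ?(ltW xb)//; last first.
      by move: ax rp; goal_lra.
    (* After subtracting the line, w is concave, nonpositive, and zero on [a, b]; it can only grow
       from a - r to x - r. *)
    suff : w (a - r) - (p * (a - r) + q) <= w (x - r) - (p * (x - r) + q) by lra.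
    case: (leP a (x - r)) => xr'.
      rewrite (wE (y := x - r)) ?subrr ?subr_le0//.
        by apply: wl; rewrite ler_norml; apply/andP; split; move: r1 rp a1' ax xr ab b1'; goal_lra.
      by move: xb rp; goal_lra.
    have arI : -1 <= a - r <= 1 by apply/andP; split; move: r1 rp ab' b1'; goal_lra.
    have aI' : -1 <= a <= 1 by rewrite (ltW a1') ltW// (lt_le_trans ab').
    have [t tE] : exists t, t = (a - (x - r)) / r by eexists.
    have tr : t * r = a - (x - r) by rewrite tE divfK// gt_eqF.
    have tI : 0 <= t <= 1.
      by rewrite tE divr_ge0 ?ler_pdivrMr// ?mul1r; move: xr' rp ax; goal_lra.
    have := wc _ _ _ arI aI' tI.
    have -> : t * (a - r) + (1 - t) * a = x - r by goal_lra.
    rewrite (wE (y := a)) ?(ltW ab)//.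
    have wle : w (a - r) <= p * (a - r) + q by apply: wl; rewrite ler_norml.
    have /andP[t0 t1] := tI.
    have D0 : 0 <= (1 - t) * (p * (a - r) + q - w (a - r)).
      by rewrite mulr_ge0// subr_ge0.
    have ptr : p * (t * r) = p * (a - (x - r)) by rewrite tr.
    move: D0 wle; goal_lra.
  move=> z; rewrite distrC; apply: wd; rewrite opprD addrA subrr sub0r normrN gtr0_norm; move: ax xd; goal_lra.
have h2 : `|a - x| <= d by rewrite distrC gtr0_norm; move: ax xd; goal_lra.
have := wd _ _ h2; rewrite ler_norml => /andP[_ h3].
have h4 : L * (w a - w x) <= L * (e / K) by rewrite ler_wpM2l// ltW.
have h5 : 4 * (e / K) * (r0 `^ (- (2 * s)) / (2 * s)) + L * (e / K) = e.
  by rewrite (_ : _ + _ = e / K * K); [rewrite divfK// gt_eqF|rewrite /K; ring].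
lra.
Qed.

(** Near -1, w is p t with t = 1 + x, and the extension by zero has a convex corner at t = 0. For t
    small against the length B of the affine interval, the corner makes -S_w nonpositive for r <= 2t
    and at most -p t for 2t < r <= B/2, which outweighs the contribution of at most 2 p t for each r
    > B/2. *)
Lemma envelope_left_boundary : a = -1 ->
  exists2 d, 0 < d & forall x, a < x -> x < a + d -> x < b -> fracLap s w x <= 0.
Proof.
move=> aE; have [cw wN wc w1 [wf _ _]] := Ew; have [cf f0 fp _] := Ef.
have ab' := ab; have b1' := b1; rewrite aE in ab'.
have w0 x : 0 <= w x by exact: cap_ge0.
pose B := b + 1.
have B0 : 0 < B by rewrite /B; lra.
have qp : q = p.
  have := wE (lexx a) (ltW ab); rewrite aE w1 ?normrN ?normr1//; lra.
have wl' t : 0 <= t -> t <= B -> w (-1 + t) = p * t.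
  by move=> t0 tB; rewrite wE ?aE ?qp; [ring|lra|rewrite /B in tB; lra].
have p0 : 0 <= p.
  by have := w0 (-1 + B); rewrite wl' ?(ltW B0)// pmulr_lge0.
exists (B / 12); first by rewrite divr_gt0.
move=> x ax xd xb.
have [t [tE t0 tB]] : exists t, [/\ x = -1 + t, 0 < t & t < B / 12].
  by exists (x + 1); split; rewrite ?aE in ax xd *; lra.
have xI : `|x| < 1 by exact: abs_lt1 ax xb.
have jx := intble_envelope xI.
have jN : intble `]0, +oo[ (fun r => - sdiff w x r * r `^ (- (2 * s) - 1)).
  by apply: (intble_eq _ (f := fun r => - (sdiff w x r * r `^ (- (2 * s) - 1)))) => // [r _|]; [rewrite mulNr|exact: intbleN].
have -> : fracLap s w x = integ `]0, +oo[ (fun r => - sdiff w x r * r `^ (- (2 * s) - 1)).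
  by rewrite /fracLap -integN//; apply: integ_eq => r _; rewrite mulNr.
have t2 : 0 < 2 * t by rewrite mulr_gt0.
have tB2 : 2 * t <= B / 2 by move: tB B0; goal_lra.
have B20 : 0 < B / 2 by rewrite divr_gt0.
have [j1 j2] := intble_sub (ltW t2) jN; have [j3 j4] := intble_sub tB2 j2.
rewrite (integ_split (ltW t2) jN) (integ_split tB2 j2).
have TE r : 0 < r -> - sdiff w x r = 2 * (p * t) - w (-1 + (t + r)) - w (-1 + (t - r)).
  by move=> r0; rewrite /sdiff tE wl'; [rewrite !addrA; ring|exact: ltW|move: tB B0; goal_lra].
have wz r : t <= r -> w (-1 + (t - r)) = 0.
  by move=> tr; rewrite w1// ler0_norm; lra.
have I1 : integ `]0, 2 * t] (fun r => - sdiff w x r * r `^ (- (2 * s) - 1)) <= 0.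
  rewrite -oppr_ge0 -integN//; apply: integ_ge0 => r /=; rewrite in_itv/= => /andP[r0 r2].
  rewrite -mulNr mulr_ge0 ?powR_ge0// oppr_ge0 TE// wl'; [|move: t0 r0 r2 tB; goal_lra..].
  case: (leP t r) => tr.
    by rewrite wz//; have := mulr_ge0 p0 (_ : 0 <= r - t); rewrite subr_ge0 => /(_ tr); goal_lra.
  by rewrite wl'; move: r0 tr tB; goal_lra.
have q0' := q0.
have I2 : integ `]2 * t, B / 2] (fun r => - sdiff w x r * r `^ (- (2 * s) - 1)) <=
   - (p * t) * (((2 * t) `^ (- (2 * s)) - (B / 2) `^ (- (2 * s))) / (2 * s)).
  have [ik _] := intble_sub tB2 (intble_y t2 q0).
  rewrite -integ_oc// -integZ//; apply: integ_le => //; first exact: intbleZ.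
  move=> r /=; rewrite in_itv/= => /andP[r0 r2]; rewrite ler_wpM2r ?powR_ge0//.
  rewrite TE ?(wl' (t + r)) ?wz; move: r0 r2 t0 tB; [|goal_lra..].
  move=> {}r0 _ _ _.
  by have := mulr_ge0 p0 (_ : 0 <= r - 2 * t); rewrite subr_ge0 => /(_ (ltW r0)); goal_lra.
have I3 : integ `]B / 2, +oo[ (fun r => - sdiff w x r * r `^ (- (2 * s) - 1)) <=
   2 * (p * t) * ((B / 2) `^ (- (2 * s)) / (2 * s)).
  have ik := intble_y B20 q0.
  rewrite -integ_y// -integZ//; apply: integ_le => //; first exact: intbleZ.
  move=> r /=; rewrite in_itv/= andbT => r0; rewrite ler_wpM2r ?powR_ge0//.
  rewrite TE; last exact: lt_trans r0.
  by have := w0 (-1 + (t + r)); have := w0 (-1 + (t - r)); goal_lra.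
(* Origin of B/12: t < B/12 means 2t < B/6, a third of B/2, and 3^(2s) >= 3. *)
have pw : 3 * (B / 2) `^ (- (2 * s)) <= (2 * t) `^ (- (2 * s)).
  have q1 : 1 <= 2 * s by case/andP: hs; goal_lra.
  apply: (@le_trans _ _ ((B / 2 / 3) `^ (- (2 * s)))).
    rewrite (@powRM _ (B / 2) 3^-1) ?(ltW B20) ?invr_ge0// mulrC ler_wpM2l ?powR_ge0//.
    have -> : (3^-1 : R) `^ (- (2 * s)) = 3 `^ (2 * s).
      by rewrite -powR_inv1// -powRrM mulN1r opprK.
    by rewrite -[leLHS]powRr1// ler_powR// ler1n.
  rewrite !powRN lef_pV2 ?posrE ?powR_gt0//; last by rewrite divr_gt0.
  by apply: ge0_ler_powR; rewrite ?nnegrE; move: t0 tB B0 q1; goal_lra.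
have pt : 0 <= p * t by rewrite mulr_ge0// ltW.
have : 0 <= p * t / (2 * s) * ((2 * t) `^ (- (2 * s)) - 3 * (B / 2) `^ (- (2 * s))).
  by rewrite mulr_ge0 ?subr_ge0// divr_ge0// ltW.
move: I1 I2 I3.
move: (integ _ _) (integ _ _) (integ _ _) => x1 x2 x3 h1 h2 h3 h4.
have : - (p * t) * (((2 * t) `^ (- (2 * s)) - (B / 2) `^ (- (2 * s))) / (2 * s)) +
   2 * (p * t) * ((B / 2) `^ (- (2 * s)) / (2 * s)) =
  - (p * t / (2 * s) * ((2 * t) `^ (- (2 * s)) - 3 * (B / 2) `^ (- (2 * s)))) by ring.
move: h1 h2 h3 h4; move: (_ * (_ / _)) (_ * (_ / _)) (_ / _ * _); goal_lra.
Qed.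

Lemma envelope_left_end e : w a = f a -> 0 < e ->
  exists2 d, 0 < d & forall x, a < x -> x < a + d -> x < b -> fracLap s w x - L * w x <= e.
Proof.
move=> wa e0; have := a1; rewrite le_eqVlt => /predU1P[aE|a1'].
  have [d d0 Hd] := envelope_left_boundary (esym aE).
  exists d => // x ax xd xb; have [cw wN wc w1 _] := Ew.
  have := Hd x ax xd xb; have wx : 0 <= w x by exact: cap_ge0.
  have L0 : 0 < L.
    have := eigenvalue_gap hs Ef; have s0 : 0 < s by have := q0; lra.
    by move=> /(lt_trans ltr01); rewrite pmulr_rgt0.
  have := mulr_ge0 (ltW L0) wx; lra.
exact: envelope_left_interior.
Qed.

(** Near x, second differences of w vanish for r <= k, so only the kernel tail, which depends
    continuously on the point, remains. *)
Lemma fracLap_affine_cont x : a < x -> x < b -> {for x, continuous (fracLap s w)}.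
Proof.
move=> ax xb; have [cw wN wc w1 _] := Ew.
have s0 : 0 < s by have := q0; lra.
have [a1' b1'] := (a1, b1).
pose k := Num.min (x - a) (b - x) / 2.
have k0 : 0 < k by rewrite divr_gt0// lt_min !subr_gt0 ax.
have [xa bx] : 2 * k <= x - a /\ 2 * k <= b - x.
  by rewrite /k mulrC divfK//; split; rewrite ge_min lexx ?orbT.
have K0 : 0 < 4 * (k `^ (- (2 * s)) / (2 * s)).
  by rewrite mulr_gt0// divr_gt0 ?powR_gt0// q0.
apply/cvgrPdist_le => e e0.
have [d d0 wd] := uniform_continuity cw w1 (divr_gt0 e0 K0).
near=> y.
have yd : `|x - y| <= d.
  by near: y; apply: (@cvgr_dist_le _ _ _ _ _ id); [exact: cvg_id|].
have yk : `|x - y| <= k.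
  by near: y; apply: (@cvgr_dist_le _ _ _ _ _ id); [exact: cvg_id|].
have /andP[yk1 yk2] : - k <= x - y <= k by rewrite -ler_norml.
have xI : `|x| < 1 by exact: abs_lt1 ax xb.
have yI : `|y| < 1 by apply: (abs_lt1 a1 b1); have := k0; move: yk1 yk2 xa bx; goal_lra.
have Sx r : 0 < r -> r <= k -> sdiff w x r = 0.
  by move=> r0 rk; apply: (envelope_affine_sdiff wE); have := k0; move: r0 rk yk1 yk2 xa bx; goal_lra.
have Sy r : 0 < r -> r <= k -> sdiff w y r = 0.
  by move=> r0 rk; apply: (envelope_affine_sdiff wE); have := k0; move: r0 rk yk1 yk2 xa bx; goal_lra.
have jx := intble_envelope xI; have jy := intble_envelope yI.
have Ee : 4 * (e / (4 * (k `^ (- (2 * s)) / (2 * s)))) * (k `^ (- (2 * s)) / (2 * s)) = e.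
  move: K0; move: (_ / (2 * s)) => Z; rewrite pmulr_rgt0// => Z0.
  by field; rewrite gt_eqF.
have h1 : fracLap s w y <= fracLap s w x + e.
  rewrite -[X in _ + X]Ee; apply: fracLap_osc => // [r r0 rk|z]; first by rewrite Sx// Sy.
  by apply: wd; rewrite addrAC subrr add0r distrC.
have h2 : fracLap s w x <= fracLap s w y + e.
  rewrite -[X in _ + X]Ee; apply: fracLap_osc => // [r r0 rk|z]; first by rewrite Sx// Sy.
  by apply: wd; rewrite addrAC subrr add0r.
by rewrite ler_norml; apply/andP; split; move: h1 h2; goal_lra.
Unshelve. all: end_near. Qed.

End Affine.

Lemma envelope_noncontact x : `|x| < 1 -> f x < w x -> fracLap s w x <= L * w x.
Proof.
move=> xI fw; have [cw wN wc w1 [wf _ waff]] := Ew; have [cf f0 fp Lf] := Ef.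
have gap := eigenvalue_gap hs Ef; have /andP[s12 s1] := hs.
have s0 : 0 < s by lra.
have hs' : 0 < s < 1 by rewrite s0.
have [p [q [a [b [[a1 ax xb b1] [wl wE wa wb]]]]]] := waff x xI fw.
have ab : a < b by exact: lt_trans xb.
pose Th y := fracLap s w y - L * w y.
rewrite -subr_le0 leNgt; apply/negP => Thx.
(* Half of the positive value is the tolerance at both ends. A maximum of [Th] over [[a', b']],
   being at least [Th x], then cannot sit at an end. *)
have e0 : 0 < Th x / 2 by rewrite divr_gt0.
have [d1 d10 left] := envelope_left_end a1 ab b1 wl wE wa e0.
(* The right end is the left end of the reflected interval, since both w and f are even. *)
have [d2 d20 right] : exists2 d, 0 < d & forall y, b - d < y -> y < b -> a < y ->
    Th y <= Th x / 2.
  have wl' y : `|y| <= 1 -> w y <= - p * y + q.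
    by rewrite -wN -normrN => /wl; rewrite mulrN mulNr.
  have wE' y : - b <= y -> y <= - a -> w y = - p * y + q.
    move=> yb ya; rewrite -wN wE; [by rewrite mulrN mulNr|by rewrite lerNr|by rewrite lerNl].
  have fN := eigenpair_even hs Ef.
  have [||||d d0 Hd] := @envelope_left_end (- p) q (- b) (- a) _ _ _ wl' wE' (Th x / 2) _ e0.
  - by rewrite lerN2.
  - by rewrite ltrN2.
  - by rewrite lerNl.
  - by rewrite wN fN.
  exists d => // y yb1 yb2 ya.
  by have := Hd (- y); rewrite /Th fracLap_even// wN; apply; move: yb1 yb2 ya; goal_lra.
pose a' := a + Num.min (d1 / 2) ((x - a) / 2).
pose b' := b - Num.min (d2 / 2) ((b - x) / 2).
have [aa' a'd a'x] : [/\ a < a', a' < a + d1 & a' < x].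
  have m0 : 0 < Num.min (d1 / 2) ((x - a) / 2) by rewrite lt_min !divr_gt0// subr_gt0.
  have m1 : Num.min (d1 / 2) ((x - a) / 2) <= d1 / 2 by rewrite ge_min lexx.
  have m2 : Num.min (d1 / 2) ((x - a) / 2) <= (x - a) / 2 by rewrite ge_min lexx orbT.
  rewrite /a'; move: m0 m1 m2; move: (Num.min _ _) => m m0 m1 m2.
  by split; move: m0 m1 m2 d10 ax; goal_lra.
have [bb' b'd b'x] : [/\ b' < b, b - d2 < b' & x < b'].
  have m0 : 0 < Num.min (d2 / 2) ((b - x) / 2) by rewrite lt_min !divr_gt0// subr_gt0.
  have m1 : Num.min (d2 / 2) ((b - x) / 2) <= d2 / 2 by rewrite ge_min lexx.
  have m2 : Num.min (d2 / 2) ((b - x) / 2) <= (b - x) / 2 by rewrite ge_min lexx orbT.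
  rewrite /b'; move: m0 m1 m2; move: (Num.min _ _) => m m0 m1 m2.
  by split; move: m0 m1 m2 d20 xb; goal_lra.
have Tha : Th a' <= Th x / 2 by apply: left => //; exact: lt_trans xb.
have Thb : Th b' <= Th x / 2 by apply: right => //; exact: lt_trans b'x.
have ab' : a' <= b' by lra.
have [|x1 x1I x1max] := @EVT_max R Th a' b' ab'.
  apply: continuous_in_subspaceT => y /set_mem/=; rewrite in_itv/= => /andP[ya yb].
  have cy : {for y, continuous (fracLap s w)}.
    by apply: (fracLap_affine_cont a1 b1 wE); [exact: lt_le_trans ya|exact: le_lt_trans bb'].
  apply: cvgB; first exact: cy.
  by apply: cvgM; [exact: cvg_cst|exact: cw].
have Thx1 : Th x <= Th x1 by apply: x1max; rewrite in_itv/= !ltW.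
have [ax1 x1b] : a' < x1 /\ x1 < b'.
  move: x1I; rewrite in_itv/= => /andP[l1 l2]; split.
    by rewrite lt_neqAle l1 andbT; apply/negP => /eqP E; move: Thx1 Tha e0; rewrite -E; goal_lra.
  by rewrite lt_neqAle l2 andbT; apply/negP => /eqP E; move: Thx1 Thb e0; rewrite E; goal_lra.
pose e := Num.min (x1 - a') (b' - x1) / 2.
have ee0 : 0 < e by rewrite divr_gt0// lt_min !subr_gt0 ax1.
have [e1 e2] : 2 * e <= x1 - a' /\ 2 * e <= b' - x1.
  by rewrite /e mulrC divfK//; split; rewrite ge_min lexx ?orbT.
have ax1' : a < x1 by exact: lt_trans ax1.
have x1b' : x1 < b by exact: lt_trans bb'.
have x1lt : `|x1| < 1 by exact: abs_lt1 ax1' x1b'.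
have flat : flat_at w x1 e 0.
  move=> y r; rewrite ler_norml => /andP[y1 y2] r0 re.
  rewrite (envelope_affine_sdiff wE); [by rewrite normr0 !mul0r|exact: ltW|..];
    by move: aa' bb' y1 y2 re e1 e2; goal_lra.
have [B wB] := cont_bounded cw w1.
have S0 r : 0 < r -> r <= e -> sdiff w x1 r = 0.
  move=> r0 re; apply: (envelope_affine_sdiff wE); first exact: ltW.
    by move: aa' re e1 r0; goal_lra.
  by move: bb' re e2 r0; goal_lra.
have I3 := flat_intble3 hs' cw wB ee0 flat.
have I30 : 0 <= integ `]0, +oo[ (fun r => sdiff w x1 r * r `^ (- (2 * s + 2) - 1)).
  apply: (integ_flat_ge0 hs' cw wB ee0 flat) => [r r0 re|h h0 he]; first by rewrite S0.
  rewrite mul0r.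
  have h1 : Th (x1 + h) <= Th x1.
    by apply: x1max; rewrite in_itv/=; apply/andP; split; move: h0 he e1 e2; goal_lra.
  have h2 : Th (x1 - h) <= Th x1.
    by apply: x1max; rewrite in_itv/=; apply/andP; split; move: h0 he e1 e2; goal_lra.
  have h3 := S0 h h0 he.
  have h4 : L * sdiff w x1 h = 0 by rewrite h3 mulr0.
  by move: h1 h2 h4; rewrite /Th /sdiff; goal_lra.
have T := cap_fracLap_le_abs wN wc w1 hs x1lt (intble_envelope x1lt) I3 I30.
have w10 : 0 < w x1 by apply: lt_le_trans (wf x1); exact: fp.
have Th1 : L * w x1 < fracLap s w x1 by rewrite -subr_gt0 -/(Th x1); exact: lt_le_trans Thx1.
have : s * (L * w x1) < w x1 by apply: lt_le_trans T; rewrite ltr_pM2l.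
by rewrite mulrA -[ltRHS]mul1r ltr_pM2r// ltNge (ltW gap).
Qed.

(** The factor relating w to f is 1: at a maximum of f the constant line already bounds the
    envelope, so w and f agree there. *)
Lemma envelope_eq x : w x = f x.
Proof.
have [cw wN wc w1 [wf wM waff]] := Ew; have [cf f0 fp Lf] := Ef.
have [|t Ht] := @subsolution_proportional R s L f w hs Ef cw w1.
  move=> y y1; split; first exact: intble_envelope.
  case: (ltP (f y) (w y)) => fy; first exact: envelope_noncontact.
  by apply: envelope_contact => //; apply/eqP; rewrite eq_le fy wf.
have [y [y1 ymax]] := eigenpair_max Ef.
have E : w y = f y by apply/eqP; rewrite eq_le wf andbT; apply: wM.
have t1 : t = 1.
  apply: (@mulIf _ (f y)); first by rewrite gt_eqF// fp.
  by rewrite -Ht E mul1r.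
by rewrite Ht t1 mul1r.
Qed.

End Contact.

Lemma eigenpair_concave s L f : 1 / 2 < s < 1 -> eigenpair s L f -> concave11 f.
Proof.
move=> hs Ef; have [cf f0 fp _] := Ef.
have f_ge0 x : 0 <= f x.
  by case: (ltP `|x| 1) => x1; [exact/ltW/fp|rewrite f0].
have [w Ew] := concave_envelope_exists cf (eigenpair_even hs Ef) f0 f_ge0.
have [_ _ wc _ _] := Ew.
by move=> x y t xI yI tI; rewrite -!(envelope_eq hs Ef Ew); exact: wc.
Qed.
End EnvelopeSubsolution.

(** * Strict concavity *)

Section StrictConcavity.
Context {R : realType}.
Implicit Types (f g : R -> R) (x y t r h e s L K : R).

Lemma is_derive_comp_add g x t d : is_derive (x + t) 1 g d ->
  is_derive t 1 (fun t => g (x + t)) d.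
Proof.
move=> H; have D := is_deriveD (is_derive_cst x t 1) (is_derive_id t (1 : R)).
by have := is_derive1_comp (f := g) (g := cst x + @id R) H D; rewrite add0r mulr1.
Qed.

Lemma is_derive_comp_sub g x t d : is_derive (x - t) 1 g d ->
  is_derive t 1 (fun t => g (x - t)) (- d).
Proof.
move=> H; have D := is_deriveB (is_derive_cst x t 1) (is_derive_id t (1 : R)).
by have := is_derive1_comp (f := g) (g := cst x - @id R) H D; rewrite sub0r mulrN1.
Qed.

Lemma sdiff_le_second (g g1 g2 : R -> R) x r K : 0 <= r ->
  (forall y, `|y - x| <= r -> is_derive y 1 g (g1 y)) ->
  (forall y, `|y - x| <= r -> is_derive y 1 g1 (g2 y)) ->
  (forall y, `|y - x| <= r -> g2 y <= K) -> sdiff g x r <= K * r ^+ 2.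
Proof.
move=> r0 dg dg1 g2K; rewrite -subr_ge0.
have near t : 0 <= t <= r -> `|x + t - x| <= r /\ `|x - t - x| <= r.
  by move=> /andP[t0 tr]; rewrite [x + t]addrC addrK addrAC subrr add0r normrN ger0_norm.
pose F t := K * (t * t) - sdiff g x t.
have -> : K * r ^+ 2 - sdiff g x r = F r by rewrite /F expr2.
apply: (@second_derive_ge0 R F (fun t => K * (2 * t) - (g1 (x + t) - g1 (x - t)))
  (fun t => 2 * K - (g2 (x + t) + g2 (x - t))) r r0).
- by rewrite /F /sdiff addr0 subr0; ring.
- by rewrite addr0 subr0; ring.
- move=> t /near[t1 t2]; have D1 := is_derive_comp_add (dg _ t1).
  have D2 := is_derive_comp_sub (dg _ t2).
  rewrite /F /sdiff; apply: is_derive_eq.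
  by rewrite /GRing.scale/=; ring.
- move=> t /near[t1 t2]; have D1 := is_derive_comp_add (dg1 _ t1).
  have D2 := is_derive_comp_sub (dg1 _ t2).
  apply: is_derive_eq.
  by rewrite /GRing.scale/=; ring.
- move=> t /near[t1 t2]; have := g2K _ t1; have := g2K _ t2; lra.
Qed.

Lemma sdiff_ge_second (g g1 g2 : R -> R) x r K : 0 <= r ->
  (forall y, `|y - x| <= r -> is_derive y 1 g (g1 y)) ->
  (forall y, `|y - x| <= r -> is_derive y 1 g1 (g2 y)) ->
  (forall y, `|y - x| <= r -> K <= g2 y) -> K * r ^+ 2 <= sdiff g x r.
Proof.
move=> r0 dg dg1 g2K; rewrite -subr_ge0.
have near t : 0 <= t <= r -> `|x + t - x| <= r /\ `|x - t - x| <= r.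
  by move=> /andP[t0 tr]; rewrite [x + t]addrC addrK addrAC subrr add0r normrN ger0_norm.
pose F t := sdiff g x t - K * (t * t).
have -> : sdiff g x r - K * r ^+ 2 = F r by rewrite /F expr2.
apply: (@second_derive_ge0 R F (fun t => g1 (x + t) - g1 (x - t) - K * (2 * t))
  (fun t => g2 (x + t) + g2 (x - t) - 2 * K) r r0).
- by rewrite /F /sdiff addr0 subr0; ring.
- by rewrite addr0 subr0; ring.
- move=> t /near[t1 t2]; have D1 := is_derive_comp_add (dg _ t1).
  have D2 := is_derive_comp_sub (dg _ t2).
  rewrite /F /sdiff; apply: is_derive_eq.
  by rewrite /GRing.scale/=; ring.
- move=> t /near[t1 t2]; have D1 := is_derive_comp_add (dg1 _ t1).
  have D2 := is_derive_comp_sub (dg1 _ t2).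
  apply: is_derive_eq.
  by rewrite /GRing.scale/=; ring.
- move=> t /near[t1 t2]; have := g2K _ t1; have := g2K _ t2; lra.
Qed.

(** K t^2 minus g, or plus g, has second derivative at least 2K - K >= 0. The boolean [sg] runs
    through the two signs; [P] and [N] treat the two sides of x. *)
Lemma quadratic_bound (g g1 g2 : R -> R) x r K : 0 <= r -> g x = 0 -> g1 x = 0 ->
  (forall y, `|y - x| <= r -> is_derive y 1 g (g1 y)) ->
  (forall y, `|y - x| <= r -> is_derive y 1 g1 (g2 y)) ->
  (forall y, `|y - x| <= r -> `|g2 y| <= K) ->
  forall y, `|y - x| <= r -> `|g y| <= K * `|y - x| ^+ 2.
Proof.
move=> r0 gx g1x dg dg1 g2K.
have K0 : 0 <= K by apply: le_trans (g2K x _); rewrite ?subrr ?normr0.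
have near t u : 0 <= t -> t <= u -> u <= r -> `|x + t - x| <= r /\ `|x - t - x| <= r.
  move=> t0 tu ur; rewrite [x + t]addrC addrK addrAC subrr add0r normrN ger0_norm//.
  by rewrite (le_trans tu).
have P u (sg : bool) : 0 <= u <= r -> 0 <= K * (u * u) - (-1) ^+ sg * g (x + u).
  move=> /andP[u0 ur].
  apply: (@second_derive_ge0 R (fun t => K * (t * t) - (-1) ^+ sg * g (x + t))
    (fun t => K * (2 * t) - (-1) ^+ sg * g1 (x + t))
    (fun t => 2 * K - (-1) ^+ sg * g2 (x + t)) u u0).
  - by rewrite addr0 gx; ring.
  - by rewrite addr0 g1x; ring.
  - move=> t /andP[t0 tu]; have [t1 _] := near _ _ t0 tu ur.
    have D1 := is_derive_comp_add (dg _ t1).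
    by apply: is_derive_eq; rewrite /GRing.scale/=; ring.
  - move=> t /andP[t0 tu]; have [t1 _] := near _ _ t0 tu ur.
    have D1 := is_derive_comp_add (dg1 _ t1).
    by apply: is_derive_eq; rewrite /GRing.scale/=; ring.
  - move=> t /andP[t0 tu]; have [t1 _] := near _ _ t0 tu ur.
    have := g2K _ t1; rewrite ler_norml => /andP[? ?].
    by case: sg; rewrite ?expr1 ?expr0; lra.
have N u (sg : bool) : 0 <= u <= r -> 0 <= K * (u * u) - (-1) ^+ sg * g (x - u).
  move=> /andP[u0 ur].
  apply: (@second_derive_ge0 R (fun t => K * (t * t) - (-1) ^+ sg * g (x - t))
    (fun t => K * (2 * t) + (-1) ^+ sg * g1 (x - t))
    (fun t => 2 * K - (-1) ^+ sg * g2 (x - t)) u u0).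
  - by rewrite subr0 gx; ring.
  - by rewrite subr0 g1x; ring.
  - move=> t /andP[t0 tu]; have [_ t1] := near _ _ t0 tu ur.
    have D1 := is_derive_comp_sub (dg _ t1).
    by apply: is_derive_eq; rewrite /GRing.scale/=; ring.
  - move=> t /andP[t0 tu]; have [_ t1] := near _ _ t0 tu ur.
    have D1 := is_derive_comp_sub (dg1 _ t1).
    by apply: is_derive_eq; rewrite /GRing.scale/=; ring.
  - move=> t /andP[t0 tu]; have [_ t1] := near _ _ t0 tu ur.
    have := g2K _ t1; rewrite ler_norml => /andP[? ?].
    by case: sg; rewrite ?expr1 ?expr0; lra.
move=> y yr; rewrite ler_norml expr2.
have uI : 0 <= `|y - x| <= r by rewrite normr_ge0.
case: (ger0P (y - x)) uI => yx uI.
  have := P _ true uI; have := P _ false uI; rewrite addrCA subrr addr0 expr1 expr0.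
  by move=> ? ?; apply/andP; split; lra.
have := N _ true uI; have := N _ false uI; rewrite opprK addrCA subrr addr0 expr1 expr0.
by move=> ? ?; apply/andP; split; lra.
Qed.

Lemma is_derive_cont f x d : is_derive x 1 f d -> {for x, continuous f}.
Proof.
by move=> H; apply: differentiable_continuous; apply/derivable1_diffP; exact: ex_derive.
Qed.

Lemma eigenpair_second_derive_lt0 s L (f f1 f2 f3 f4 : R -> R) : 1 / 2 < s < 1 ->
  eigenpair s L f ->
  (forall x, `|x| < 1 -> is_derive x 1 f (f1 x)) ->
  (forall x, `|x| < 1 -> is_derive x 1 f1 (f2 x)) ->
  (forall x, `|x| < 1 -> is_derive x 1 f2 (f3 x)) ->
  (forall x, `|x| < 1 -> is_derive x 1 f3 (f4 x)) ->
  (forall x, `|x| < 1 -> {for x, continuous f4}) ->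
  forall x, `|x| < 1 -> f2 x < 0.
Proof.
move=> hs Ef d1 d2 d3 d4 c4.
have [cf f0 fp Lf] := Ef; have fN := eigenpair_even hs Ef.
have fc := eigenpair_concave hs Ef; have gap := eigenvalue_gap hs Ef.
have /andP[s12 s1] := hs.
have s0 : 0 < s by lra.
have L0 : 0 < L by move: gap => /(lt_trans ltr01); rewrite pmulr_rgt0.
have hs' : 0 < s < 1 by rewrite s0.
have inI x r y : `|x| + r < 1 -> `|y - x| <= r -> `|y| < 1.
  move=> xr yx; apply: le_lt_trans xr; have := ler_normD x (y - x).
  rewrite addrCA subrr addr0; move: yx; goal_lra.
have S_le0 x r : 0 <= r -> `|x| + r <= 1 -> sdiff f x r <= 0.
  move=> r0 xr; apply: (cap_sdiff_le0 fc) => //.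
    by have := ler_norm (- x); rewrite normrN; lra.
  by have := ler_norm x; lra.
have f2_le0 x : `|x| < 1 -> f2 x <= 0.
  move=> x1; rewrite leNgt; apply/negP => f2x.
  have c2 := is_derive_cont (d3 x x1).
  have f2x2 : 0 < f2 x / 2 by rewrite divr_gt0.
  have /cvgrPdist_lt /(_ _ f2x2) /nbhs_ballP[c /= c0 Hc] := c2.
  pose r := Num.min (c / 2) ((1 - `|x|) / 2).
  have r0 : 0 < r by rewrite lt_min !divr_gt0// subr_gt0.
  have rc : r <= c / 2 by rewrite ge_min lexx.
  have rx : r <= (1 - `|x|) / 2 by rewrite ge_min lexx orbT.
  have xr : `|x| + r < 1 by move: rx x1; goal_lra.
  have : f2 x / 2 * r ^+ 2 <= sdiff f x r.
    apply: (sdiff_ge_second (ltW r0) (g1 := f1) (g2 := f2)).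
    - by move=> y yx; apply: d1; exact: inI yx.
    - by move=> y yx; apply: d2; exact: inI yx.
    - move=> y yx; have Hb : `|x - y| < c by rewrite distrC; move: yx rc c0; goal_lra.
      by have := Hc y Hb; rewrite /= ltr_norml => /andP[_]; goal_lra.
  have := S_le0 x r (ltW r0) (ltW xr).
  have : 0 < f2 x / 2 * r ^+ 2 by rewrite mulr_gt0// exprn_gt0.
  goal_lra.
move=> x1 x1I; rewrite lt_neqAle f2_le0// andbT; apply/negP => /eqP f2x1.
(* f'' <= 0 attains its maximum 0 at x1, so its derivative vanishes there too. This makes f''
   quadratically small near x1, as flatness requires. *)
have f3x1 : f3 x1 = 0.
  have le11 : (-1 : R) <= 1 by lra.
  have H : is_derive x1 1 f2 0.
    apply: (derive1_at_max le11).
    - move=> t; rewrite in_itv/= -ltr_norml => /d3 H; exact: ex_derive.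
    - by rewrite in_itv/= -ltr_norml.
    - by move=> t; rewrite in_itv/= -ltr_norml f2x1; exact: f2_le0.
  have H3 := d3 _ x1I.
  by rewrite -(@derive_val _ _ _ _ _ _ _ H3) (@derive_val _ _ _ _ _ _ _ H).
pose e := (1 - `|x1|) / 4.
have e0 : 0 < e by rewrite divr_gt0// subr_gt0.
have x1e : `|x1| + 2 * e < 1 by rewrite /e in e0 *; lra.
have [M HM] : exists M, forall y, `|y - x1| <= 2 * e -> `|f4 y| <= M.
  have le2 : x1 - 2 * e <= x1 + 2 * e by move: e0; goal_lra.
  have [|c _ Hc] := @EVT_max R (fun y => `|f4 y|) _ _ le2.
    apply: continuous_in_subspaceT => y /set_mem/=; rewrite in_itv/= => yI.
    apply: cvg_norm; apply: c4; apply: (inI _ _ _ x1e).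
    by rewrite ler_distl.
  exists `|f4 c| => y yI; apply: Hc.
  by rewrite in_itv/= -ler_distl.
have M0 : 0 <= M by apply: le_trans (HM x1 _); rewrite ?subrr ?normr0//; move: e0; goal_lra.
have e20 : 0 <= 2 * e by rewrite mulr_ge0// ltW.
have Q y : `|y - x1| <= 2 * e -> `|f2 y| <= M * `|y - x1| ^+ 2.
  apply: (quadratic_bound e20 f2x1 f3x1 (g2 := f4)) => // z zI.
  - by apply: d3; exact: inI x1e zI.
  - by apply: d4; exact: inI x1e zI.
have flat : flat_at f x1 e M.
  move=> x r xe r0 re.
  have near y : `|y - x| <= r -> `|y - x1| <= `|x - x1| + r.
    by move=> yx; have := ler_distD x y x1; move: yx; goal_lra.
  have near2 y : `|y - x| <= r -> `|y - x1| <= 2 * e by move=> /near; move: xe re; goal_lra.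
  have K0 : 0 <= `|x - x1| + r by rewrite addr_ge0// ltW.
  have f2b y : `|y - x| <= r -> `|f2 y| <= M * (`|x - x1| + r) ^+ 2.
    move=> yx; apply: le_trans (Q y (near2 y yx)) _.
    by rewrite ler_wpM2l// lerXn2r ?nnegrE// near.
  rewrite ler_norml -mulNr; apply/andP; split.
    apply: (sdiff_ge_second (ltW r0) (g1 := f1) (g2 := f2)).
    - by move=> y /near2 yI; apply: d1; exact: inI x1e yI.
    - by move=> y /near2 yI; apply: d2; exact: inI x1e yI.
    - by move=> y /f2b; rewrite ler_norml => /andP[].
  apply: (sdiff_le_second (ltW r0) (g1 := f1) (g2 := f2)).
  - by move=> y /near2 yI; apply: d1; exact: inI x1e yI.
  - by move=> y /near2 yI; apply: d2; exact: inI x1e yI.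
  - by move=> y /f2b; rewrite ler_norml => /andP[].
have [B fB] := cont_bounded cf f0.
have I3 := flat_intble3 hs' cf fB e0 flat.
have [j1 E1] := Lf x1 x1I.
have I30 : 0 <= integ `]0, +oo[ (fun r => sdiff f x1 r * r `^ (- (2 * s + 2) - 1)).
  apply: (integ_flat_ge0 hs' cf fB e0 flat) => [r r0 re|h h0 he].
    by apply: S_le0; [exact: ltW|move: re x1e e0; goal_lra].
  have hI : `|x1 + h| < 1 /\ `|x1 - h| < 1.
    split; apply: (inI _ _ _ x1e); rewrite addrAC subrr add0r ?normrN gtr0_norm//; move: he e0; goal_lra.
  rewrite /sdiff E1 (Lf _ hI.1).2 (Lf _ hI.2).2.
  have -> : L * f (x1 + h) + L * f (x1 - h) - 2 * (L * f x1) = L * sdiff f x1 h.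
    by rewrite /sdiff; ring.
  apply: (@le_trans _ _ 0); last by rewrite mulr_ge0// exprn_ge0// ltW.
  by rewrite mulr_ge0_le0 ?(ltW L0)//; apply: S_le0; [exact: ltW|move: he x1e e0; goal_lra].
have := cap_fracLap_le_abs fN fc f0 hs x1I j1 I3 I30.
by rewrite E1 mulrA -[leRHS]mul1r ler_pM2r ?fp// leNgt gap.
Qed.

End StrictConcavity.

(** * Continuity at the boundary *)

Section Morrey.
Context {R : realType}.
Local Notation mu := (@lebesgue_measure R).
Implicit Types (f g v : R -> R) (s x y z l e c t E : R) (D : set R).

Lemma integ_EFin D g : intble D g -> measurable D ->
  ((integ D g)%:E = \int[mu]_(x in D) (g x)%:E)%E.
Proof.
move=> ig mD; rewrite integE /Rintegral fineK//.
exact: integrable_fin_num.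
Qed.

Lemma integ_cst D c l : measurable D -> mu D = l%:E -> integ D (fun=> c) = c * l.
Proof.
move=> mD lD; rewrite integE Rintegral_cst//.
by congr (_ * _); transitivity (fine l%:E) => //; congr fine.
Qed.

(** G takes extended values because it will also be an inner integral of the energy, which may be
    infinite at some points. *)
Lemma integ_affine_bound D g (G : R -> \bar R) c t l : measurable D ->
  mu D = l%:E -> intble D g -> measurable_fun setT G -> (forall y, 0 <= G y)%E ->
  0 <= c -> 0 <= t -> (forall y, D y -> (`|g y|%:E <= c%:E * G y + t%:E)%E) ->
  (`|integ D g|%:E <= c%:E * \int[mu]_y G y + (t * l)%:E)%E.
Proof.
move=> mD lD ig mG G0 c0 t0 H.
have ign := intble_norm mD ig.
apply: (@le_trans _ _ (integ D (fun x => `|g x|))%:E).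
  by rewrite lee_fin integ_norm.
rewrite integ_EFin//.
have mGD : measurable_fun D G by apply: measurable_funS mG.
apply: (@le_trans _ _ (\int[mu]_(y in D) (c%:E * G y + t%:E))%E).
  apply: ge0_le_integral => //.
  - exact: measurable_int ign.
  - apply: emeasurable_funD => //; exact: measurable_funeM.
rewrite ge0_integralD//; last 2 first.
- by move=> y _; rewrite mule_ge0// lee_fin.
- exact: measurable_funeM.
rewrite integral_cst// EFinM -lD leeD2r//.
rewrite ge0_integralZl_EFin// lee_wpmul2l ?lee_fin//.
exact: ge0_subset_integral.
Qed.

Lemma measurable_comp_fst (F : R -> R) : measurable_fun setT F ->
  measurable_fun setT (fun z : R * R => F z.1).
Proof. by move=> mF; apply: (measurableT_comp mF); exact: measurable_fst. Qed.

Lemma measurable_comp_snd (F : R -> R) : measurable_fun setT F ->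
  measurable_fun setT (fun z : R * R => F z.2).
Proof. by move=> mF; apply: (measurableT_comp mF); exact: measurable_snd. Qed.

Lemma measurable_gagliardo f s : measurable_fun setT f ->
  measurable_fun setT (fun z : R * R => (f z.1 - f z.2) ^+ 2 * `|z.1 - z.2| `^ (- (2 * s) - 1)).
Proof.
move=> mf; apply: measurable_funM.
  apply: (measurable_funX 2); apply: measurable_funB.
    exact: measurable_comp_fst.
  exact: measurable_comp_snd.
apply: (measurableT_comp (measurable_powR _)).
apply: measurableT_comp => //; apply: measurable_funB.
  exact: (@measurable_comp_fst id).
exact: (@measurable_comp_snd id).
Qed.

(** For y and z in the two disjoint intervals 0 < y - z <= l, so |y - z|^(-1-2s) >= l^(-1-2s).
    Averaging |f(y) - f(z)| over both intervals thus bounds the difference of the means by the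
    energy. *)
Lemma average_step f s x l E : measurable_fun setT f -> 1 / 2 < s < 1 -> 0 < l ->
  intble `]x + l, x + l * (3 / 2)] f -> intble `]x + l / 2, x + l / 2 * (3 / 2)] f ->
  (\int[mu]_y \int[mu]_z ((f y - f z) ^+ 2 * `|y - z| `^ (- (2 * s) - 1))%:E <= E%:E)%E ->
  `|integ `]x + l, x + l * (3 / 2)] f / (l / 2) -
    integ `]x + l / 2, x + l / 2 * (3 / 2)] f / (l / 2 / 2)| <= (4 * E + 1 / 2) * l `^ (s - 1 / 2).
Proof.
move=> mf hs l0 if1 if2 HE.
set J := [set` `]x + l, _]]; set J' := [set` `]x + l / 2, _]].
have mJ : measurable J by exact: measurable_itv.
have mJ' : measurable J' by exact: measurable_itv.
have lJ : mu J = (l / 2)%:E.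
  rewrite /J lebesgue_measure_itv/= lte_fin ifT; first by rewrite -EFinD; congr EFin; lra.
  by have := l0; lra.
have lJ' : mu J' = (l / 2 / 2)%:E.
  rewrite /J' lebesgue_measure_itv/= lte_fin ifT; first by rewrite -EFinD; congr EFin; lra.
  by have := l0; lra.
(* The scale t in |d| <= d^2/(2t) + t/2 is chosen so that, after dividing by the product l^2/8 of
   the two lengths, both terms are multiples of l^(s - 1/2): 4E and 1/2 times it. *)
pose t := l `^ (s - 1 / 2); have t0 : 0 < t by rewrite powR_gt0.
pose k := l `^ (1 + 2 * s); have k0 : 0 < k by rewrite powR_gt0.
have kt : k = l ^+ 2 * t ^+ 2.
  rewrite -(powR_mulrn 2 (ltW t0)) -(powR_mulrn 2 (ltW l0)) /k /t -powRrM -powRD ?gt_eqF ?implybT//.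
    by congr (_ `^ _); lra.
  by move: hs => /andP[]; lra.
pose c := k / (2 * t). have c0 : 0 <= c by rewrite /c divr_ge0 ?ltW// mulr_gt0.
pose G y z : R := (f y - f z) ^+ 2 * `|y - z| `^ (- (2 * s) - 1).
have G0 y z : 0 <= G y z by rewrite mulr_ge0 ?sqr_ge0 ?powR_ge0.
have mG := measurable_gagliardo s mf.
(* AM-GM replaces the Cauchy-Schwarz inequality of the usual argument. *)
have pw y z : J y -> J' z -> `|f y - f z| <= c * G y z + t / 2.
  rewrite /J /J' /= !in_itv/= => /andP[y1 y2] /andP[z1 z2].
  have yz0 : 0 < y - z by move: y1 y2 z1 z2 l0; goal_lra.
  have yzl : y - z <= l by move: y1 y2 z1 z2 l0; goal_lra.
  rewrite /G (gtr0_norm yz0).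
  have -> : (y - z) `^ (- (2 * s) - 1) = ((y - z) `^ (1 + 2 * s))^-1.
    by rewrite -powRN; congr (_ `^ _); ring.
  set w := (y - z) `^ _; have w0 : 0 < w by rewrite powR_gt0.
  have wk : w <= k.
    by apply: ge0_ler_powR; rewrite ?nnegrE ?(ltW l0) ?(ltW yz0)//; move: hs => /andP[]; goal_lra.
  set d := f y - f z.
  have : `|d| <= d ^+ 2 / (2 * t) + t / 2.
    rewrite -subr_ge0 -(real_normK (num_real d)).
    have -> : `|d| ^+ 2 / (2 * t) + t / 2 - `|d| = (`|d| - t) ^+ 2 / (2 * t).
      by field; rewrite gt_eqF.
    by rewrite divr_ge0 ?sqr_ge0// mulr_ge0// ltW.
  move=> /le_trans; apply; rewrite lerD2r.
    have -> : c * (d ^+ 2 / w) = k * (d ^+ 2 / w) / (2 * t) by rewrite /c mulrAC.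
    rewrite ler_wpM2r//.
    by rewrite invr_ge0 mulr_ge0// ltW.
  by rewrite mulrCA ler_peMr ?sqr_ge0// ler_pdivlMr// mul1r.
pose F y := (\int[mu]_z (G y z)%:E)%E.
have mF : measurable_fun setT F.
  apply: (@measurable_fun_fubini_tonelli_F _ _ _ _ R mu (fun z : R * R => (G z.1 z.2)%:E)).
    exact/measurable_EFinP.
  by move=> z; rewrite lee_fin.
have F0 y : (0 <= F y)%E by apply: integral_ge0 => z _; rewrite lee_fin.
have inner y : J y -> (`|f y * (l / 2 / 2) - integ J' f|%:E <= c%:E * F y + (t / 2 * (l / 2 / 2))%:E)%E.
  move=> Jy.
  have ic : intble J' (fun=> f y).
    apply: intble_cont; apply: continuous_subspaceT => z; exact: cvg_cst.
  have -> : f y * (l / 2 / 2) - integ J' f = integ J' (fun z => f y - f z).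
    rewrite integB//; congr (_ - _); by rewrite (integ_cst _ mJ' lJ').
  apply: (@integ_affine_bound J' (fun z => f y - f z) (fun z => (G y z)%:E)) => //.
  - exact: intbleB.
  - apply/measurable_EFinP.
    exact: (measurableT_comp mG (measurable_pair1 y)).
  - by move=> z; rewrite lee_fin.
  - by rewrite divr_ge0 ?ltW.
  - by move=> z J'z; rewrite -EFinM -EFinD lee_fin pw.
have ic : intble J (fun=> integ J' f).
  apply: intble_cont; apply: continuous_subspaceT => z; exact: cvg_cst.
have ifl : intble J (fun y => l / 2 / 2 * f y) by exact: intbleZ.
have outer : (`|l / 2 / 2 * integ J f - integ J' f * (l / 2)|%:E <= c%:E * E%:E + (t / 2 * (l / 2 / 2) * (l / 2))%:E)%E.
  have -> : l / 2 / 2 * integ J f - integ J' f * (l / 2) = integ J (fun y => l / 2 / 2 * f y - integ J' f).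
    rewrite integB// integZ//; congr (_ - _); by rewrite (integ_cst _ mJ lJ).
  apply: le_trans.
    apply: (@integ_affine_bound J _ F c (t / 2 * (l / 2 / 2)) (l / 2)) => //.
    - exact: intbleB.
    - by rewrite !mulr_ge0 ?ltW.
    - by move=> y Jy; rewrite mulrC; exact: inner.
  by rewrite leeD2r// lee_wpmul2l.
move: outer; rewrite -EFinM -EFinD lee_fin => outer.
have -> : integ J f / (l / 2) - integ J' f / (l / 2 / 2) =
  (l / 2 / 2 * integ J f - integ J' f * (l / 2)) * (8 / l ^+ 2) by field; rewrite gt_eqF.
have l2 : 0 < 8 / l ^+ 2 by rewrite divr_gt0// exprn_gt0.
rewrite normrM (gtr0_norm l2) -ler_pdivlMr// (le_trans outer)// le_eqVlt; apply/orP; left; apply/eqP.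
rewrite -/t /c kt; field.
by rewrite !gt_eqF.
Qed.

Lemma exists_half_pow_lt d e : 0 < d -> 0 < e -> exists k, d * (1 / 2) ^+ k < e.
Proof.
move=> d0 e0; pose k := (Num.truncn (d / e)).+1; exists k.
have k2 : d / e < 2 ^+ k.
  apply: (lt_le_trans (truncnS_gt _)); rewrite -/k -natrX ler_nat.
  by apply: ltnW; apply: ltn_expl.
rewrite mul1r exprVn -ltr_pdivlMr ?invr_gt0 ?exprn_gt0// invrK mulrC.
by rewrite -ltr_pdivrMr.
Qed.

(** Means of f over intervals to the right of x at scales d 2^-k, where d = 1 - x, converge to f(x).
    The interval at scale d lies beyond 1, where f is zero, so f(x) is bounded by a geometric series
    with ratio 2^-(s - 1/2), which converges because s > 1/2. *)
Lemma morrey_boundary f s E x : measurable_fun setT f -> 1 / 2 < s < 1 ->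
  (forall y, `|y| < 1 -> {for y, continuous f}) -> (forall y, 1 <= y -> f y = 0) ->
  (\int[mu]_y \int[mu]_z ((f y - f z) ^+ 2 * `|y - z| `^ (- (2 * s) - 1))%:E <= E%:E)%E ->
  0 <= E -> `|x| < 1 ->
  `|f x| <= (4 * E + 1 / 2) / (1 - (1 / 2) `^ (s - 1 / 2)) * (1 - x) `^ (s - 1 / 2).
Proof.
move=> mf hs cf f0 HE E0 x1.
have [xl xr] : -1 < x /\ x < 1 by move: x1; rewrite ltr_norml => /andP.
pose d := 1 - x. have d0 : 0 < d by rewrite subr_gt0.
pose a := s - 1 / 2. have a0 : 0 < a by rewrite /a; move: hs => /andP[]; lra.
pose rho : R := (1 / 2) `^ a.
have rho1 : rho < 1.
  apply: (@lt_le_trans _ _ ((1 : R) `^ a)); last by rewrite powR1.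
  by rewrite /rho gt0_ltr_powR// ?nnegrE; lra.
pose A := 4 * E + 1 / 2. have A0 : 0 < A by rewrite /A; lra.
pose l k := d * (1 / 2) ^+ k.
have l0 k : 0 < l k by rewrite mulr_gt0// exprn_gt0.
have lS k : l k.+1 = l k / 2 by rewrite /l exprSr; field.
pose b k := l k `^ a.
have bS k : b k.+1 = b k * rho.
  by rewrite /b lS powRM ?ltW// /rho div1r.
have b0 k : 0 <= b k by rewrite powR_ge0.
pose J k := [set` `]x + l k, x + l k * (3 / 2)]].
have mJ k : measurable (J k) by exact: measurable_itv.
have lJ k : mu (J k) = (l k / 2)%:E.
  have := l0 k; rewrite /J lebesgue_measure_itv/= lte_fin => lk; rewrite ifT; last by lra.
  by rewrite -EFinD; congr EFin; lra.
have ld k : l k.+1 <= d / 2.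
  rewrite lS /l; have : (1 / 2 : R) ^+ k <= 1 by apply: exprn_ile1; lra.
  move=> H; have : d * (1 / 2) ^+ k <= d by rewrite ler_piMr// ltW.
  by lra.
have iJ k : intble (J k) f.
  case: k => [|k].
    apply: (@intble_eq _ _ (fun=> 0)) => //.
      move=> y; rewrite /J/= in_itv/= /l expr0 mulr1 /d => /andP[y1 _].
      by rewrite f0//; lra.
    apply: intble_cont; apply: continuous_subspaceT => z; exact: cvg_cst.
  apply: intble_cont; apply: continuous_in_subspaceT => y.
  rewrite inE/= in_itv/= => /andP[y1 y2]; apply: cf.
  rewrite ltr_norml; have := ld k; rewrite /d.
  by move: (l0 k.+1) y1 y2 xl => h1 h2 h3 h4 h5; apply/andP; split; move: h1 h2 h3 h4 h5; goal_lra.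
pose m k := integ (J k) f / (l k / 2).
have m0 : m 0 = 0.
  rewrite /m (@integ_eq _ _ _ (fun=> 0)).
    by rewrite (integ_cst _ (mJ 0) (lJ 0)) !mul0r.
  move=> y; rewrite /J/= in_itv/= /l expr0 mulr1 /d => /andP[y1 _].
  by rewrite f0//; lra.
have ms k : `|m k - m k.+1| <= A * b k.
  rewrite /m /J lS; apply: (@average_step f s x (l k) E) => //; first exact: iJ.
  by rewrite -lS; exact: iJ.
have r0 : 0 < 1 - rho by rewrite subr_gt0.
have mb k : `|m k| <= A / (1 - rho) * (b 0 - b k).
  elim: k => [|k IH]; first by rewrite m0 normr0 subrr mulr0.
  have -> : A / (1 - rho) * (b 0 - b k.+1) = A / (1 - rho) * (b 0 - b k) + A * b k.
    by rewrite bS; field; rewrite gt_eqF.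
  have -> : m k.+1 = m k - (m k - m k.+1) by ring.
  by apply: (le_trans (ler_normB _ _)); apply: lerD.
have b0E : b 0 = (1 - x) `^ a by rewrite /b /l expr0 mulr1.
rewrite -/a -/rho -/A -b0E; apply/ler_addgt0Pr => e e0.
have [t t0 Ht] : exists2 t, 0 < t & forall y, `|x - y| < t -> `|f x - f y| < e.
  have /cvgrPdist_lt/(_ _ e0) := cf _ x1.
  by move=> /nbhs_ballP[t /= t0 Ht]; exists t => // y xy; exact: Ht.
have [k hk] : exists k, d * (3 / 2) * (1 / 2) ^+ k < t by apply: exists_half_pow_lt => //; rewrite mulr_gt0.
have lk : l k * (3 / 2) < t by rewrite /l mulrAC.
have near y : J k y -> `|f x - f y| < e.
  rewrite /J/= in_itv/= => /andP[y1 y2]; apply: Ht.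
  by rewrite ltr_norml; apply/andP; split; move: y1 y2 lk (l0 k); goal_lra.
have icst c : intble (J k) (fun=> c).
  apply: intble_cont; apply: continuous_subspaceT => z; exact: cvg_cst.
have lk2 : 0 < l k / 2 by rewrite divr_gt0.
have mf1 : f x - e <= m k.
  rewrite /m ler_pdivlMr// -(integ_cst _ (mJ k) (lJ k)); apply: integ_le => // y Jy.
  by have := near y Jy; rewrite ltr_norml => /andP[]; goal_lra.
have mf2 : m k <= f x + e.
  rewrite /m ler_pdivrMr// -(integ_cst _ (mJ k) (lJ k)); apply: integ_le => // y Jy.
  by have := near y Jy; rewrite ltr_norml => /andP[]; goal_lra.
have : `|m k| <= A / (1 - rho) * b 0.
  apply: (le_trans (mb k)); rewrite ler_wpM2l//; first by rewrite divr_ge0 ?ltW.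
  by move: (b0 k); goal_lra.
by rewrite !ler_norml => /andP[h1 h2]; apply/andP; split; move: h1 h2 mf1 mf2; goal_lra.
Qed.

Lemma ge0_integralT_opp (h : R -> \bar R) : measurable_fun setT h ->
  (forall x, 0 <= h x)%E -> (\int[mu]_x h x = \int[mu]_x h (- x)%R)%E.
Proof.
move=> mh h0; rewrite (ge0_integral_opp measurableT mh)//.
Qed.

(** The left end follows by reflection, which preserves the energy. The two bounds give |f(y)| <= C
    |x - y|^(s - 1/2) for every |x| >= 1. *)
Lemma morrey_continuous f s E : measurable_fun setT f -> 1 / 2 < s < 1 ->
  (forall y, `|y| < 1 -> {for y, continuous f}) -> (forall y, 1 <= `|y| -> f y = 0) ->
  (\int[mu]_y \int[mu]_z ((f y - f z) ^+ 2 * `|y - z| `^ (- (2 * s) - 1))%:E <= E%:E)%E ->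
  0 <= E -> continuous f.
Proof.
move=> mf hs cf f0 HE E0 x.
case: (ltP `|x| 1) => x1; first exact: cf.
pose a := s - 1 / 2. have a0 : 0 < a by rewrite /a; move: hs => /andP[]; lra.
pose C := (4 * E + 1 / 2) / (1 - (1 / 2) `^ a).
have C0 : 0 < C.
  rewrite /C divr_gt0//; first by lra.
  rewrite subr_gt0; apply: (@lt_le_trans _ _ ((1 : R) `^ a)); last by rewrite powR1.
  by rewrite gt0_ltr_powR// ?nnegrE; lra.
have bd y : `|y| < 1 -> `|f y| <= C * (1 - `|y|) `^ a.
  move=> y1; case: (leP 0 y) => y0.
    rewrite (ger0_norm y0); apply: (@morrey_boundary f s E) => // z z1.
    by apply: f0; rewrite ger0_norm//; lra.
  rewrite (ltr0_norm y0); have -> : f y = (fun y => f (- y)) (- y) by rewrite opprK.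
  have mfN : measurable_fun setT (fun y => f (- y)).
    by apply: measurableT_comp => //; exact: oppr_measurable.
  have cfN z : `|z| < 1 -> {for z, continuous (fun y => f (- y))}.
    move=> z1; apply: continuous_comp; first exact: opp_continuous.
    by apply: cf; rewrite normrN.
  have f0N z : 1 <= z -> f (- z) = 0.
    by move=> z1; apply: f0; rewrite normrN ger0_norm//; lra.
  have yN1 : `|- y| < 1 by rewrite normrN.
  refine (@morrey_boundary (fun y => f (- y)) s E (- y) mfN hs cfN f0N _ E0 yN1).
  - have mG := measurable_gagliardo s mf.
    apply: le_trans HE.
    rewrite [leRHS]ge0_integralT_opp; last 2 first.
    + apply: (@measurable_fun_fubini_tonelli_F _ _ _ _ R mu
        (fun z : R * R => ((f z.1 - f z.2) ^+ 2 * `|z.1 - z.2| `^ (- (2 * s) - 1))%:E)).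
        exact/measurable_EFinP.
      by move=> z; rewrite lee_fin mulr_ge0 ?sqr_ge0 ?powR_ge0.
    + by move=> z; apply: integral_ge0 => w _; rewrite lee_fin mulr_ge0 ?sqr_ge0 ?powR_ge0.
    rewrite le_eqVlt; apply/orP; left; apply/eqP; apply: eq_integral => w _.
    rewrite [RHS]ge0_integralT_opp; last 2 first.
    + apply/measurable_EFinP; exact: (measurableT_comp mG (pair1_measurable (- w))).
    + by move=> z; rewrite lee_fin mulr_ge0 ?sqr_ge0 ?powR_ge0.
    apply: eq_integral => z _ /=; congr (_ * _ `^ _)%:E.
    by rewrite -[LHS]normrN; congr (`|_|); ring.
have bd2 y : `|f y| <= C * `|x - y| `^ a.
  case: (ltP `|y| 1) => y1; last first.
    by rewrite f0// normr0 mulr_ge0 ?powR_ge0// ltW.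
  apply: (le_trans (bd _ y1)); rewrite ler_wpM2l ?(ltW C0)//.
  have h : 1 - `|y| <= `|x - y|.
    by apply: le_trans (lerB_dist _ _); rewrite lerD2r.
  by apply: ge0_ler_powR => //; rewrite ?nnegrE ?(ltW a0)// subr_ge0 ltW.
rewrite /continuous_at (f0 _ x1); apply/cvgrPdist_le => e e0.
pose t := (e / C) `^ a^-1; have t0 : 0 < t by rewrite powR_gt0// divr_gt0.
exists t => //= y /= xy.
rewrite sub0r normrN (le_trans (bd2 y))// -ler_pdivlMl// mulrC.
have -> : e / C = t `^ a.
  by rewrite /t -powRrM mulVf ?gt_eqF// powRr1// divr_ge0 ?ltW.
by apply: ge0_ler_powR; rewrite ?nnegrE ?(ltW a0) ?(ltW t0)//; exact: ltW xy.
Qed.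

End Morrey.

(** * From the weak to the pointwise equation *)

Section ProductTools.
Context {R : realType}.
Local Notation mu := (@lebesgue_measure R).
Local Notation mu2 := ((@lebesgue_measure R) \x (@lebesgue_measure R))%E.
Implicit Types (f g v a b : R -> R) (s x y l e c t E : R) (D : set R).

Lemma measurable_shear (H : R * R -> \bar R) : measurable_fun setT H ->
  measurable_fun setT (fun z : R * R => H (z.1, z.2 + z.1)).
Proof.
move=> mH; apply: (measurableT_comp mH).
apply: measurable_fun_pair; first exact: (@measurable_comp_fst _ id).
apply: measurable_funD; [exact: (@measurable_comp_snd _ id)|exact: (@measurable_comp_fst _ id)].
Qed.

Lemma ge0_integral_shear (H : R * R -> \bar R) : measurable_fun setT H ->
  (forall z, 0 <= H z)%E -> (\int[mu2]_z H z = \int[mu2]_z H (z.1, (z.2 + z.1)%R))%E.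
Proof.
move=> mH H0; have mH' := measurable_shear mH.
transitivity (\int[mu]_x \int[mu]_y H (x, y))%E.
  exact: (@fubini_tonelli1 _ _ _ _ R mu mu H mH H0).
transitivity (\int[mu]_x \int[mu]_y H (x, (y + x)%R))%E; last first.
  exact/esym/(@fubini_tonelli1 _ _ _ _ R mu mu (fun z => H (z.1, z.2 + z.1)) mH' (fun z => H0 _)).
apply: eq_integral => x _.
rewrite (@ge0_integral_shift _ x setT (fun y => H (x, y)))//.
exact: measurable_fun_pair2.
Qed.

Lemma integrable_shear (H : R * R -> R) : mu2.-integrable setT (EFin \o H) ->
  mu2.-integrable setT (EFin \o (fun z => H (z.1, z.2 + z.1))) /\
  (\int[mu2]_z (H z)%:E = \int[mu2]_z (H (z.1, (z.2 + z.1)%R))%:E)%E.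
Proof.
move=> iH; have mH := measurable_int _ iH; split.
  apply/integrableP; split; first exact: (measurable_shear mH).
  have /integrableP[_] := iH.
  rewrite (@ge0_integral_shear (fun z => `|(EFin \o H) z|%E))//.
  exact: measurableT_comp.
rewrite integralE [RHS]integralE.
rewrite (ge0_integral_shear (measurable_funepos mH))//.
rewrite (ge0_integral_shear (measurable_funeneg mH))//.
by congr (_ - _)%E; apply: eq_integral => z _; rewrite ?funeposE ?funenegE.
Qed.

Lemma ge0_integral_swap (H : R * R -> \bar R) : measurable_fun setT H ->
  (forall z, 0 <= H z)%E -> (\int[mu2]_z H z = \int[mu2]_z H (z.2, z.1))%E.
Proof.
move=> mH H0; rewrite fubini_tonelli1// fubini_tonelli2//.
by apply: (measurableT_comp mH); exact: measurable_swap.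
Qed.

Lemma ge0_integral_tensor a b : intble setT a -> intble setT b ->
  (forall x, 0 <= a x) -> (forall x, 0 <= b x) ->
  (\int[mu2]_z (a z.1 * b z.2)%:E = (integ setT a * integ setT b)%:E)%E.
Proof.
move=> ia ib a0 b0.
have ma := intble_measurable ia. have mb := intble_measurable ib.
rewrite fubini_tonelli1; last 2 first.
- apply/measurable_EFinP; apply: measurable_funM; [exact: measurable_comp_fst|exact: measurable_comp_snd].
- by move=> z; rewrite lee_fin mulr_ge0.
rewrite EFinM (integ_EFin ia)// (integ_EFin ib)//.
transitivity (\int[mu]_x ((a x)%:E * \int[mu]_y (b y)%:E))%E.
  apply: eq_integral => x _; rewrite /fubini_F/=.
  rewrite -ge0_integralZl_EFin//; last exact/measurable_EFinP.
  by move=> y _; rewrite lee_fin.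
rewrite ge0_integralZr//.
- exact/measurable_EFinP.
- by move=> x _; rewrite lee_fin.
- by apply: integral_ge0 => y _; rewrite lee_fin.
Qed.

Lemma ge0_integral_even (h : R -> \bar R) : measurable_fun setT h -> (forall x, 0 <= h x)%E ->
  (forall x, h (- x)%R = h x) ->
  (\int[mu]_x h x = \int[mu]_(x in [set` `]0%R, +oo[]) h x + \int[mu]_(x in [set` `]0%R, +oo[]) h x)%E.
Proof.
move=> mh h0 hN.
have -> : [set: R] = `]-oo, 0%R]%classic `|` `]0%R, +oo[%classic :> set R.
  apply/seteqP; split => x //= _; rewrite !in_itv/= andbT.
  by case: (leP x 0); [left|right].
rewrite ge0_integral_setU//.
- congr (_ + _)%E.
  rewrite (@ge0_integral_opp _ `]-oo, 0%R]%classic)//; last exact: measurable_funTS.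
  rewrite integral_itv_obnd_cbnd; last exact: measurable_funTS.
  under eq_integral => x _ do rewrite hN.
  congr integral; apply/seteqP; split => x /=; rewrite !in_itv/= ?andbT; lra.
- exact: measurable_funTS.
- apply/disj_setPS => x /= []; rewrite !in_itv/= andbT; lra.
Qed.

Lemma integ_even g : measurable_fun setT g -> (forall x, g (- x) = g x) ->
  intble `]0, +oo[ g -> intble setT g /\ integ setT g = 2 * integ `]0, +oo[ g.
Proof.
move=> mg gN ig; have mge : measurable_fun setT (EFin \o g) by exact/measurable_EFinP.
split.
  apply/integrableP; split => //.
  rewrite (@ge0_integral_even (fun x => `|(EFin \o g) x|%E)); last 3 first.
  - exact: measurableT_comp.
  - by [].
  - by move=> x /=; rewrite gN.
  by have /integrableP[_ H] := ig; rewrite lte_add_pinfty.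
have ep : forall x, (EFin \o g)^\+%E (- x) = (EFin \o g)^\+%E x.
  by move=> x; rewrite !funeposE /= gN.
have en : forall x, (EFin \o g)^\-%E (- x) = (EFin \o g)^\-%E x.
  by move=> x; rewrite !funenegE /= gN.
pose I := [set` `]0 : R, +oo[]; have mI : measurable I by exact: measurable_itv.
have ig' : mu.-integrable I (EFin \o g) by [].
pose A := (\int[mu]_(x in I) (EFin \o g)^\+ x)%E.
pose B := (\int[mu]_(x in I) (EFin \o g)^\- x)%E.
have iT : (\int[mu]_x (g x)%:E = A + A - (B + B))%E.
  rewrite [LHS]integralE (ge0_integral_even (measurable_funepos mge))//.
  by rewrite (ge0_integral_even (measurable_funeneg mge)).
have iI : (\int[mu]_(x in I) (g x)%:E = A - B)%E by rewrite [LHS]integralE.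
have fA : A \is a fin_num.
  by apply: integrable_fin_num => //; exact: integrable_funepos.
have fB : B \is a fin_num.
  by apply: integrable_fin_num => //; exact: integrable_funeneg.
rewrite !integE /Rintegral iT iI -(fineK fA) -(fineK fB).
by rewrite /=; ring.
Qed.

Lemma intble_compact_support g : continuous g -> (forall x, 1 <= `|x| -> g x = 0) ->
  intble setT g.
Proof.
move=> cg g0.
have ig : intble `]-1, 1] g by apply: intble_cont; exact: continuous_subspaceT.
have := (@integrable_mkcond _ _ _ mu [set` `]-1, 1]] (EFin \o g) (measurable_itv _)).1 ig.
congr (_.-integrable _ _); apply/funext => x; rewrite patchE /=.
case: ifPn => // /negP; rewrite inE/= in_itv/= => /negP x1.
by rewrite g0//; move: x1; rewrite negb_and -!leNgt; have := ler_norm x; have := ler_norm (-x); rewrite normrN => h1 h2 /orP[]; lra.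
Qed.

End ProductTools.

(** * The bilinear form as an integral against the Laplacian *)

Section WeakForm.
Context {R : realType}.
Local Notation mu := (@lebesgue_measure R).
Local Notation mu2 := ((@lebesgue_measure R) \x (@lebesgue_measure R))%E.
Implicit Types (f g u v a b : R -> R) (s x y r l e c t E C : R) (D : set R).

(** The integrable majorant of a second difference that is bounded and of order r^2, times the
    singular kernel. *)
Definition trunc_kernel s r : R := Num.min (r ^+ 2) 1 * `|r| `^ (- (2 * s) - 1).

Lemma trunc_kernelN s r : trunc_kernel s (- r) = trunc_kernel s r.
Proof. by rewrite /trunc_kernel sqrrN normrN. Qed.

Lemma trunc_kernel_ge0 s r : 0 <= trunc_kernel s r.
Proof. by rewrite mulr_ge0 ?powR_ge0// le_min sqr_ge0 ler01. Qed.

Lemma measurable_trunc_kernel s : measurable_fun setT (trunc_kernel s).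
Proof.
apply: measurable_funM.
  apply: measurable_minr => //; exact: (measurable_funX 2).
by apply: (measurableT_comp (measurable_powR _)).
Qed.

Lemma intble_trunc_kernel s : 0 < s < 1 -> intble setT (trunc_kernel s).
Proof.
move=> /andP[s0 s1].
have [|//] := @integ_even R (trunc_kernel s) (measurable_trunc_kernel s) (trunc_kernelN s).
apply: (@intble_split _ _ 0 1) => //.
- apply: (@intble_eq _ _ (fun r => r `^ (2 - 2 * s - 1))) => //; last first.
    by apply: intble_0 => //; lra.
  move=> r; rewrite /= in_itv/= => /andP[r0 r1].
  rewrite /trunc_kernel min_l; last by rewrite expr_le1// ltW.
  rewrite (gtr0_norm r0) -(powR_mulrn 2 (ltW r0)) -powRD ?(gt_eqF r0) ?implybT//.
  by congr (_ `^ _); ring.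
- apply: (@intble_eq _ _ (fun r => r `^ (- (2 * s) - 1))) => //; last first.
    by apply: intble_y => //; lra.
  move=> r; rewrite /= in_itv/= andbT => r1.
  have r0 : 0 < r by exact: lt_trans r1.
  by rewrite /trunc_kernel min_r ?mul1r ?(gtr0_norm r0)// expr_ge1// ltW.
Qed.

Lemma integrable_tensor a b : intble setT a -> intble setT b ->
  (forall x, 0 <= a x) -> (forall x, 0 <= b x) ->
  mu2.-integrable setT (EFin \o (fun z : R * R => a z.1 * b z.2)).
Proof.
move=> ia ib a0 b0; apply/integrableP; split.
  apply/measurable_EFinP; apply: measurable_funM.
    by apply: measurable_comp_fst; exact: intble_measurable.
  by apply: measurable_comp_snd; exact: intble_measurable.
under eq_integral => z _ do rewrite /= ger0_norm ?mulr_ge0//.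
by rewrite ge0_integral_tensor// ltry.
Qed.

(** A discrete integration by parts: translating x by r turns the terms in v(x + r) into terms in
    v(x) and pairs f(x + r) with f(x - r). *)
Lemma integ_form_section f v r : continuous f -> continuous v ->
  (forall x, 1 <= `|x| -> f x = 0) -> (forall x, 1 <= `|x| -> v x = 0) ->
  intble setT (fun x => (f x - f (r + x)) * (v x - v (r + x))) /\
  intble setT (fun x => - (v x * sdiff f x r)) /\
  integ setT (fun x => (f x - f (r + x)) * (v x - v (r + x))) =
  integ setT (fun x => - (v x * sdiff f x r)).
Proof.
move=> cf cv f0 v0.
pose P x := f x * v x. pose Q x := f (x + r) * v x. pose S x := f (x - r) * v x.
have iP : intble setT P.
  apply: intble_compact_support => [x|x x1]; last by rewrite /P v0// mulr0.
  by apply: continuousM; [exact: cf|exact: cv].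
have iQ : intble setT Q.
  apply: intble_compact_support => [x|x x1]; last by rewrite /Q v0// mulr0.
  by apply: continuousM; [exact: continuous_addr|exact: cv].
have iS : intble setT S.
  apply: intble_compact_support => [x|x x1]; last by rewrite /S v0// mulr0.
  by apply: continuousM; [exact: (@continuous_addr R f (- r))|exact: cv].
have mT : measurable [set: R] by [].
have iP' : intble setT (fun x => P (x + r)) by exact: (intble_shift r mT iP).
have iS' : intble setT (fun x => S (x + r)) by exact: (intble_shift r mT iS).
have eP : integ setT (fun x => P (x + r)) = integ setT P by exact: esym (integ_shift r mT iP).
have eS : integ setT (fun x => S (x + r)) = integ setT S by exact: esym (integ_shift r mT iS).
have i1 : intble setT (fun x => (P x + P (x + r)) - (Q x + S (x + r))).
  by apply: intbleB => //; apply: intbleD.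
have i2 : intble setT (fun x => 2 * P x - (Q x + S x)).
  by apply: intbleB => //; [apply: intbleZ|apply: intbleD].
have E1 x : (P x + P (x + r)) - (Q x + S (x + r)) = (f x - f (r + x)) * (v x - v (r + x)).
  by rewrite /P /Q /S addrK (addrC r x); ring.
have E2 x : 2 * P x - (Q x + S x) = - (v x * sdiff f x r).
  by rewrite /P /Q /S /sdiff; ring.
split; last split.
- by apply: (intble_eq mT _ i1) => x _; rewrite E1.
- by apply: (intble_eq mT _ i2) => x _; rewrite E2.
transitivity (integ setT (fun x => (P x + P (x + r)) - (Q x + S (x + r)))).
  by apply: integ_eq => x _; rewrite E1.
transitivity (integ setT (fun x => 2 * P x - (Q x + S x))); last first.
  by apply: integ_eq => x _; rewrite E2.
rewrite integB//; [|exact: intbleD|exact: intbleD].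
rewrite [RHS]integB//; [|exact: intbleZ|exact: intbleD].
rewrite !integD// integZ// eP eS; ring.
Qed.

Lemma measurable_sdiff f : measurable_fun setT f ->
  measurable_fun setT (fun z : R * R => sdiff f z.1 z.2).
Proof.
move=> mf; have m1 := @measurable_comp_fst R id (@measurable_id _ _ _).
have m2 := @measurable_comp_snd R id (@measurable_id _ _ _).
apply: measurable_funB; last by apply: measurable_funM => //; exact: measurable_comp_fst.
apply: measurable_funD; apply: (measurableT_comp mf).
  exact: measurable_funD.
exact: measurable_funB.
Qed.

Lemma sdiffNr f x r : sdiff f x (- r) = sdiff f x r.
Proof. by rewrite /sdiff opprK; ring. Qed.

Lemma sdiff_form_section f v s C : 0 < s < 1 -> continuous f -> continuous v -> 0 <= C ->
  (forall x r, v x != 0 -> `|sdiff f x r| <= C * Num.min (r ^+ 2) 1) ->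
  forall x, integ setT (fun r => - (v x * sdiff f x r) * `|r| `^ (- (2 * s) - 1)) =
    2 * (v x * fracLap s f x) /\
    intble setT (fun r => - (v x * sdiff f x r) * `|r| `^ (- (2 * s) - 1)).
Proof.
move=> hs cf cv C0 HC x.
pose g r := - (v x * sdiff f x r) * `|r| `^ (- (2 * s) - 1).
have mg : measurable_fun setT g.
  apply: measurable_funM; last by apply: (measurableT_comp (measurable_powR _)).
  apply: measurableT_comp => //; apply: measurable_funM => //.
  by apply: cont_measurable => //; exact: sdiff_continuous.
have gN r : g (- r) = g r by rewrite /g normrN sdiffNr.
have ig : intble `]0, +oo[ g.
  apply: (@intble_le _ _ _ (fun r => `|v x| * C * trunc_kernel s r)).
  - exact: measurable_itv.
  - exact: measurable_funTS.
  - move=> r _; rewrite /g normrM (ger0_norm (powR_ge0 _ _)) /trunc_kernel mulrA.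
    rewrite ler_wpM2r ?powR_ge0// normrN normrM -mulrA.
    by have [->|vz] := eqVneq (v x) 0; [rewrite normr0 !mul0r|rewrite ler_wpM2l// HC].
  - apply: intbleZ; first exact: measurable_itv.
    by apply: (intbleS _ _ _ (intble_trunc_kernel hs)).
have [iT eT] := integ_even mg gN ig; split; last exact: iT.
rewrite eT; congr (_ * _).
have [vx|vx] := eqVneq (v x) 0.
  rewrite vx mul0r (@integ_eq _ _ _ (fun=> 0)).
    by rewrite integE /Rintegral integral0.
  by move=> r _; rewrite /g vx mul0r oppr0 mul0r.
rewrite /fracLap mulrN -mulNr -integZ//.
  apply: integ_eq => r; rewrite /= in_itv/= andbT => r0.
  by rewrite /g (gtr0_norm r0); ring.
apply: (@intble_eq _ _ (fun r => (- (v x)^-1) * g r)) => //.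
  move=> r; rewrite /= in_itv/= andbT => r0.
  by rewrite /g (gtr0_norm r0); field.
exact: intbleZ.
Qed.

Lemma integrable_sdiff_form f v s C : 0 < s < 1 -> continuous f -> continuous v ->
  intble setT v -> 0 <= C ->
  (forall x r, v x != 0 -> `|sdiff f x r| <= C * Num.min (r ^+ 2) 1) ->
  mu2.-integrable setT (EFin \o (fun z : R * R => - (v z.1 * sdiff f z.1 z.2) * `|z.2| `^ (- (2 * s) - 1))).
Proof.
move=> hs cf cv iv C0 HC.
have mf := cont_measurable cf (@measurableT _ R).
have mv := cont_measurable cv (@measurableT _ R).
have ivn : intble setT (fun x => C * `|v x|).
  by apply: intbleZ; [exact: measurableT|apply: intble_norm].
apply: le_integrable (integrable_tensor ivn (intble_trunc_kernel hs)
  (fun x => mulr_ge0 C0 (normr_ge0 (v x))) (trunc_kernel_ge0 s)).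
- exact: measurableT.
- apply/measurable_EFinP; apply: measurable_funM.
    apply: measurable_funN; apply: measurable_funM; last exact: measurable_sdiff.
    exact: measurable_comp_fst.
  apply: (@measurable_comp_snd _ (fun r => `|r| `^ (- (2 * s) - 1))).
  by apply: (measurableT_comp (measurable_powR _)).
- move=> z _; rewrite /= lee_fin [leRHS]ger0_norm; last first.
    by rewrite mulr_ge0 ?trunc_kernel_ge0// mulr_ge0.
  rewrite normrM (ger0_norm (powR_ge0 _ _)) /trunc_kernel mulrA.
  rewrite ler_wpM2r ?powR_ge0// normrN normrM mulrAC [leRHS]mulrC.
  by have [->|vz] := eqVneq (v z.1) 0; [rewrite normr0 !mul0r|rewrite ler_wpM2l// HC].
Qed.

(** With y = x + r, integration in x at fixed r replaces the integrand by -v(x) S_f(x, r). Unlike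
    the separate terms of the product, this is absolutely integrable by the bound on the support of
    v, so Fubini allows integrating in r first. The factor 2 comes from negative r. *)
Lemma form_eq_fracLap f v s C : 0 < s < 1 -> continuous f -> continuous v ->
  (forall x, 1 <= `|x| -> f x = 0) -> (forall x, 1 <= `|x| -> v x = 0) -> 0 <= C ->
  (forall x r, v x != 0 -> `|sdiff f x r| <= C * Num.min (r ^+ 2) 1) ->
  mu2.-integrable setT (EFin \o (fun z => (f z.1 - f z.2) * (v z.1 - v z.2) / frac_kernel s z)) ->
  intble setT (fun x => v x * fracLap s f x) /\
  \int[mu2]_z ((f z.1 - f z.2) * (v z.1 - v z.2) / frac_kernel s z) =
    2 * integ setT (fun x => v x * fracLap s f x).
Proof.
move=> hs cf cv f0 v0 C0 HC.
have iv : intble setT v by exact: intble_compact_support.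
have mT : measurable [set: R] by exact: measurableT.
pose k r := `|r| `^ (- (2 * s) - 1).
pose G (z : R * R) := - (v z.1 * sdiff f z.1 z.2) * k z.2.
have sec := sdiff_form_section hs cf cv C0 HC.
have FG x : (\int[mu]_r (G (x, r))%:E = (2 * (v x * fracLap s f x))%:E)%E.
  by have [e i] := sec x; rewrite -(integ_EFin i mT) e.
have FH r : (\int[mu]_x ((f x - f (r + x)) * (v x - v (r + x)) * k r)%:E = \int[mu]_x (G (x, r))%:E)%E.
  have [j1 [j2 j3]] := integ_form_section r cf cv f0 v0.
  transitivity (\int[mu]_x (k r * ((f x - f (r + x)) * (v x - v (r + x))))%:E)%E.
    by apply: eq_integral => x _; rewrite mulrC.
  rewrite -(integ_EFin (intbleZ (k r) mT j1) mT) integZ// j3 -integZ//.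
  rewrite (integ_EFin (intbleZ (k r) mT j2) mT).
  by apply: eq_integral => x _; rewrite /G/= mulrC.
have eH (z : R * R) : (f z.1 - f (z.2 + z.1)) * (v z.1 - v (z.2 + z.1)) / frac_kernel s (z.1, z.2 + z.1) =
    (f z.1 - f (z.2 + z.1)) * (v z.1 - v (z.2 + z.1)) * k z.2.
  rewrite /k /frac_kernel /=; congr (_ * _); rewrite -powRN; congr (_ `^ _); last by ring.
  by rewrite -normrN; congr (`|_|); ring.
have iG := integrable_sdiff_form hs cf cv iv C0 HC.
have iF := integrable_fubini_F iG.
have i2 : intble setT (fun x => 2 * (v x * fracLap s f x)).
  by apply: eq_integrable iF => [|x _]; [exact: measurableT|exact: FG].
have i1 : intble setT (fun x => v x * fracLap s f x).
  apply: (intble_eq mT _ (intbleZ 2^-1 mT i2)) => x _; rewrite mulKf//.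
have EG : (\int[mu2]_z (G z)%:E = (2 * integ setT (fun x => (v x * fracLap s f x)%R))%:E)%E.
  rewrite -[LHS](integral12_prod_meas1 iG) -(integZ _ mT i1) (integ_EFin i2 mT).
  by apply: eq_integral => x _; exact: FG.
have E2 := integral21_prod_meas1 iG.
move: iF iG => _ _ iH; split; first exact: i1.
have [iH1 eH1] := integrable_shear iH.
rewrite /Rintegral eH1 -(integral21_prod_meas1 iH1).
transitivity (fine (\int[mu2]_z (G z)%:E)); last by rewrite EG.
congr fine; rewrite -[RHS]E2; apply: eq_integral => r _; rewrite /fubini_G -[RHS]FH.
by apply: eq_integral => x _ /=; rewrite (eH (x, r)).
Qed.

End WeakForm.

(** * Tent test functions and local continuity of the Laplacian *)

Section Tents.
Context {R : realType}.
Local Notation mu := (@lebesgue_measure R).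
Local Notation mu2 := ((@lebesgue_measure R) \x (@lebesgue_measure R))%E.
Implicit Types (f g u v a b : R -> R) (s x y r l e c t C : R) (D : set R).

Definition tent x e y : R := Num.max 0 (e - `|y - x|).

Lemma tent_ge0 x e y : 0 <= tent x e y.
Proof. by rewrite le_max lexx. Qed.

Lemma tent_le x e y : 0 <= e -> tent x e y <= e.
Proof. by move=> e0; rewrite ge_max e0 gerBl normr_ge0. Qed.

Lemma tent_eq0 x e y : e <= `|y - x| -> tent x e y = 0.
Proof. by move=> h; rewrite /tent max_l// subr_le0. Qed.

Lemma tent_neq0 x e y : tent x e y != 0 -> `|y - x| < e.
Proof. by apply: contraNT; rewrite -leNgt => /tent_eq0/eqP. Qed.

Lemma continuous_tent x e : continuous (tent x e).
Proof.
move=> y.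
have c1 : {for y, continuous (fun y => e - `|y - x|)}.
  apply: continuousB; first exact: cvg_cst.
  by apply: cvg_norm; apply: continuousB; [exact: cvg_id|exact: cvg_cst].
have -> : tent x e = (fun y => ((e - `|y - x|) + `|e - `|y - x| |) / 2).
  by apply/funext => z; rewrite /tent maxr_absE add0r sub0r normrN.
apply: (@continuousM R R (fun z => (e - `|z - x|) + `|e - `|z - x| |) (fun=> 2^-1)); last exact: cvg_cst.
by apply: continuousD => //; exact: cvg_norm.
Qed.

Lemma tent_lip x e y z : `|tent x e y - tent x e z| <= `|y - z|.
Proof.
wlog : y z / tent x e z <= tent x e y.
  move=> H; case: (leP (tent x e z) (tent x e y)); first exact: H.
  by move=> /ltW; rewrite distrC (distrC y); exact: H.
move=> zy; rewrite ger0_norm ?subr_ge0//.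
have [->|/tent_neq0 h] := eqVneq (tent x e y) 0.
  by rewrite sub0r (le_trans _ (normr_ge0 _))// oppr_le0 tent_ge0.
have -> : tent x e y = e - `|y - x| by rewrite /tent max_r// subr_ge0 ltW.
have : e - `|z - x| <= tent x e z by rewrite le_max lexx orbT.
by have := ler_distD y z x; rewrite (distrC z y); lra.
Qed.

Lemma intble_restrict D g : measurable D -> (forall x, ~ D x -> g x = 0) ->
  intble D g -> intble setT g.
Proof.
move=> mD g0 ig.
have := (@integrable_mkcond _ _ _ mu D (EFin \o g) mD).1 ig.
congr (_.-integrable _ _); apply/funext => x; rewrite patchE /=.
by case: ifPn => // /negP; rewrite inE => xD; rewrite g0.
Qed.

Lemma integ_restrict D g : measurable D -> (forall x, ~ D x -> g x = 0) ->
  integ D g = integ setT g.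
Proof.
move=> mD g0; rewrite !integE /Rintegral integral_mkcond; congr fine.
apply: eq_integral => x _; rewrite patchE /=.
by case: ifPn => // /negP; rewrite inE => xD; rewrite g0.
Qed.

Lemma integ_tent_gt0 x e : 0 < e -> intble setT (tent x e) -> 0 < integ setT (tent x e).
Proof.
move=> e0 it; pose J := [set` `]x - e / 2, x + e / 2]].
have mJ : measurable J by exact: measurable_itv.
have lJ : mu J = e%:E.
  rewrite /J lebesgue_measure_itv/= lte_fin ifT; last by lra.
  by rewrite -EFinD; congr EFin; lra.
pose w y := if y \in J then e / 2 else 0.
have w0 y : ~ J y -> w y = 0 by move=> Jy; rewrite /w memNset.
have wJ y : J y -> w y = e / 2 by move=> Jy; rewrite /w mem_set.
have ic : intble J (fun=> e / 2).
  by apply: intble_cont; apply: continuous_subspaceT => z; exact: cvg_cst.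
have iw : intble J w by apply: (intble_eq mJ _ ic) => y Jy; rewrite wJ.
apply: (@lt_le_trans _ _ (integ setT w)).
  rewrite -(integ_restrict mJ w0) (@integ_eq _ _ _ (fun=> e / 2))//.
  by rewrite (integ_cst _ mJ lJ) mulr_gt0// divr_gt0.
apply: integ_le => //; first exact: intble_restrict iw.
move=> y _; have [|] := pselect (J y); last by move=> /w0 ->; exact: tent_ge0.
move=> Jy; rewrite wJ//; move: Jy; rewrite /J/= in_itv/= => /andP[y1 y2].
rewrite /tent le_max; apply/orP; right.
have : `|y - x| <= e / 2 by rewrite ler_norml; apply/andP; split; lra.
by lra.
Qed.

Section Energy.
Variables (s : R) (hs : 0 < s < 1) (v : R -> R).
Hypotheses (cv : continuous v) (v0 : forall x, 1 <= `|x| -> v x = 0)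
  (v1 : forall x, 0 <= v x <= 1) (vl : forall x y, `|v x - v y| <= `|x - y|).

Let J := [set` `]-1 : R, 1]].
Let mJ : measurable J. Proof. exact: measurable_itv. Qed.
Let a x : R := if x \in J then 1 else 0.

Let a_ge0 x : 0 <= a x. Proof. by rewrite /a; case: ifP. Qed.

Let aJ x : v x != 0 -> a x = 1.
Proof.
move=> vx; rewrite /a mem_set// /J/= in_itv/=.
have : `|x| < 1 by rewrite ltNge; apply: contra vx => /v0 ->.
by rewrite ltr_norml => /andP[-> /ltW].
Qed.

Let ia : intble setT a.
Proof.
apply: (@intble_restrict J) => //; first by move=> x xJ; rewrite /a memNset.
have ic : intble J (fun=> 1).
  by apply: intble_cont; apply: continuous_subspaceT => z; exact: cvg_cst.
by apply: (intble_eq mJ _ ic) => y Jy; rewrite /a mem_set.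
Qed.

Lemma measurable_gagliardo_kernel f : measurable_fun setT f ->
  measurable_fun setT (fun z : R * R => `|f z.1 - f z.2| ^+ 2 / frac_kernel s z).
Proof.
move=> mf; have mG := measurable_gagliardo s mf.
apply: eq_measurable_fun mG => z _ /=.
rewrite real_normK ?num_real//; congr (_ * _); rewrite /frac_kernel -powRN.
by congr (_ `^ _); ring.
Qed.

(** The squared difference is at most min(|x - y|^2, 1) and vanishes unless one of the points is in
    the support. So the integrand is dominated by the truncated kernel times the indicator of an
    interval in x or in y. *)
Lemma lipschitz_energy_lty :
  (\int[mu2]_z (`|v z.1 - v z.2| ^+ 2 / frac_kernel s z)%:E < +oo)%E.
Proof.
pose T := trunc_kernel s.
have iT := intble_trunc_kernel hs; have mT := @measurable_trunc_kernel R s.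
have mv := cont_measurable cv (@measurableT _ R).
have ma := intble_measurable ia.
have pw (z : R * R) : `|v z.1 - v z.2| ^+ 2 / frac_kernel s z <=
    a z.1 * T (z.2 - z.1) + a z.2 * T (z.1 - z.2).
  have -> : T (z.1 - z.2) = T (z.2 - z.1) by rewrite -[RHS]trunc_kernelN opprB.
  rewrite -mulrDl; have T0 := trunc_kernel_ge0 s (z.2 - z.1).
  have [/andP[/eqP -> /eqP ->]|nz] := boolP ((v z.1 == 0) && (v z.2 == 0)).
    by rewrite subrr normr0 expr0n/= mul0r mulr_ge0// addr_ge0.
  apply: (@le_trans _ _ (T (z.2 - z.1))); last first.
    by rewrite ler_peMl//; move: nz; rewrite negb_and => /orP[] /aJ ->; rewrite ?lerDl ?lerDr.
  rewrite /T /trunc_kernel /frac_kernel (distrC z.1).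
  have -> : (`|z.2 - z.1| `^ (1 + 2 * s))^-1 = `|z.2 - z.1| `^ (- (2 * s) - 1).
    by rewrite -powRN; congr (_ `^ _); ring.
  rewrite ler_wpM2r ?powR_ge0// le_min; apply/andP; split.
    by rewrite -(real_normK (num_real (z.2 - z.1))) lerXn2r ?nnegrE// distrC.
  rewrite expr_le1// ler_norml.
  have /andP[h1 h2] := v1 z.1; have /andP[h3 h4] := v1 z.2.
  by apply/andP; split; move: h1 h2 h3 h4; goal_lra.
have m12 : measurable_fun setT (fun z : R * R => a z.1 * T (z.2 - z.1)).
  apply: measurable_funM; first exact: measurable_comp_fst.
  apply: (measurableT_comp mT); apply: measurable_funB.
    exact: (@measurable_comp_snd _ id).
  exact: (@measurable_comp_fst _ id).
have m21 : measurable_fun setT (fun z : R * R => a z.2 * T (z.1 - z.2)).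
  apply: measurable_funM; first exact: measurable_comp_snd.
  apply: (measurableT_comp mT); apply: measurable_funB.
    exact: (@measurable_comp_fst _ id).
  exact: (@measurable_comp_snd _ id).
have p12 (z : R * R) : 0 <= a z.1 * T (z.2 - z.1) by rewrite mulr_ge0// trunc_kernel_ge0.
have p21 (z : R * R) : 0 <= a z.2 * T (z.1 - z.2) by rewrite mulr_ge0// trunc_kernel_ge0.
have E12 : (\int[mu2]_z (a z.1 * T (z.2 - z.1))%:E < +oo)%E.
  rewrite (ge0_integral_shear (H := fun z : R * R => (a z.1 * T (z.2 - z.1))%:E)); last 2 first.
  - exact/measurable_EFinP.
  - by move=> z; rewrite lee_fin.
  under eq_integral => z _ do rewrite /= addrK.
  by rewrite ge0_integral_tensor ?ltry//; exact: trunc_kernel_ge0.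
have E21 : (\int[mu2]_z (a z.2 * T (z.1 - z.2))%:E < +oo)%E.
  rewrite (ge0_integral_swap (H := fun z : R * R => (a z.2 * T (z.1 - z.2))%:E))//.
  - exact/measurable_EFinP.
apply: (@le_lt_trans _ _ (\int[mu2]_z ((a z.1 * T (z.2 - z.1))%:E + (a z.2 * T (z.1 - z.2))%:E))%E).
  apply: ge0_le_integral => //.
  - by move=> z _; rewrite lee_fin mulr_ge0// invr_ge0 powR_ge0.
  - by apply/measurable_EFinP; exact: measurable_gagliardo_kernel.
  - by apply/measurable_EFinP; exact: measurable_funD.
  - by move=> z _; rewrite -EFinD lee_fin.
rewrite ge0_integralD//.
- exact: lte_add_pinfty E12 E21.
- by move=> z _; rewrite lee_fin.
- exact/measurable_EFinP.
- by move=> z _; rewrite lee_fin.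
- exact/measurable_EFinP.
Qed.

Lemma lipschitz_fracSobolev0 : fracSobolev0 s `]-1, 1[%classic v.
Proof.
have mv := cont_measurable cv (@measurableT _ R).
have iv2 : intble setT (fun x => v x * v x).
  apply: intble_compact_support => [x|x x1]; last by rewrite v0// mul0r.
  by apply: (@continuousM R R v v); exact: cv.
split; [split; last exact: lipschitz_energy_lty|].
  rewrite inE; apply/andP; split; rewrite inE//=.
  rewrite /finite_norm unlock; apply: poweR_lty.
  have -> : (\int[mu]_x `|(EFin \o v) x| `^ 2 = \int[mu]_x (v x * v x)%:E)%E.
    apply: eq_integral => x _ /=; rewrite powR_mulrn//.
    by rewrite real_normK ?num_real// expr2.
  by rewrite -(integ_EFin iv2)// ltry.
apply: aeW => x /=; rewrite in_itv/= => xI; apply: v0; rewrite leNgt.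
by apply/negP; rewrite ltr_norml.
Qed.

End Energy.
Lemma fracLap_near f s x C d : 0 < s < 1 -> continuous f -> (forall y, 1 <= `|y| -> f y = 0) ->
  0 < d -> 0 <= C ->
  (forall y r, `|y - x| < d -> `|sdiff f y r| <= C * Num.min (r ^+ 2) 1) ->
  (forall y, `|y - x| < d -> intble `]0, +oo[ (fun r => sdiff f y r * r `^ (- (2 * s) - 1))) /\
  forall e, 0 < e -> exists2 d', 0 < d' & forall y, `|y - x| < d' ->
    `|fracLap s f y - fracLap s f x| <= e.
Proof.
move=> hs cf f0 d0 C0 HC; have /andP[s0 s1] := hs.
pose I := [set` `]0 : R, +oo[]; have mI : measurable I by exact: measurable_itv.
pose k r := r `^ (- (2 * s) - 1).
have iD : forall y, `|y - x| < d -> intble I (fun r => sdiff f y r * k r).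
  move=> y yx; apply: (@intble_le _ _ _ (fun r => C * trunc_kernel s r)) => //.
  - apply: measurable_funM; last exact: measurable_powR_cst.
    by apply: cont_measurable => //; exact: sdiff_continuous.
  - move=> r; rewrite /I/= in_itv/= andbT => r0; rewrite normrM (ger0_norm (powR_ge0 _ _)).
    by rewrite /trunc_kernel (gtr0_norm r0) mulrA ler_wpM2r ?powR_ge0// HC.
  - by apply: intbleZ => //; apply: (intbleS _ _ _ (intble_trunc_kernel hs)).
split=> // e e0.
pose p := 2 - 2 * s; have p0 : 0 < p by rewrite /p; lra.
pose A := 2 * C + 1; have A0 : 0 < A by rewrite /A; lra.
(* Chosen so that the range r <= kap contributes A kap^p / p = e/2. The modulus e/8/K at the scale t
   below makes the range r > kap contribute the other half. *)
pose kap := (e * p / (2 * A)) `^ p^-1.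
have ep : 0 < e * p / (2 * A) by rewrite divr_gt0 ?mulr_gt0.
have kap0 : 0 < kap by rewrite powR_gt0.
have kapp : kap `^ p = e * p / (2 * A) by rewrite /kap -powRrM mulVf ?gt_eqF// powRr1// ltW.
have q0 : 0 < 2 * s by rewrite mulr_gt0.
have K0 : 0 < kap `^ (- (2 * s)) / (2 * s) by rewrite divr_gt0 ?powR_gt0.
pose K := kap `^ (- (2 * s)) / (2 * s).
have [t t0 Ht] := uniform_continuity cf f0 (divr_gt0 (divr_gt0 e0 (ltr0Sn R 7)) K0).
exists (Num.min d t); first by rewrite lt_min d0.
move=> y; rewrite lt_min => /andP[yd yt].
have xd : `|x - x| < d by rewrite subrr normr0.
have iy := iD y yd; have ix := iD x xd.
pose T r := (sdiff f x r - sdiff f y r) * k r.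
have iT : intble I T.
  by apply: (intble_eq mI _ (intbleB mI ix iy)) => r _; rewrite /T /=; ring.
have -> : fracLap s f y - fracLap s f x = integ I T.
  rewrite /fracLap -/I opprK addrC -integB//.
  by apply: integ_eq => r _; rewrite /T /k; ring.
have [iT1 iT2] := intble_sub (ltW kap0) iT.
rewrite (integ_split (ltW kap0) iT).
apply: (le_trans (ler_normD _ _)); rewrite [leRHS]splitr; apply: lerD.
  apply: (le_trans (integ_norm (measurable_itv _) iT1)).
  have i1 : intble `]0, kap] (fun r => A * r `^ (p - 1)).
    by apply: intbleZ; [exact: measurable_itv|exact: intble_0].
  apply: (@le_trans _ _ (integ `]0, kap] (fun r => A * r `^ (p - 1)))).
    apply: integ_le => //; first exact: intble_norm.
    move=> r; rewrite /= in_itv/= => /andP[r0 _].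
    rewrite /T normrM (ger0_norm (powR_ge0 _ _)).
    have -> : r `^ (p - 1) = r ^+ 2 * k r.
      rewrite /k -(powR_mulrn 2 (ltW r0)) -powRD ?(gt_eqF r0) ?implybT//.
      by congr (_ `^ _); rewrite /p; ring.
    rewrite mulrA ler_wpM2r ?powR_ge0//.
    have h1 : C * Num.min (r ^+ 2) 1 <= C * r ^+ 2 by rewrite ler_wpM2l// ge_min lexx.
    have h2 := HC x r xd; have h3 := HC y r yd; have h4 := sqr_ge0 r.
    apply: (le_trans (ler_normB _ _)); rewrite /A mulrDl mul1r -mulrA.
    by move: h1 h2 h3 h4; goal_lra.
  rewrite integZ//; last exact: intble_0.
  have : A * integ `]0, kap] (fun r => r `^ (p - 1)) <= A * (kap `^ p / p).
    by rewrite ler_wpM2l ?(ltW A0)// integ_0_le.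
  move=> /le_trans; apply; rewrite kapp le_eqVlt; apply/orP; left; apply/eqP; field.
  by rewrite !gt_eqF.
apply: (le_trans (integ_norm (measurable_itv _) iT2)).
have i2 : intble `]kap, +oo[ (fun r => 4 * (e / 8 / K) * k r).
  by apply: intbleZ; [exact: measurable_itv|exact: intble_y].
apply: (@le_trans _ _ (integ `]kap, +oo[ (fun r => 4 * (e / 8 / K) * k r))).
  apply: integ_le => //; first exact: intble_norm.
  move=> r _; rewrite /T normrM (ger0_norm (powR_ge0 _ _)) ler_wpM2r ?powR_ge0//.
  have hd z : `|(x + z) - (y + z)| <= t.
    by rewrite (_ : _ - _ = x - y) 1?distrC ?ltW//; ring.
  have := Ht _ _ (hd r); have := Ht _ _ (hd (- r)); have := Ht _ _ (hd 0).
  rewrite !addr0 /sdiff -/K !ler_norml => /andP[h1 h2] /andP[h3 h4] /andP[h5 h6].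
  by apply/andP; split; move: h1 h2 h3 h4 h5 h6; goal_lra.
rewrite integZ//; last exact: intble_y.
rewrite integ_y// -/K le_eqVlt; apply/orP; left; apply/eqP; field.
by rewrite gt_eqF.
Qed.

End Tents.

(** * The pointwise equation by localisation *)

Section Pointwise.
Context {R : realType}.
Local Notation mu := (@lebesgue_measure R).
Local Notation mu2 := ((@lebesgue_measure R) \x (@lebesgue_measure R))%E.
Implicit Types (f g u v a b : R -> R) (s x y r l e c t C : R) (D : set R).

Lemma sdiff_bound f f1 f2 x : continuous f -> (forall y, 1 <= `|y| -> f y = 0) -> `|x| < 1 ->
  (forall y, `|y| < 1 -> is_derive y 1 f (f1 y)) ->
  (forall y, `|y| < 1 -> is_derive y 1 f1 (f2 y)) ->
  (forall y, `|y| < 1 -> {for y, continuous f2}) ->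
  exists C d, [/\ 0 < d, 0 <= C &
    forall y r, `|y - x| < d -> `|sdiff f y r| <= C * Num.min (r ^+ 2) 1].
Proof.
move=> cf f0 x1 d1 d2 c2.
have [B fB] := cont_bounded cf f0.
have B0 : 0 <= B by apply: le_trans (fB 0).
pose d := (1 - `|x|) / 4; have d0 : 0 < d by rewrite divr_gt0// subr_gt0.
have inI y : `|y - x| <= 2 * d -> `|y| < 1.
  have dE : d = (1 - `|x|) / 4 by [].
  have := ler_normD x (y - x); rewrite addrCA subrr addr0.
  by move: dE d0; lra.
have [M HM] : exists M, forall y, `|y - x| <= 2 * d -> `|f2 y| <= M.
  have le2 : x - 2 * d <= x + 2 * d by move: d0; lra.
  have [|c _ Hc] := @EVT_max R (fun y => `|f2 y|) _ _ le2.
    apply: continuous_in_subspaceT => y /set_mem/=; rewrite in_itv/= => yI.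
    by apply: cvg_norm; apply: c2; apply: inI; rewrite ler_distl.
  exists `|f2 c| => y yI; apply: Hc.
  by rewrite in_itv/= -ler_distl.
have M0 : 0 <= M by apply: le_trans (HM x _); rewrite ?subrr ?normr0//; move: d0; lra.
have dd : 0 < d ^+ 2 by rewrite exprn_gt0.
(* The three terms serve r <= d with second derivative bound M, r > 1, and d < r <= 1, where 4B is
   at most (4B/d^2) r^2. *)
pose C := M + 4 * B + 4 * B / d ^+ 2.
have Bd : 0 <= 4 * B / d ^+ 2 by apply: divr_ge0; [rewrite mulr_ge0|exact: ltW].
exists C, d; split => //; first by rewrite /C; move: M0 B0 Bd; goal_lra.
have main y r : `|y - x| < d -> 0 <= r -> `|sdiff f y r| <= C * Num.min (r ^+ 2) 1.
  move=> yx r0.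
  have SB : `|sdiff f y r| <= 4 * B.
    have := fB (y + r); have := fB (y - r); have := fB y; rewrite /sdiff !ler_norml.
    move=> /andP[h1 h2] /andP[h3 h4] /andP[h5 h6].
    by apply/andP; split; move: h1 h2 h3 h4 h5 h6; goal_lra.
  have [r1|r1] := leP (r ^+ 2) 1; last first.
    by rewrite mulr1 (le_trans SB)// /C; move: M0 B0 Bd; goal_lra.
  have [rd|rd] := leP r d; last first.
    apply: (le_trans SB); apply: (@le_trans _ _ (4 * B / d ^+ 2 * r ^+ 2)); last first.
      by rewrite ler_wpM2r ?sqr_ge0// /C; move: M0 B0; goal_lra.
    rewrite -mulrA ler_peMr ?mulr_ge0// mulrC ler_pdivlMr// mul1r.
    by rewrite lerXn2r ?nnegrE// ltW.
  have yI z : `|z - y| <= r -> `|z - x| <= 2 * d.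
    by have := ler_distD y z x; move: rd yx; goal_lra.
  have dz1 z : `|z - y| <= r -> is_derive z 1 f (f1 z) by move=> h; apply/d1/inI/yI.
  have dz2 z : `|z - y| <= r -> is_derive z 1 f1 (f2 z) by move=> h; apply/d2/inI/yI.
  have up : sdiff f y r <= M * r ^+ 2.
    apply: (sdiff_le_second r0 dz1 dz2) => z /yI /HM; exact: le_trans (ler_norm _).
  have lo : - M * r ^+ 2 <= sdiff f y r.
    by apply: (sdiff_ge_second r0 dz1 dz2) => z /yI /HM; rewrite ler_norml => /andP[].
  have MC : M * r ^+ 2 <= C * r ^+ 2.
    by rewrite ler_wpM2r ?sqr_ge0// /C; move: B0 Bd; goal_lra.
  by rewrite ler_norml; apply/andP; split; move: up lo MC; rewrite ?mulNr; goal_lra.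
move=> y r yx; case: (leP 0 r) => r0; first exact: main.
by rewrite -sdiffNr -sqrrN; apply: main => //; rewrite oppr_ge0 ltW.
Qed.

Lemma measurable_form s f v : measurable_fun setT f -> measurable_fun setT v ->
  measurable_fun setT (fun z => (f z.1 - f z.2) * (v z.1 - v z.2) / frac_kernel s z).
Proof.
move=> mf mv.
have md g : measurable_fun setT g -> measurable_fun setT (fun z : R * R => g z.1 - g z.2).
  by move=> mg; apply: measurable_funB; [exact: measurable_comp_fst|exact: measurable_comp_snd].
apply: measurable_funM; first by apply: measurable_funM; exact: md.
have m0 : measurable_fun setT (fun z : R * R => `|z.1 - z.2| `^ (- (1 + 2 * s))).
  apply: (measurableT_comp (measurable_powR _)).
  by apply: measurableT_comp => //; exact: (md id).
by apply: eq_measurable_fun m0 => z _; rewrite powRN.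
Qed.

Lemma integrable_form s f v : measurable_fun setT f -> measurable_fun setT v ->
  (\int[mu2]_z (`|f z.1 - f z.2| ^+ 2 / frac_kernel s z)%:E < +oo)%E ->
  (\int[mu2]_z (`|v z.1 - v z.2| ^+ 2 / frac_kernel s z)%:E < +oo)%E ->
  mu2.-integrable setT (EFin \o (fun z => (f z.1 - f z.2) * (v z.1 - v z.2) / frac_kernel s z)).
Proof.
move=> mf mv; have mform := measurable_form s mf mv.
have k0 z : 0 <= (frac_kernel s z)^-1 by rewrite invr_ge0 powR_ge0.
have p0 g (z : R * R) : 0 <= `|g z.1 - g z.2| ^+ 2 / frac_kernel s z by rewrite mulr_ge0.
have iE g : measurable_fun setT g ->
  (\int[mu2]_z (`|g z.1 - g z.2| ^+ 2 / frac_kernel s z)%:E < +oo)%E ->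
  mu2.-integrable setT (EFin \o (fun z => `|g z.1 - g z.2| ^+ 2 / frac_kernel s z)).
  move=> mg lg; apply/integrableP; split.
    by apply/measurable_EFinP; exact: measurable_gagliardo_kernel.
  by under eq_integral => z _ do rewrite /= ger0_norm//.
move=> /(iE f mf) iF /(iE v mv) iV.
apply: le_integrable (integrableD measurableT iF iV).
- exact: measurableT.
- exact/measurable_EFinP.
- move=> z _; rewrite /= lee_fin [leRHS]ger0_norm ?addr_ge0//.
  rewrite normrM (ger0_norm (k0 z)) -mulrDl ler_wpM2r// normrM.
  rewrite -subr_ge0; set A := `|f _ - _|; set B := `|v _ - _|.
  have -> : A ^+ 2 + B ^+ 2 - A * B = (A - B) ^+ 2 / 2 + (A ^+ 2 + B ^+ 2) / 2 by field.
  by rewrite addr_ge0// divr_ge0// ?addr_ge0 ?sqr_ge0.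
Qed.

(** The residual h = c (-Delta)^s f - l f is continuous in (-1, 1), and integrates to zero against
    every tent with small support. If h(x) were nonzero, a tent around x inside the region where h
    keeps its sign would contradict this. *)
Lemma weak_pointwise s f c l : 0 < s < 1 -> 0 < c -> continuous f ->
  (forall y, 1 <= `|y| -> f y = 0) ->
  (forall x, `|x| < 1 -> exists C d, [/\ 0 < d, 0 <= C &
    forall y r, `|y - x| < d -> `|sdiff f y r| <= C * Num.min (r ^+ 2) 1]) ->
  (\int[mu2]_z (`|f z.1 - f z.2| ^+ 2 / frac_kernel s z)%:E < +oo)%E ->
  (forall v, continuous v -> (forall y, 1 <= `|y| -> v y = 0) -> fracSobolev0 s `]-1, 1[%classic v ->
    c / 2 * \int[mu2]_z ((f z.1 - f z.2) * (v z.1 - v z.2) / frac_kernel s z) =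
    l * integ setT (fun x => f x * v x)) ->
  forall x, `|x| < 1 -> intble `]0, +oo[ (fun r => sdiff f x r * r `^ (- (2 * s) - 1)) /\
      fracLap s f x = l / c * f x.
Proof.
move=> hs c0 cf f0 Hsd Ef weak x x1.
have [C [d [d0 C0 HC]]] := Hsd x x1.
have [isd near] := fracLap_near hs cf f0 d0 C0 HC.
split; first by apply: isd; rewrite subrr normr0.
suff q0 : c * fracLap s f x - l * f x = 0.
  by rewrite mulrAC; apply: (mulfI (lt0r_neq0 c0)); rewrite mulrCA divff ?gt_eqF// mulr1; apply/eqP; rewrite -subr_eq0 q0.
apply/eqP; apply/negPn/negP => qn0.
pose h y := c * fracLap s f y - l * f y.
have hx0 : 0 < `|h x| by rewrite normr_gt0.
have [d1 d10 near1] := near _ (divr_gt0 (divr_gt0 hx0 (ltr0Sn R 3)) c0).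
have l1 : 0 < `|l| + 1 by rewrite ltr_wpDl.
have [d2 d20 near2] := uniform_continuity cf f0 (divr_gt0 (divr_gt0 hx0 (ltr0Sn R 3)) l1).
pose e := Num.min (Num.min d d1) (Num.min d2 (1 - `|x|)).
have e0 : 0 < e by rewrite !lt_min d0 d10 d20 subr_gt0.
have [ed ed1 ed2 ex] : [/\ e <= d, e <= d1, e <= d2 & e <= 1 - `|x|].
  by rewrite /e !ge_min !lexx ?orbT.
have e1 : e <= 1 by rewrite (le_trans ex)// gerBl normr_ge0.
pose v := tent x e.
have cv : continuous v by exact: continuous_tent.
have v0 y : 1 <= `|y| -> v y = 0.
  move=> y1; apply: tent_eq0; apply: (le_trans ex).
  by apply: le_trans (lerB_dist _ _); rewrite lerD2r.
have vl y z : `|v y - v z| <= `|y - z| by exact: tent_lip.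
have v01 y : 0 <= v y <= 1.
  by rewrite tent_ge0/= (le_trans (tent_le _ _ (ltW e0))).
have Sv := lipschitz_fracSobolev0 hs cv v0 v01 vl.
have mf := cont_measurable cf (@measurableT _ R).
have mv := cont_measurable cv (@measurableT _ R).
have HCv y r : v y != 0 -> `|sdiff f y r| <= C * Num.min (r ^+ 2) 1.
  by move=> /tent_neq0 h1; apply: HC; apply: lt_le_trans ed.
have [iL eL] := form_eq_fracLap hs cf cv f0 v0 C0 HCv
   (integrable_form mf mv Ef (lipschitz_energy_lty hs cv v0 v01 vl)).
have mT : measurable [set: R] by exact: measurableT.
have iv : intble setT v by exact: intble_compact_support.
have ifv : intble setT (fun y => f y * v y).
  apply: intble_compact_support => [y|y y1]; last by rewrite v0// mulr0.
  by apply: (@continuousM R R f v); [exact: cf|exact: cv].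
have ih : intble setT (fun y => v y * h y).
  apply: (intble_eq mT _ (intbleB mT (intbleZ c mT iL) (intbleZ l mT ifv))) => y _.
  by rewrite /h; ring.
have Z : integ setT (fun y => v y * h y) = 0.
  transitivity (integ setT (fun y => c * (v y * fracLap s f y) - l * (f y * v y))).
    by apply: integ_eq => y _; rewrite /h; ring.
  rewrite (integB mT (intbleZ c mT iL) (intbleZ l mT ifv)) !integZ//.
  rewrite -(weak v cv v0 Sv) eL mulrA -[c / 2 * 2]mulrA mulVf ?mulr1 ?subrr//.
(* Multiplying by h(x) treats both signs of the residual at once. *)
have hq y : v y != 0 -> (h x) ^+ 2 / 2 <= h y * h x.
  move=> /tent_neq0 yx.
  have n1 : `|fracLap s f y - fracLap s f x| <= `|h x| / 4 / c.
    by apply: near1; apply: lt_le_trans ed1.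
  have n2 : `|f y - f x| <= `|h x| / 4 / (`|l| + 1).
    by apply: near2; rewrite ltW// (lt_le_trans yx).
  have m1 : `|c * (fracLap s f y - fracLap s f x)| <= `|h x| / 4.
    by rewrite normrM (gtr0_norm c0) mulrC -ler_pdivlMr.
  have m2 : `|l * (f y - f x)| <= `|h x| / 4.
    rewrite normrM; apply: (@le_trans _ _ ((`|l| + 1) * `|f y - f x|)).
      by rewrite ler_wpM2r// lerDl.
    by rewrite mulrC -ler_pdivlMr.
  have m3 : `|h y - h x| <= `|h x| / 2.
    have -> : h y - h x = c * (fracLap s f y - fracLap s f x) - l * (f y - f x) by rewrite /h; ring.
    by apply: (le_trans (ler_normB _ _)); move: m1 m2; goal_lra.
  have : `|(h y - h x) * h x| <= `|h x| / 2 * `|h x| by rewrite normrM ler_wpM2r.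
  have -> : `|h x| / 2 * `|h x| = (h x) ^+ 2 / 2.
    by rewrite -(real_normK (num_real (h x))); ring.
  by rewrite ler_norml mulrBl -expr2 => /andP[]; goal_lra.
have P := integ_tent_gt0 e0 iv.
have : integ setT (fun y => (h x) ^+ 2 / 2 * v y) <= integ setT (fun y => h x * (v y * h y)).
  apply: integ_le => //; [exact: intbleZ|exact: intbleZ|].
  move=> y _; have [->|vy] := eqVneq (v y) 0; first by rewrite mulr0 mul0r mulr0.
  have := hq y vy; have /andP[vy0 _] := v01 y.
  have -> : h x * (v y * h y) = h y * h x * v y by ring.
  by move=> ?; rewrite ler_wpM2r.
rewrite !integZ// Z mulr0 => Hle.
have h2 : 0 < h x ^+ 2 by rewrite exprn_even_gt0//= -normr_gt0.
have : 0 < h x ^+ 2 / 2 * integ setT v by exact: (mulr_gt0 (divr_gt0 h2 (ltr0Sn R 1)) P).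
by rewrite ltNge Hle.
Qed.

End Pointwise.

(** * Conclusion *)

Section Constant.
Context {R : realType}.
Local Notation mu := (@lebesgue_measure R).
Implicit Types (s t z : R).

(** The cube of t/3 <= exp(t/3); hence 27 = 3^3. *)
Lemma expRN_le t : 0 < t -> expR (- t) <= 27 * t `^ (- 3).
Proof.
move=> t0; have t3 : 0 < t / 3 by rewrite divr_gt0.
have h : t / 3 <= expR (t / 3) by apply: le_trans (expR_ge1Dx _); rewrite lerDr.
have : (t / 3) ^+ 3 <= expR (t / 3) ^+ 3 by rewrite lerXn2r ?nnegrE ?expR_ge0// ltW.
have -> : expR (t / 3) ^+ 3 = expR t by rewrite -expRM_natl; congr expR; field.
move=> h3; rewrite expRN powRN (powR_mulrn 3 (ltW t0)).
rewrite -[leRHS]invrK lef_pV2 ?posrE ?expR_gt0 ?invr_gt0 ?mulr_gt0 ?invr_gt0 ?exprn_gt0//.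
apply: le_trans h3; rewrite le_eqVlt; apply/orP; left; apply/eqP; field.
by rewrite gt_eqF.
Qed.

(** Integrability has to be proved, since a divergent real-valued integral defaults to 0. For z < 2
    the integrand at t > 1 is at most 27 t^-2, and a constant on (1, 2] gives positivity. *)
Lemma euler_gamma_gt0 z : 0 < z < 2 -> 0 < euler_gamma z.
Proof.
move=> /andP[z0 z2].
pose g t := t `^ (z - 1) * expR (- t).
have mg : measurable_fun setT g.
  apply: measurable_funM; first exact: measurable_powR_cst.
  apply: (measurableT_comp (@measurable_expR R)); exact: oppr_measurable.
have g0 t : 0 <= g t by rewrite mulr_ge0 ?powR_ge0 ?expR_ge0.
have i1 : intble `]0, 1] g.
  apply: (@intble_le _ _ _ (fun t => t `^ (z - 1))) => //.
  - exact: measurable_funTS.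
  - move=> t; rewrite /= in_itv/= => /andP[t0 _]; rewrite ger0_norm// ler_piMr ?powR_ge0//.
    by rewrite -expR0 ler_expR oppr_le0 ltW.
  - exact: intble_0.
have i2 : intble `]1, +oo[ g.
  apply: (@intble_le _ _ _ (fun t => 27 * t `^ (- 1 - 1))) => //.
  - exact: measurable_funTS.
  - move=> t; rewrite /= in_itv/= andbT => t1; rewrite ger0_norm//.
    have t0 : 0 < t by exact: lt_trans t1.
    apply: (@le_trans _ _ (t `^ 1 * (27 * t `^ (- 3)))).
      apply: ler_pM; rewrite ?powR_ge0 ?expR_ge0 ?expRN_le//.
      by apply: ler_powR; [exact: ltW|lra].
    rewrite mulrCA -powRD ?(gt_eqF t0) ?implybT//.
    by rewrite le_eqVlt; apply/orP; left; apply/eqP; congr (_ * _ `^ _); lra.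
  - by apply: intbleZ => //; exact: intble_y.
have i : intble `]0, +oo[ g by apply: intble_split i1 i2.
have -> : euler_gamma z = integ `]0, +oo[ g by rewrite /euler_gamma integE.
have l12 : (1 : R) <= 2 by lra.
rewrite (integ_split ler01 i) (integ_split l12 i2) ltr_wpDl ?integ_ge0// ltr_wpDr ?integ_ge0//.
have [i12 _] := intble_sub l12 i2.
pose J := [set` `](1 : R), 2]]; have mJ : measurable J by exact: measurable_itv.
have lJ : mu J = (1 : R)%:E.
  rewrite /J lebesgue_measure_itv/= lte_fin ifT; last by lra.
  by rewrite -EFinD; congr EFin; lra.
pose c : R := 2 `^ (- 1) * expR (- 2).
have c0 : 0 < c by rewrite mulr_gt0 ?powR_gt0 ?expR_gt0.
have ic : intble J (fun=> c).
  by apply: intble_cont; apply: continuous_subspaceT => x; exact: cvg_cst.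
apply: (@lt_le_trans _ _ (integ J (fun=> c))); first by rewrite (integ_cst _ mJ lJ) mulr1.
apply: integ_le => // t; rewrite /J/= in_itv/= => /andP[t1 t2].
have t0 : 0 < t by exact: lt_trans t1.
apply: ler_pM; rewrite ?powR_ge0 ?expR_ge0//; last by rewrite ler_expR lerN2.
apply: (@le_trans _ _ (t `^ (- 1))); last by apply: ler_powR; [exact: ltW|lra].
by rewrite !powRN !powRr1 ?(ltW t0)// lef_pV2 ?posrE.
Qed.

Lemma fracLap_const_gt0 s : 0 < s < 1 -> 0 < fracLap_const 1 s.
Proof.
move=> /andP[s0 s1].
have g1 : 0 < euler_gamma (1%:R / 2 + s) by apply: euler_gamma_gt0; lra.
have g2 : 0 < euler_gamma (- s + 1%:R) by apply: euler_gamma_gt0; lra.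
have G1 : Gamma (1%:R / 2 + s) = euler_gamma (1%:R / 2 + s).
  by rewrite /Gamma ifT ?big_ord0 ?divr1 ?addr0//; move: s0; goal_lra.
(* As s < 1, one application of the functional equation is enough. *)
have G2 : Gamma (- s) = euler_gamma (- s + 1%:R) / - s.
  rewrite /Gamma ifF; last by rewrite oppr_gt0 ltNge ltW.
  have -> : Num.truncn (- - s) = 0%N by apply/truncn0Pn; rewrite opprK -ltNge.
  by rewrite big_ord1 addr0.
rewrite /fracLap_const G1 G2; apply: divr_gt0; apply: mulr_gt0.
- exact: powR_gt0.
- exact: g1.
- by rewrite powR_gt0 ?pi_gt0.
- by rewrite normr_gt0 mulf_neq0// ?invr_eq0 ?oppr_eq0 gt_eqF.
Qed.

End Constant.

(** * Passing to the representative that vanishes outside the interval *)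

Section Representative.
Context {R : realType}.
Local Notation mu := (@lebesgue_measure R).
Local Notation mu2 := ((@lebesgue_measure R) \x (@lebesgue_measure R))%E.
Implicit Types (f g u v phi : R -> R) (s x y r l c : R).

Lemma ae_product (P : R -> Prop) : {ae mu, forall x, P x} ->
  {ae mu2, forall z : R * R, P z.1 /\ P z.2}.
Proof.
move=> [N [mN N0 PN]].
have mT : measurable [set: R] by exact: measurableT.
have n1 : mu2.-negligible (N `*` [set: R]).
  exists (N `*` [set: R]); split => //; first exact: measurableX.
  by transitivity (mu N * mu setT)%E; [exact: product_measure1E|rewrite N0 mul0e].
have n2 : mu2.-negligible ([set: R] `*` N).
  exists ([set: R] `*` N); split => //; first exact: measurableX.
  by transitivity (mu setT * mu N)%E; [exact: product_measure1E|rewrite N0 mule0].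
apply: negligibleS (negligibleU n1 n2) => z /= /not_andP[h|h].
- by left; split => //; exact: PN.
- by right; split => //; exact: PN.
Qed.

Lemma energy_ae_eq s f g : measurable_fun setT f -> measurable_fun setT g ->
  {ae mu, forall x, f x = g x} ->
  (\int[mu2]_z (`|f z.1 - f z.2| ^+ 2 / frac_kernel s z)%:E =
   \int[mu2]_z (`|g z.1 - g z.2| ^+ 2 / frac_kernel s z)%:E)%E.
Proof.
move=> mf mg fg; apply: ge0_ae_eq_integral.
- exact: measurableT.
- by apply/measurable_EFinP; exact: measurable_gagliardo_kernel.
- by apply/measurable_EFinP; exact: measurable_gagliardo_kernel.
- by move=> z _; rewrite lee_fin divr_ge0 ?sqr_ge0 ?powR_ge0.
- by move=> z _; rewrite lee_fin divr_ge0 ?sqr_ge0 ?powR_ge0.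
- by apply: negligibleS (ae_product fg) => z; apply: contra_not => -[e1 e2] _; rewrite e1 e2.
Qed.

Lemma form_ae_eq s f g v : measurable_fun setT f -> measurable_fun setT g ->
  measurable_fun setT v -> {ae mu, forall x, f x = g x} ->
  \int[mu2]_z ((f z.1 - f z.2) * (v z.1 - v z.2) / frac_kernel s z) =
  \int[mu2]_z ((g z.1 - g z.2) * (v z.1 - v z.2) / frac_kernel s z).
Proof.
move=> mf mg mv fg; congr fine; apply: ae_eq_integral.
- exact: measurableT.
- by apply/measurable_EFinP; exact: measurable_form.
- by apply/measurable_EFinP; exact: measurable_form.
- by apply: negligibleS (ae_product fg) => z; apply: contra_not => -[e1 e2] _; rewrite e1 e2.
Qed.

Lemma smooth_is_derive phi n x : smooth_in `]-1, 1[%classic phi -> `|x| < 1 ->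
  is_derive x 1 (derive1n n phi) (derive1n n.+1 phi x).
Proof.
move=> sm x1; have H : derivable (derive1n n phi) x 1.
  by apply: sm; rewrite /= in_itv/= -ltr_norml.
by rewrite derive1nS derive1E; exact/derivableP.
Qed.

(** [phi] vanishes outside the interval only almost everywhere, so continuity is claimed for the
    corrected function f. The energy and the bilinear form ignore null sets, since the pairs with a
    coordinate in a null set form a null set of the plane. *)
Lemma eigenfunction_eigenpair s l phi f : 1 / 2 < s < 1 ->
  frac_eigenfunction s `]-1, 1[%classic l phi ->
  smooth_in `]-1, 1[%classic phi ->
  (forall x, `|x| < 1 -> 0 < phi x) ->
  (forall x, `|x| < 1 -> f x = phi x) -> (forall x, 1 <= `|x| -> f x = 0) ->
  (forall x, `|x| < 1 -> is_derive x 1 f (derive1n 1 phi x)) ->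
  eigenpair s (l / fracLap_const 1 s) f.
Proof.
move=> hs [[[Lphi Ephi] phi0] _ weak] sm pos fphi f0 df.
have hs' : 0 < s < 1 by move: hs => /andP[h1 h2]; apply/andP; split; move: h1 h2; lra.
have c0 := fracLap_const_gt0 hs'.
have mphi : measurable_fun setT phi.
  by move: Lphi; rewrite inE => /andP[]; rewrite inE.
have inI x : `]-1, 1[%classic x <-> `|x| < 1 by rewrite /= in_itv/= -ltr_norml.
have mD : measurable `]-1 : R, 1[%classic by exact: measurable_itv.
have mf : measurable_fun setT f.
  have -> : f = phi \_ `]-1, 1[%classic.
    apply/funext => x; rewrite patchE; case: ifPn => [/set_mem/inI/fphi//|].
    by move=> /negP; rewrite inE => xD; apply: f0; rewrite leNgt; apply/negP => /inI.
  by apply/(measurable_restrictT _ mD); exact: measurable_funTS.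
have ae : {ae mu, forall x, phi x = f x}.
  apply: negligibleS phi0 => x; apply: contra_not => /= px.
  case: (ltP `|x| 1) => x1; first by rewrite fphi.
  by rewrite f0// px// => /inI; rewrite ltNge x1.
have Ef : (\int[mu2]_z (`|f z.1 - f z.2| ^+ 2 / frac_kernel s z)%:E < +oo)%E.
  by rewrite -(energy_ae_eq s mphi mf ae).
have d1 n x := @smooth_is_derive phi n x sm.
have cI x : `|x| < 1 -> {for x, continuous f} by move=> /df/is_derive_cont.
have cf : continuous f.
  pose E := (\int[mu2]_z (`|f z.1 - f z.2| ^+ 2 / frac_kernel s z)%:E)%E.
  have E0 : (0 <= E)%E.
    by apply: integral_ge0 => z _; rewrite lee_fin divr_ge0 ?sqr_ge0 ?powR_ge0.
  have fE : E \is a fin_num by rewrite ge0_fin_numE.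
  apply: (@morrey_continuous R f s (fine E)) => //; last exact: fine_ge0.
  rewrite fineK// /E le_eqVlt; apply/orP; left; apply/eqP.
  have mG := measurable_gagliardo s mf.
  transitivity (\int[mu2]_z ((f z.1 - f z.2) ^+ 2 * `|z.1 - z.2| `^ (- (2 * s) - 1))%:E)%E.
    apply/esym; apply: (@fubini_tonelli1 _ _ _ _ R mu mu
      (fun z : R * R => ((f z.1 - f z.2) ^+ 2 * `|z.1 - z.2| `^ (- (2 * s) - 1))%:E)).
      exact/measurable_EFinP.
    by move=> z; rewrite lee_fin mulr_ge0 ?sqr_ge0 ?powR_ge0.
  apply: eq_integral => z _; rewrite real_normK ?num_real// /frac_kernel -powRN.
  by congr ((_ * _ `^ _)%:E); ring.
split => //; first by move=> x x1; rewrite fphi// pos.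
apply: (weak_pointwise hs' c0 cf f0 _ Ef).
  move=> x x1; apply: (sdiff_bound cf f0 x1 df (d1 1%N)).
  by move=> y y1; exact: is_derive_cont (d1 2%N y y1).
move=> v cv v0 Sv.
have mv := cont_measurable cv (@measurableT _ R).
rewrite -(form_ae_eq s mphi mf mv ae).
have := weak v Sv; rewrite /frac_form => ->; congr (_ * _).
rewrite -(@integ_restrict R `]-1, 1[%classic)//; last first.
  by move=> x xD; rewrite v0 ?mulr0// leNgt; apply/negP => /inI.
by rewrite integE; apply: eq_Rintegral => x /set_mem/inI x1; rewrite fphi.
Qed.

End Representative.

Theorem theorem1p1 (R : realType) (s : R) (hs : 1 / 2 < s < 1)
    (phi : R -> R)
    (hphi : first_frac_eigenfunction s `]-1, 1[%classic phi)
    (hsmooth : smooth_in `]-1, 1[%classic phi)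
    (hpos : forall x : R, -1 < x < 1 -> 0 < phi x) :
  forall x : R, -1 < x < 1 -> derive1n 2 phi x < 0.
Proof.
have [l _ Hphi] := hphi.
pose f (x : R) := if `|x| < 1 then phi x else 0.
have fphi (x : R) : `|x| < 1 -> f x = phi x by rewrite /f => ->.
have f0 (x : R) : 1 <= `|x| -> f x = 0 by rewrite /f ltNge => ->.
(* Only the first derivative must pass from [phi] to [f]: it is expressed by [derive1n 1 phi], and
   all further derivatives are then those of [phi]. *)
have df (x : R) : `|x| < 1 -> is_derive x 1 f (derive1n 1 phi x).
  move=> x1; apply: near_eq_is_derive (@smooth_is_derive R phi 0 x hsmooth x1).
  have x10 : 0 < 1 - `|x| by rewrite subr_gt0.
  apply/nbhs_ballP; exists (1 - `|x|) => //= y xy; rewrite fphi//.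
  by move: xy; rewrite /ball/= distrC; have := ler_distD x y 0; rewrite !subr0; lra.
have pos (x : R) : `|x| < 1 -> 0 < phi x by rewrite ltr_norml; exact: hpos.
have E := eigenfunction_eigenpair hs Hphi hsmooth pos fphi f0 df.
have d n (x : R) := @smooth_is_derive R phi n x hsmooth.
move=> x; rewrite -ltr_norml; move: x.
apply: (eigenpair_second_derive_lt0 hs E df (d 1%N) (d 2%N) (d 3%N)).
by move=> x x1; exact: is_derive_cont (d 4%N x x1).
Qed.
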